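(* Let $V(q)=1-\cos(q)$ on $2\pi\mathbb T$ and fix $\gamma>0$. The matrix $\widehat{\mathbf L}_{KL}$ is invertible for $K,L$ sufficiently large. More precisely, there is $C\ge 1$ (independent of $K,L,\gamma$) such that, for $K,L$ sufficiently large, $\Pi_{KL,0}\mathcal L\Pi_{KL,0}$ is invertible on $V_{KL,0}$ with resolvent bound $$\big\|(\Pi_{KL,0}\mathcal L\Pi_{KL,0})^{-1}\big\|_{\mathcal B(V_{KL,0})}\le\frac{C}{\widehat\lambda_{\gamma,KL}}$$ for some $\widehat\lambda_{\gamma,KL}>0$ satisfying $$\widehat\lambda_{\gamma,KL}\ \ge\ \lambda_\gamma-\frac{\varepsilon}{1+\varepsilon}\left[\frac{(1+\sqrt2)\,\beta}{2K}+\frac{\beta^3}{16}\,\frac{\|(1-\Pi^q_{K-1})\mathbf 1\|^2}{1-\|(1-\Pi^q_K)\mathbf 1\|^2}\right].$$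
   Context: Setting. $\beta,\gamma>0$, mass $m=1$, dimension $1$, position space $2\pi\mathbb T=\mathbb R/2\pi\mathbb Z$. Probability measures: $\mu(dq\,dp)=Z_\mu^{-1}\mathrm e^{-\beta(V(q)+p^2/2)}dq\,dp$ on $2\pi\mathbb T\times\mathbb R$, with marginals $\nu(dq)=Z_\nu^{-1}\mathrm e^{-\beta V(q)}dq$ and $\kappa(dp)=(\beta/(2\pi))^{1/2}\mathrm e^{-\beta p^2/2}dp$. $\langle\cdot,\cdot\rangle,\|\cdot\|$: scalar product and norm of $L^2(\mu)$; $^*$: adjoint on $L^2(\mu)$; $\mathbf 1$: constant function 1; $\mathcal B(E)$: bounded operators on $E$ with operator norm. $L_0^2(\mu)=\{\varphi\in L^2(\mu):\int\varphi\,d\mu=0\}$ and $\Pi_0\varphi=\varphi-\int\varphi\,d\mu$. Operators: $\mathcal L=\mathcal L_{\mathrm{ham}}+\gamma\mathcal L_{\mathrm{FD}}$, $\mathcal L_{\mathrm{ham}}=p\,\partial_q-V'(q)\partial_p$, $\mathcal L_{\mathrm{FD}}=-p\,\partial_p+\frac1\beta\partial_p^2$; $(\Pi_p\varphi)(q)=\int_{\mathbb R}\varphi(q,p)\kappa(dp)$; $A=\big(1+(\mathcal L_{\mathrm{ham}}\Pi_p)^*(\mathcal L_{\mathrm{ham}}\Pi_p)\big)^{-1}(\mathcal L_{\mathrm{ham}}\Pi_p)^*$. Basis: the orthonormal family of $L^2(\nu)$ given by $G_0(q)=\sqrt{Z_\nu/(2\pi)}\,\mathrm e^{\beta V(q)/2}$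 and, for $k\ge1$, $G_{2k}(q)=\sqrt{Z_\nu/\pi}\cos(kq)\mathrm e^{\beta V(q)/2}$, $G_{2k-1}(q)=\sqrt{Z_\nu/\pi}\sin(kq)\mathrm e^{\beta V(q)/2}$; and the orthonormal Hermite family of $L^2(\kappa)$, $H_\ell(p)=\frac1{\sqrt{\ell!}}\widetilde H_\ell(\sqrt\beta p)$, $\widetilde H_\ell(y)=(-1)^\ell\mathrm e^{y^2/2}\frac{d^\ell}{dy^\ell}(\mathrm e^{-y^2/2})$, $\ell\ge0$. $\Pi_K^q$ is the orthogonal projector onto functions spanned in the position variable by $G_0,\dots,G_{2K-2}$, i.e. $\Pi_K^q\varphi=\sum_{k=0}^{2K-2}\langle\varphi,G_k\rangle_{L^2(\nu)}G_k$. The Galerkin space $V_{KL}$ is spanned by $e_{k,\ell}(q,p)=G_k(q)H_\ell(p)$, $0\le k\le2K-2$, $0\le\ell\le L-1$; $\Pi_{KL}$ is the orthogonal projector of $L^2(\mu)$ onto it; $V_{KL,0}=V_{KL}\cap L_0^2(\mu)$ with orthogonal projector $\Pi_{KL,0}$; $u_{KL}=\Pi_{KL}\mathbf 1/\|\Pi_{KL}\mathbf 1\|$. With $\mathbf L_{KL}$ the $(2K-1)L\times(2K-1)L$ matrix of entries $\langle e_i,-\mathcal Le_j\rangle$ and $\mathbf U_{KL}$ the vector of entries $\langle u_{KL},e_i\rangle$ ($e_i$ enumerating the $e_{k,\ell}$), $$\widehat{\mathbf L}_{KL}=\begin{pmatrix}\mathbf L_{KL}&\mathbf U_{KL}\\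 \mathbf U_{KL}^\top&0\end{pmatrix}.$$ Constants (from known hypocoercivity results). There exist $\overline\varepsilon\in(0,1)$, $\overline\lambda>0$ and, for each $\gamma>0$, $\widetilde\lambda_\gamma>0$ such that, with $\varepsilon=\overline\varepsilon\min(\gamma,\gamma^{-1})$, for all $\varphi\in\Pi_0C_c^\infty(2\pi\mathbb T\times\mathbb R)$, $$\langle-\mathcal L\varphi,\varphi\rangle+\varepsilon\langle A\mathcal L\varphi,\varphi\rangle+\varepsilon\langle A\varphi,\mathcal L\varphi\rangle\ge\widetilde\lambda_\gamma\|\varphi\|^2 .$$ These (and $\varepsilon$) are fixed, and $\lambda_\gamma:=\widetilde\lambda_\gamma/(1+\varepsilon)\ge\overline\lambda\min(\gamma,\gamma^{-1})$. *)

(* Defs.v *)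
From HB Require Import structures.
From mathcomp Require Import all_boot all_order all_algebra.
From mathcomp Require Import all_classical all_reals all_analysis.
From mathcomp Require Import measurable_realfun.

Set Implicit Arguments.
Unset Strict Implicit.
Unset Printing Implicit Defensive.

Import Order.TTheory GRing.Theory Num.Theory.
Import numFieldNormedType.Exports.

Local Open Scope classical_set_scope.
Local Open Scope ring_scope.

Section gibbs_measure.
Context d (T : measurableType d) (R : realType).
Variables (m : {measure set T -> \bar R}) (D : set T) (U : T -> R).
Hypotheses (mD : measurable D) (mU : measurable_fun setT U).

Definition partition_function : R := \int[m]_(x in D) expR (- U x).

(* the measure Z^-1 e^{-U} dm on D, extended by 0 outside D *)
Definition gibbs of measurable D & measurable_fun setT U : set T -> \bar R :=
  fun X => (\int[m]_(x in X `&` D) (partition_function^-1 * expR (- U x))%:E)%E.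

Let dens_ge0 x : 0 <= partition_function^-1 * expR (- U x).
Proof.
by rewrite mulr_ge0 ?expR_ge0// invr_ge0 fine_ge0// integral_ge0.
Qed.

Let gibbs0 : gibbs mD mU set0 = 0%E.
Proof. by rewrite /gibbs set0I integral_set0. Qed.

Let gibbs_ge0 X : (0 <= gibbs mD mU X)%E.
Proof. by apply: integral_ge0 => x _; rewrite lee_fin dens_ge0. Qed.

Let gibbs_sigma_additive : semi_sigma_additive (gibbs mD mU).
Proof.
move=> /= F mF tF mUF; rewrite /gibbs; apply: cvg_toP.
  apply: ereal_nondecreasing_is_cvgn => i j ij.
  apply: lee_sum_nneg_natr => // k _ _.
  by apply: integral_ge0 => x _; rewrite lee_fin dens_ge0.
rewrite setI_bigcupl ge0_integral_bigcup//=.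
- by move=> k; exact: measurableI.
- apply: measurable_funTS; apply/measurable_EFinP.
  apply: measurable_funM => //; apply: measurableT_comp => //.
  exact: measurableT_comp.
- by move=> x _; rewrite lee_fin dens_ge0.
- exact: trivIset_setIr.
Qed.

HB.instance Definition _ := isMeasure.Build _ _ _ (gibbs mD mU)
  gibbs0 gibbs_ge0 gibbs_sigma_additive.

End gibbs_measure.

(* L^2(m) is the set Lfun m 2%:E of representatives; identities between
   elements of L^2(m) are understood m-almost everywhere. *)
Section L2.
Context d (T : measurableType d) (R : realType).
Variable m : {measure set T -> \bar R}.
Implicit Types (f g : T -> R) (W : set (T -> R)) (G H : set ((T -> R) * (T -> R))).

Definition inner f g : R := \int[m]_x (f x * g x).

Definition norm2 f : R := Num.sqrt (inner f f).

Definition lin_span n (b : 'I_n -> T -> R) : set (T -> R) :=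
  [set f | exists c : 'I_n -> R, f = \sum_i c i *: b i].

(* the orthogonal projector onto W, for W finite-dimensional; it is unique as a
   function, and not only a.e., when no nonzero element of W is null a.e. *)
Definition orth_proj W f : T -> R :=
  xget 0 [set g | W g /\ forall w, W w -> inner (f - g) w = 0].

(* as a supremum in \bar R, so that unbounded maps have norm +oo *)
Definition op_norm W (S : (T -> R) -> (T -> R)) : \bar R :=
  ereal_sup [set (norm2 (S f))%:E | f in W `&` [set f | norm2 f <= 1]].

Definition inverse_on W (M S : (T -> R) -> (T -> R)) : Prop :=
  [/\ forall f, W f -> W (M f), forall f, W f -> W (S f),
      forall f, W f -> S (M f) = f & forall f, W f -> M (S f) = f].

(* Unbounded operators on L^2(m) are represented by their graphs. *)

Definition closure_op G : set ((T -> R) * (T -> R)) :=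
  [set fg | [/\ fg.1 \in Lfun m 2%:E, fg.2 \in Lfun m 2%:E &
    forall e, 0 < e -> exists uv, [/\ G uv,
      norm2 (fg.1 - uv.1) < e & norm2 (fg.2 - uv.2) < e]]].

Definition adjoint_op G : set ((T -> R) * (T -> R)) :=
  [set fg | [/\ fg.1 \in Lfun m 2%:E, fg.2 \in Lfun m 2%:E &
    forall uv, G uv -> inner uv.1 fg.2 = inner uv.2 fg.1]].

(* comp_op G H is G \o H: H is applied first *)
Definition comp_op G H : set ((T -> R) * (T -> R)) :=
  [set fh | exists g, H (fh.1, g) /\ G (g, fh.2)].

Definition one_plus_op G : set ((T -> R) * (T -> R)) :=
  [set fh | exists2 g, G (fh.1, g) &
    {ae m, forall x, fh.2 x = fh.1 x + g x}].

Definition inv_op G : set ((T -> R) * (T -> R)) := [set fg | G (fg.2, fg.1)].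

End L2.

(* Functions on the cylinder (R/2piZ) x R are functions (q, p) |-> f (q, p) on
   R * R; the measures are carried by the fundamental domain q \in [0, 2pi[,
   and smooth functions are required to be 2pi-periodic in q. *)
Section langevin.
Context {R : realType}.
Variable beta : R.
Implicit Types (f g : R * R -> R) (k l K L n : nat) (q p : R).

Definition circle : set R := `[0, pi *+ 2[.

Lemma measurable_circle : measurable circle.
Proof. exact: measurable_itv. Qed.

Lemma measurable_cylinder : measurable (circle `*` [set: R]).
Proof. by apply: measurableX => //; exact: measurable_circle. Qed.

Definition V_pot q : R := 1 - cos q.

Definition energy (x : R * R) : R := V_pot x.1 + x.2 ^+ 2 / 2.

Lemma measurable_V : measurable_fun [set: R] V_pot.
Proof.
apply: measurable_funB => //; apply: continuous_measurable_fun.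
exact: continuous_cos.
Qed.

Lemma measurable_betaV : measurable_fun [set: R] (fun q => beta * V_pot q).
Proof. by apply: measurable_funM => //; exact: measurable_V. Qed.

Lemma measurable_beta_energy :
  measurable_fun [set: R * R] (fun x => beta * energy x).
Proof.
apply: measurable_funM => //; apply: measurable_funD.
  by apply: measurableT_comp; [exact: measurable_V|exact: measurable_fst].
by apply: measurable_funM => //; apply: measurable_funX; exact: measurable_snd.
Qed.

Definition mu := gibbs (lebesgue_measure \x lebesgue_measure)%E
  measurable_cylinder measurable_beta_energy.

Definition nu := gibbs lebesgue_measure measurable_circle measurable_betaV.

(* density sqrt(beta / (2 pi)) e^(- beta p^2 / 2) *)
Definition kappa := normal_prob (0 : R) (Num.sqrt beta^-1).

Definition Z_nu : R :=
  partition_function lebesgue_measure circle (fun q => beta * V_pot q).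

Definition cst1 : R * R -> R := cst 1.

Definition Pi0 f : R * R -> R := fun x => f x - \int[mu]_y f y.

Definition dq f : R * R -> R := fun x => derive1 (fun q => f (q, x.2)) x.1.
Definition dp f : R * R -> R := fun x => derive1 (fun p => f (x.1, p)) x.2.

Fixpoint Cn n f : Prop :=
  continuous f /\
  if n is n'.+1 then
    [/\ forall q p, derivable (fun q' => f (q', p)) q 1,
        forall q p, derivable (fun p' => f (q, p')) p 1,
        Cn n' (dq f) & Cn n' (dp f)]
  else True.

Definition Cc_infty : set (R * R -> R) :=
  [set f | [/\ forall n, Cn n f,
               forall q p, f (q + pi *+ 2, p) = f (q, p) &
               exists M, forall q p, M < `|p| -> f (q, p) = 0]].

Definition L_ham f : R * R -> R :=
  fun x => x.2 * dq f x - derive1 V_pot x.1 * dp f x.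

Definition L_FD f : R * R -> R :=
  fun x => - x.2 * dp f x + beta^-1 * dp (dp f) x.

Definition gen (gamma : R) f : R * R -> R := L_ham f + gamma *: L_FD f.

Definition Pi_p f : R * R -> R := fun x => \int[kappa]_p f (x.1, p).

(* L_ham Pi_p on its core C_c^oo, and its closure *)
Definition T_core : set ((R * R -> R) * (R * R -> R)) :=
  [set (f, L_ham (Pi_p f)) | f in Cc_infty].

Definition T_op := closure_op mu T_core.
Definition T_adj := adjoint_op mu T_op.

(* (1 + T^* T)^-1 T^*, with domain that of T^* *)
Definition A_graph : set ((R * R -> R) * (R * R -> R)) :=
  comp_op (inv_op (one_plus_op mu (comp_op T_adj T_op))) T_adj.

(* A_graph is single-valued up to mu-a.e. equality, and 1 + T^* T is onto, T
   being closed and densely defined; A picks a representative of the value at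
   each element of the (dense) domain of T^*, which contains Cc_infty, the
   constants and all the e_kl below. Nothing is required elsewhere. *)
Definition is_A (A : (R * R -> R) -> (R * R -> R)) : Prop :=
  forall f g, T_adj (f, g) -> A_graph (f, A f).

Definition hypocoercive (A : (R * R -> R) -> (R * R -> R))
    (gamma eps lam : R) : Prop :=
  forall phi, (Pi0 @` Cc_infty) phi ->
    lam * norm2 mu phi ^+ 2 <=
      inner mu (- gen gamma phi) phi
      + eps * inner mu (A (gen gamma phi)) phi
      + eps * inner mu (A phi) (gen gamma phi).

(* k = 2j gives cos(j q), k = 2j-1 gives sin(j q) *)
Definition G_k k q : R :=
  (if k == 0 then Num.sqrt (Z_nu / (pi *+ 2))
   else Num.sqrt (Z_nu / pi) *
     (if odd k then sin ((uphalf k)%:R * q) else cos ((k./2)%:R * q)))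
  * expR (beta * V_pot q / 2).

Definition hermite l (y : R) : R :=
  (-1) ^+ l * expR (y ^+ 2 / 2) *
  derive1n l (fun z : R => expR (- (z ^+ 2 / 2))) y.

Definition H_l l p : R := (Num.sqrt (l`!)%:R)^-1 * hermite l (Num.sqrt beta * p).

Definition e_kl k l : R * R -> R := fun x => G_k k x.1 * H_l l x.2.

(* number of position modes: (2 * K).-1 = 2K - 1 *)
Definition Pi_q K f : R * R -> R := fun x =>
  \sum_(k < (2 * K).-1) (\int[nu]_q (f (q, x.2) * G_k k q)) * G_k k x.1.

(* enumeration of the e_{k,l}, k < 2K-1, l < L *)
Definition e_enum K L (i : 'I_((2 * K).-1 * L)) : R * R -> R :=
  e_kl (i %/ L) (i %% L).

Definition V_KL K L : set (R * R -> R) := lin_span (@e_enum K L).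

Definition V_KL0 K L : set (R * R -> R) :=
  V_KL K L `&` [set f | \int[mu]_x f x = 0].

Definition Pi_KL K L := orth_proj mu (V_KL K L).
Definition Pi_KL0 K L := orth_proj mu (V_KL0 K L).

Definition u_KL K L : R * R -> R :=
  (norm2 mu (Pi_KL K L cst1))^-1 *: Pi_KL K L cst1.

Definition gen_KL0 (gamma : R) K L f : R * R -> R :=
  Pi_KL0 K L (gen gamma (Pi_KL0 K L f)).

Definition L_mx (gamma : R) K L : 'M[R]_((2 * K).-1 * L) :=
  \matrix_(i, j) inner mu (@e_enum K L i) (- gen gamma (@e_enum K L j)).

Definition U_mx K L : 'cV[R]_((2 * K).-1 * L) :=
  \col_i inner mu (u_KL K L) (@e_enum K L i).

Definition Lhat_mx (gamma : R) K L : 'M[R]_((2 * K).-1 * L + 1) :=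
  block_mx (L_mx gamma K L) (U_mx K L) (U_mx K L)^T 0.

End langevin.

(* Main.v *)
(* In the basis e_kl the generator maps the momentum modes x_l of a Galerkin
   function to
     sqrt l D x_(l-1) - sqrt (l+1) D^T x_(l+1) - gamma l x_l,
   where D is the matrix of beta^(-1/2) d/dq on the span of G_0, ..., G_(2K-2).
   Let y be the image of a function x of mean zero. Testing against x bounds
   the modes x_l, l > 0. Let w be the coordinates of 1 and let h, orthogonal to
   w, solve D^T D h = x_0 modulo w; testing the equation of the mode 1 against
   D h bounds x_0. Such an h exists, with bounds uniform in K, because D w is
   bounded and D is bounded below on the orthogonal of w: the latter follows
   from the Poincare inequality of nu, since multiplication by sin q shifts
   frequencies by one, so that truncation only affects the top frequencies.
   Hence |x| <= C max (gamma, 1/gamma) |y|, which gives both the invertibility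
   of Lhat and a bound on the inverse.

   It remains to see that lamhat := lam gamma, admissible as the bracket is
   nonnegative, is at most C min (gamma, 1/gamma). Since |A f| <= |f| / 2, this
   follows from the assumed coercivity inequality at sin q b (t p), b a smooth
   bump function, whose Dirichlet form tends to 0 with t. *)

From HB Require Import structures.
Require Import Defs.
From mathcomp Require Import all_boot all_order all_algebra.
From mathcomp Require Import all_classical all_reals all_analysis.
From mathcomp Require Import measurable_realfun ring lra zify.

Set Implicit Arguments.
Unset Strict Implicit.
Unset Printing Implicit Defensive.

Import Order.TTheory GRing.Theory Num.Theory.
Import numFieldNormedType.Exports.

Local Open Scope classical_set_scope.
Local Open Scope ring_scope.

(** * Inner products of square-integrable functions *)

(** The weight e^(beta V / 2) in the [G_k] shapes the estimate twice. The constant 1 need not be a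
    Galerkin function, so [D w] need not vanish; the equation for [h] carries a multiplier of [w],
    found by pairing with [w], and this is where the bound on [D w] enters. Nor is [D]
    antisymmetric: [D + D^T] is the compression of multiplication by sqrt beta sin q. Its norm, at
    most sqrt beta, allows [D D h], which appears when the mode 2 is moved over, to be traded for
    [D^T D h]. The factor max (gamma, 1/gamma) appears to the first power only: with P the squared
    norm of the modes l > 0, gamma P <= |x| |y|, so that P and gamma^2 P are both linear in it. An
    upper bound on the rate has to be derived because the hypothesis admits any coercivity constant.
    At sin q b (t p) the transport term p cos q b does not become small, but it is nearly orthogonal
    to the test function. What survives for small t comes from the two terms with A, which carry the
    factor eps <= min (gamma, 1/gamma). The parameter t is chosen after gamma, so the constant does
    not depend on either. *)

Section inner_product.
Context d (T : measurableType d) (R : realType).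
Variable m : {measure set T -> \bar R}.
Implicit Types (f g h : T -> R) (a : R).
Local Notation L2 := (Lfun m 2%:E).

Lemma Lfun2P f : measurable_fun setT f ->
  m.-integrable setT (EFin \o (fun x => f x ^+ 2)) -> f \in L2.
Proof.
move=> mf /integrableP[_ fi].
rewrite inE; apply/andP; split; rewrite inE//= /finite_norm unlock poweR_lty//.
apply: le_lt_trans fi; apply: ge0_le_integral => //=.
- apply/measurable_EFinP; apply: (measurableT_comp (measurable_powR _)) => //.
  exact: measurableT_comp.
- by apply/measurable_EFinP/measurableT_comp => //; exact: measurable_funX.
- by move=> x _; rewrite lee_fin powR_mulrn// normrX.
Qed.

Lemma Lfun2D f g : f \in L2 -> g \in L2 -> f + g \in L2.
Proof.
by move=> fL gL; have [_ +] := @Lfun_addr_closed _ T R m 2%:E (lee1n 2); apply.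
Qed.

Lemma Lfun2N f : f \in L2 -> - f \in L2.
Proof. by have := @Lfun_oppr_closed _ T R m 2%:E; apply. Qed.

Lemma Lfun2B f g : f \in L2 -> g \in L2 -> f - g \in L2.
Proof. by move=> fL gL; apply: Lfun2D => //; exact: Lfun2N. Qed.

Lemma Lfun2Z a f : f \in L2 -> a *: f \in L2.
Proof.
move=> fL; rewrite (_ : a *: f = a \o* f); last first.
  by apply/funext => x; rewrite /= fctE mulrC.
by apply: Lfun_scale => //; rewrite ler1n.
Qed.

Lemma Lfun2_0 : (0 : T -> R) \in L2.
Proof. by have [] := @Lfun_addr_closed _ T R m 2%:E (lee1n 2). Qed.

Lemma Lfun2_sum n (F : 'I_n -> T -> R) :
  (forall i, F i \in L2) -> \sum_i F i \in L2.
Proof.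
by move=> FL; elim/big_ind : _ => //; [exact: Lfun2_0|exact: Lfun2D].
Qed.

Lemma integrable_mul f g : f \in L2 -> g \in L2 ->
  m.-integrable setT (EFin \o (fun x => f x * g x)).
Proof. by move=> fL gL; apply/Lfun1_integrable; exact: Lfun2_mul_Lfun1. Qed.

Lemma innerC f g : inner m f g = inner m g f.
Proof. by apply: eq_Rintegral => x _; rewrite mulrC. Qed.

Lemma innerZl a f g : f \in L2 -> g \in L2 ->
  inner m (a *: f) g = a * inner m f g.
Proof.
move=> fL gL; rewrite -RintegralZl//; last exact: integrable_mul.
by apply: eq_Rintegral => x _; rewrite fctE -mulrA.
Qed.

Lemma innerDl f g h : f \in L2 -> g \in L2 -> h \in L2 ->
  inner m (f + g) h = inner m f h + inner m g h.
Proof.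
move=> fL gL hL; rewrite -RintegralD//; [|exact: integrable_mul..].
by apply: eq_Rintegral => x _; rewrite fctE mulrDl.
Qed.

Lemma innerNl f g : f \in L2 -> g \in L2 -> inner m (- f) g = - inner m f g.
Proof. by move=> fL gL; rewrite -scaleN1r innerZl// mulN1r. Qed.

Lemma innerBl f g h : f \in L2 -> g \in L2 -> h \in L2 ->
  inner m (f - g) h = inner m f h - inner m g h.
Proof. by move=> fL gL hL; rewrite innerDl ?innerNl//; exact: Lfun2N. Qed.

Lemma innerZr a f g : f \in L2 -> g \in L2 ->
  inner m f (a *: g) = a * inner m f g.
Proof. by move=> fL gL; rewrite innerC innerZl// innerC. Qed.

Lemma innerDr f g h : f \in L2 -> g \in L2 -> h \in L2 ->
  inner m h (f + g) = inner m h f + inner m h g.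
Proof. by move=> fL gL hL; rewrite innerC innerDl// !(innerC h). Qed.

Lemma innerNr f g : f \in L2 -> g \in L2 -> inner m f (- g) = - inner m f g.
Proof. by move=> fL gL; rewrite innerC innerNl// innerC. Qed.

Lemma innerBr f g h : f \in L2 -> g \in L2 -> h \in L2 ->
  inner m h (f - g) = inner m h f - inner m h g.
Proof. by move=> fL gL hL; rewrite innerC innerBl// !(innerC h). Qed.

Lemma inner0l g : inner m 0 g = 0.
Proof.
by rewrite /inner; under eq_Rintegral do rewrite mul0r; rewrite Rintegral_cst ?mul0r.
Qed.

Lemma inner_suml n (F : 'I_n -> T -> R) g : (forall i, F i \in L2) -> g \in L2 ->
  inner m (\sum_i F i) g = \sum_i inner m (F i) g.
Proof.
move=> FL gL; elim: n F FL => [|n IH] F FL.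
  by rewrite !big_ord0 inner0l.
rewrite !big_ord_recl innerDl ?IH//; exact: Lfun2_sum.
Qed.

Lemma inner_lin_combl n (b : 'I_n -> T -> R) (c : 'I_n -> R) g :
  (forall i, b i \in L2) -> g \in L2 ->
  inner m (\sum_i c i *: b i) g = \sum_i c i * inner m (b i) g.
Proof.
move=> bL gL; rewrite inner_suml// => [|i]; last exact: Lfun2Z.
by apply: eq_bigr => i _; rewrite innerZl.
Qed.

Lemma inner_ge0 f : 0 <= inner m f f.
Proof. by apply: Rintegral_ge0 => x _; rewrite -expr2 sqr_ge0. Qed.

Lemma norm2_ge0 f : 0 <= norm2 m f.
Proof. exact: sqrtr_ge0. Qed.

Lemma sqr_norm2 f : norm2 m f ^+ 2 = inner m f f.
Proof. by rewrite sqr_sqrtr// inner_ge0. Qed.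

Lemma norm2Z a f : f \in L2 -> norm2 m (a *: f) = `|a| * norm2 m f.
Proof.
move=> fL; rewrite /norm2 innerZl ?innerZr//; last exact: Lfun2Z.
by rewrite mulrA -expr2 sqrtrM ?sqr_ge0// sqrtr_sqr.
Qed.

Lemma norm2N f : f \in L2 -> norm2 m (- f) = norm2 m f.
Proof. by move=> fL; rewrite -scaleN1r norm2Z// normrN1 mul1r. Qed.

Lemma inner_CS f g : f \in L2 -> g \in L2 ->
  `|inner m f g| <= norm2 m f * norm2 m g.
Proof.
move=> fL gL; rewrite -(@ler_sqr R) ?nnegrE ?mulr_ge0 ?norm2_ge0//.
rewrite real_normK ?num_real// exprMn !sqr_norm2.
have Q a b : 0 <= a ^+ 2 * inner m f f + 2 * a * b * inner m f g + b ^+ 2 * inner m g g.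
  have := inner_ge0 (a *: f + b *: g).
  by rewrite !(innerDl, innerDr, innerZl, innerZr) ?Lfun2D ?Lfun2Z//
    (innerC g f); move=> /le_trans; apply; lra.
have [g0|g0] := eqVneq (inner m g g) 0.
  rewrite g0 mulr0; have [->|fg0] := eqVneq (inner m f g) 0; first by rewrite expr0n.
  (* With this witness the form takes the value -1. *)
  have := Q 1 (- (inner m f f + 1) / (2 * inner m f g)).
  rewrite g0 mulr0 addr0 expr1n mul1r mulr1.
  rewrite (_ : 2 * _ * _ = - (inner m f f + 1)); first lra.
  by field.
have gg : 0 < inner m g g by rewrite lt0r g0 inner_ge0.
have := Q (inner m g g) (- inner m f g).
rewrite (_ : _ + _ = inner m g g * (inner m f f * inner m g g - inner m f g ^+ 2)); last ring.
by rewrite pmulr_rge0// subr_ge0.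
Qed.

Lemma le_inner f g : f \in L2 -> g \in L2 -> inner m f g <= norm2 m f * norm2 m g.
Proof. by move=> fL gL; exact: le_trans (ler_norm _) (inner_CS fL gL). Qed.

Lemma norm2_triangle f g : f \in L2 -> g \in L2 ->
  norm2 m (f + g) <= norm2 m f + norm2 m g.
Proof.
move=> fL gL; rewrite -(@ler_sqr R) ?nnegrE ?addr_ge0 ?norm2_ge0//.
rewrite sqr_norm2 !(innerDl, innerDr) ?Lfun2D// (innerC g f) sqrrD !sqr_norm2.
have := le_inner fL gL; lra.
Qed.

End inner_product.

(** * Measures given by a density *)

Section density.
Context d (T : measurableType d) (R : realType).
Variables (m m' : {measure set T -> \bar R}) (g : T -> R).
Hypotheses (mg : measurable_fun setT g) (g0 : forall x, 0 <= g x).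
Hypothesis m'E : forall A, measurable A -> m' A = (\int[m]_(x in A) (g x)%:E)%E.
Local Open Scope ereal_scope.
Import HBNNSimple.

(** Both sides are monotone limits along the same sequence of simple functions, for which the
    formula reduces to [m'E] on level sets. *)
Lemma ge0_integral_density (f : T -> \bar R) :
  (forall x, 0 <= f x) -> measurable_fun setT f ->
  \int[m']_x f x = \int[m]_x (f x * (g x)%:E).
Proof.
move=> f0 mf; pose h := nnsfun_approx measurableT mf.
have mgE : measurable_fun setT (EFin \o g) by exact/measurable_EFinP.
have -> : \int[m']_x f x = lim (\int[m']_x (EFin \o h n) x @[n --> \oo]).
  have fE x : f x = lim ((EFin \o h n) x @[n --> \oo]).
    by apply/esym/cvg_lim => //; exact: cvg_nnsfun_approx.
  under eq_integral do rewrite fE.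
  apply: monotone_convergence => //.
  - by move=> n; apply/measurable_EFinP.
  - by move=> n x _; rewrite lee_fin.
  - by move=> x _ a b ab; rewrite lee_fin; exact/lefP/nd_nnsfun_approx.
have -> : \int[m]_x (f x * (g x)%:E) =
    lim (\int[m]_x ((EFin \o h n) x * (g x)%:E) @[n --> \oo]).
  have fE x : f x * (g x)%:E = lim ((EFin \o h n) x * (g x)%:E @[n --> \oo]).
    by apply/esym/cvg_lim => //; apply: cvgeZr => //; exact: cvg_nnsfun_approx.
  under eq_integral do rewrite fE.
  apply: monotone_convergence => //.
  - by move=> n; apply: emeasurable_funM => //; exact/measurable_EFinP.
  - by move=> n x _; rewrite mule_ge0 ?lee_fin.
  - move=> x _ a b ab; rewrite lee_wpmul2r ?lee_fin//.
    exact/lefP/nd_nnsfun_approx.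
suff suf n : \int[m']_x (EFin \o h n) x = \int[m]_x ((EFin \o h n) x * (g x)%:E).
  by under eq_fun do rewrite suf.
transitivity (\int[m']_x
   (\sum_(y \in range (h n)) (y * \1_(h n @^-1` [set y]) x)%:E)).
  by apply: eq_integral => t _; rewrite /= fimfunE -fsumEFin.
rewrite ge0_integral_fsum//; last 2 first.
- by move=> r; apply/measurable_EFinP; exact: measurable_funM.
- by move=> r y _; exact: nnfun_muleindic_ge0.
transitivity (\int[m]_x (\sum_(y \in range (h n))
    (y * \1_(h n @^-1` [set y]) x)%:E * (g x)%:E)); last first.
  apply: eq_integral => x _.
  rewrite -ge0_mule_fsuml => [|y]; last exact: nnfun_muleindic_ge0.
  by rewrite fsumEFin // -(fimfunE _ x).
rewrite ge0_integral_fsum//; last 2 first.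
- move=> r; apply: emeasurable_funM => //.
  by apply/measurable_EFinP; exact: measurable_funM.
- by move=> r y _; apply: mule_ge0; [exact: nnfun_muleindic_ge0|rewrite lee_fin].
apply: eq_fsbigr => r /[!inE] -[t _ <-].
under eq_integral do rewrite EFinM.
under [RHS]eq_integral do rewrite EFinM -muleA.
rewrite !ge0_integralZl ?lee_fin//; last 3 first.
- apply: emeasurable_funM => //; exact/measurable_EFinP.
- by move=> x _; rewrite mule_ge0 ?lee_fin.
- exact/measurable_EFinP.
rewrite integral_indic// setIT m'E//; congr (_ * _).
rewrite integral_mkcond; apply: eq_integral => x _.
by rewrite epatch_indic muleC.
Qed.

Lemma integrable_densityP (f : T -> R) : measurable_fun setT f ->
  m'.-integrable setT (EFin \o f) <->
  m.-integrable setT (EFin \o (fun x => f x * g x)%R).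
Proof.
move=> mf; have H : \int[m']_x `|(f x)%:E| = \int[m]_x `|(f x * g x)%:E|.
  rewrite ge0_integral_density//.
    by apply: eq_integral => x _; rewrite EFinM abseM (@gee0_abs _ (g x)%:E) ?lee_fin.
  by apply: measurableT_comp => //; exact/measurable_EFinP.
split => /integrableP[_]; [rewrite H|rewrite -H] => fi; apply/integrableP;
  split => //; apply/measurable_EFinP => //; exact: measurable_funM.
Qed.

Lemma integral_density (f : T -> R) : measurable_fun setT f ->
  \int[m']_x (f x)%:E = \int[m]_x (f x * g x)%:E.
Proof.
move=> mf; have mfE : measurable_fun setT (EFin \o f) by exact/measurable_EFinP.
rewrite integralE [RHS]integralE !ge0_integral_density//;
  [|exact: measurable_funeneg|exact: measurable_funepos].
congr (_ - _); apply: eq_integral => x _.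
  by rewrite !funeposE /= EFinM maxeMl ?mul0e ?lee_fin.
by rewrite !funenegE EFinM -mulNe maxeMl ?mul0e ?lee_fin.
Qed.

End density.

(** * The Gibbs measure as a product *)

Section ftc.
Context {R : realType}.

Lemma continuous_mul (f g : R -> R) :
  continuous f -> continuous g -> continuous (fun x => f x * g x).
Proof. by move=> cf cg x; apply: cvgM; [exact: cf|exact: cg]. Qed.

Lemma continuous_add (f g : R -> R) :
  continuous f -> continuous g -> continuous (fun x => f x + g x).
Proof. by move=> cf cg x; apply: cvgD; [exact: cf|exact: cg]. Qed.

Lemma continuous_opp (f : R -> R) : continuous f -> continuous (fun x => - f x).
Proof. by move=> cf x; apply: cvgN; exact: cf. Qed.

Lemma continuous_cst (c : R) : continuous (fun _ : R => c).
Proof. by move=> x; exact: cvg_cst. Qed.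

Local Notation lam := (@lebesgue_measure R).

Section derivation_rules.
Implicit Types (f g : R -> R) (x a b : R).

(** Separates the computation of a derivative by the rules below from the rewriting of its value
    into the wanted form. *)
Lemma is_derive_val f x a b : is_derive x 1 f a -> a = b -> is_derive x 1 f b.
Proof. by move=> + <-. Qed.

Lemma der_cst (c x : R) : is_derive x 1 (fun _ : R => c) 0.
Proof. exact: is_derive_cst. Qed.

Lemma der_id x : is_derive x 1 (fun y : R => y) 1.
Proof. exact: is_derive_id. Qed.

Lemma der_add f g x a b : is_derive x 1 f a -> is_derive x 1 g b ->
  is_derive x 1 (fun y => f y + g y) (a + b).
Proof. by move=> fa gb; exact: is_deriveD. Qed.

Lemma der_opp f x a : is_derive x 1 f a -> is_derive x 1 (fun y => - f y) (- a).
Proof. by move=> fa; exact: is_deriveN. Qed.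

Lemma der_mul f g x a b : is_derive x 1 f a -> is_derive x 1 g b ->
  is_derive x 1 (fun y => f y * g y) (a * g x + f x * b).
Proof.
move=> fa gb; apply: is_derive_val (is_deriveM _ _) _.
by rewrite /GRing.scale /= addrC (mulrC (g x)).
Qed.

Lemma der_comp f g x a b : is_derive (g x) 1 f a -> is_derive x 1 g b ->
  is_derive x 1 (fun y => f (g y)) (a * b).
Proof. by move=> fa gb; exact: is_derive1_comp. Qed.

Lemma der_exp f x a : is_derive x 1 f a ->
  is_derive x 1 (fun y => expR (f y)) (expR (f x) * a).
Proof. by move=> fa; apply: der_comp fa; exact: is_derive_expR. Qed.

Lemma der_scale (c : R) f x a : is_derive x 1 f a ->
  is_derive x 1 (fun y => c * f y) (c * a).
Proof. by move=> fa; apply: is_derive_val (der_mul (der_cst c x) fa) _; rewrite mul0r add0r. Qed.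

Lemma der_sum n (F : 'I_n -> R -> R) (a : 'I_n -> R) x :
  (forall i, is_derive x 1 (F i) (a i)) ->
  is_derive x 1 (fun y => \sum_i F i y) (\sum_i a i).
Proof.
move=> Fa; rewrite (_ : (fun y => _) = \sum_i F i); first exact: is_derive_sum.
by apply/funext => y; rewrite fct_sumE.
Qed.

Lemma derive1_val f x a : is_derive x 1 f a -> derive1 f x = a.
Proof. by move=> fa; rewrite derive1E; exact: derive_val. Qed.

End derivation_rules.

Lemma is_derive_continuous (F f : R -> R) :
  (forall x : R, is_derive x 1 F (f x)) -> continuous F.
Proof. by move=> dF x; apply/differentiable_continuous/derivable1_diffP; case: (dF x). Qed.

Lemma Rintegral_FTC2 (F f : R -> R) (a b : R) : a < b ->
  (forall x : R, is_derive x 1 F (f x)) -> continuous f ->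
  \int[lam]_(x in `[a, b]) f x = F b - F a.
Proof.
move=> ab dF cf; have cF := is_derive_continuous dF.
rewrite /Rintegral (@continuous_FTC2 _ f F a b)//.
- exact: continuous_subspaceT.
- split.
  + by move=> x _; case: (dF x).
  + exact: cvg_at_right_filter (cF a).
  + exact: cvg_at_left_filter (cF b).
- by move=> x _; rewrite derive1E; have [_ ->] := dF x.
Qed.

Lemma continuous_integrable_itv (f : R -> R) (a b : R) : continuous f ->
  lam.-integrable `[a, b] (EFin \o f).
Proof.
move=> cf; apply: continuous_compact_integrable; first exact: segment_compact.
exact: continuous_subspaceT.
Qed.

End ftc.

Definition tensor (R : realType) (a b : R -> R) (x : R * R) : R := a x.1 * b x.2.

(** * Integrals of tensor products *)

Section product.
Context d1 d2 (T1 : measurableType d1) (T2 : measurableType d2) (R : realType).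
Variables (m1 : {sigma_finite_measure set T1 -> \bar R})
  (m2 : {sigma_finite_measure set T2 -> \bar R}).
Local Open Scope ereal_scope.

Lemma ge0_integral_tensor (f : T1 -> \bar R) (g : T2 -> \bar R) :
  (forall x, 0 <= f x) -> (forall x, 0 <= g x) ->
  measurable_fun setT f -> measurable_fun setT g ->
  \int[m1 \x m2]_z (f z.1 * g z.2) = (\int[m1]_x f x) * (\int[m2]_y g y).
Proof.
move=> f0 g0 mf mg; rewrite fubini_tonelli1/=; last 2 first.
- by apply: emeasurable_funM; apply: measurableT_comp.
- by move=> z; rewrite mule_ge0.
under eq_integral => x _.
  rewrite /fubini_F/= ge0_integralZl//.
  over.
rewrite ge0_integralZr// integral_ge0//.
Qed.

Lemma integrable_tensor (f : T1 -> R) (g : T2 -> R) :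
  m1.-integrable setT (EFin \o f) -> m2.-integrable setT (EFin \o g) ->
  (m1 \x m2).-integrable setT (EFin \o (fun z => f z.1 * g z.2)%R).
Proof.
move=> /integrableP[/measurable_EFinP mf fi] /integrableP[/measurable_EFinP mg gi].
apply/integrableP; split.
  by apply/measurable_EFinP; apply: measurable_funM; apply: measurableT_comp.
under eq_integral => z _ do rewrite /= normrM EFinM.
rewrite (@ge0_integral_tensor (fun x => `|f x|%:E) (fun x => `|g x|%:E))//.
- by rewrite lte_mul_pinfty// ?integral_ge0// ge0_fin_numE ?integral_ge0.
- by apply/measurable_EFinP; apply: measurableT_comp.
- by apply/measurable_EFinP; apply: measurableT_comp.
Qed.

Lemma Rintegral_tensor (f : T1 -> R) (g : T2 -> R) :
  m1.-integrable setT (EFin \o f) -> m2.-integrable setT (EFin \o g) ->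
  (\int[m1 \x m2]_z (f z.1 * g z.2) = (\int[m1]_x f x) * (\int[m2]_y g y))%R.
Proof.
move=> fi gi; rewrite /Rintegral -(integral12_prod_meas1 (integrable_tensor fi gi)).
have E x : fubini_F m2 (EFin \o (fun z => f z.1 * g z.2)%R) x =
    (f x)%:E * \int[m2]_y (g y)%:E.
  by rewrite -integralZl//; apply: eq_integral => y _; rewrite EFinM.
transitivity (fine (\int[m1]_x ((f x)%:E * \int[m2]_y (g y)%:E))).
  by congr fine; apply: eq_integral => x _; exact: E.
have /fineK <- := integrable_fin_num measurableT gi.
rewrite integralZr// fineM//; exact: integrable_fin_num.
Qed.

End product.

(** * The two marginals and the factorisation of [mu] *)

Section marginals.
Context {R : realType}.
Implicit Types (beta q p : R) (f g : R -> R).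
Local Notation lam := (@lebesgue_measure R).

Definition wt beta q : R := expR (- (beta * V_pot q)).

Lemma continuous_wt beta : continuous (wt beta).
Proof.
have cV : continuous (fun q : R => - (beta * V_pot q)).
  apply: continuous_opp; apply: continuous_mul; first exact: continuous_cst.
  apply: continuous_add; first exact: continuous_cst.
  by apply: continuous_opp; exact: continuous_cos.
by move=> q; apply: continuous_comp; [exact: cV|exact: continuous_expR].
Qed.

Lemma twopi_gt0 : 0 < pi *+ 2 :> R.
Proof. by rewrite pmulrn_lgt0// pi_gt0. Qed.

Lemma continuous_integrable_circle f : continuous f ->
  lam.-integrable (@circle R) (EFin \o f).
Proof.
move=> cf; apply: integrableS (continuous_integrable_itv 0 (pi *+ 2) cf) => //.
  exact: measurable_circle.
by move=> q; exact: subset_itv_co_cc.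
Qed.

Lemma Rintegral_circle f : continuous f ->
  \int[lam]_(q in @circle R) f q = \int[lam]_(q in `[0, pi *+ 2]) f q.
Proof.
by move=> cf; apply: Rintegral_itv_bndo_bndc; exact: continuous_integrable_circle.
Qed.

Lemma Z_nuE beta : Z_nu beta = \int[lam]_(q in `[0, pi *+ 2]) wt beta q.
Proof. by rewrite -Rintegral_circle//; exact: continuous_wt. Qed.

Lemma Rintegral_itv_cst (a b c : R) : a <= b -> \int[lam]_(q in `[a, b]) c = c * (b - a).
Proof.
move=> ab; rewrite Rintegral_cst//= lebesgue_measure_itv/= lte_fin.
by case: ltgtP ab => // -> _; rewrite ?subrr.
Qed.

(** Follows from 0 <= V <= 2; the absolute value covers both signs of [beta]. The bound gives the
    positivity of [Z_nu] and, later, the comparison of [nu] with Lebesgue measure in the Poincare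
    inequality. *)
Lemma wt_ge beta q : expR (- (`|beta| * 2)) <= wt beta q.
Proof.
rewrite ler_expR lerN2 (le_trans (ler_norm _))// normrM ler_wpM2l//.
rewrite ler_norml /V_pot; have := cos_geN1 q; have := cos_le1 q; lra.
Qed.

Lemma Z_nu_gt0 beta : 0 < Z_nu beta.
Proof.
apply: (@lt_le_trans _ _ (\int[lam]_(q in `[0, pi *+ 2]) expR (- (`|beta| * 2)))).
  by rewrite Rintegral_itv_cst ?ltW ?twopi_gt0// subr0 mulr_gt0 ?expR_gt0 ?twopi_gt0.
rewrite Z_nuE; apply: le_Rintegral => //.
- by apply: continuous_integrable_itv; exact: continuous_cst.
- by apply: continuous_integrable_itv; exact: continuous_wt.
- by move=> q _; exact: wt_ge.
Qed.

(** The indicator of the fundamental domain is part of the density, so that [nu] has a density on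
    the whole line and the preceding results on densities apply. *)
Definition dens_nu beta q : R := (Z_nu beta)^-1 * wt beta q * \1_circle q.

Lemma dens_nu_ge0 beta q : 0 <= dens_nu beta q.
Proof. by rewrite !mulr_ge0 ?expR_ge0// invr_ge0 ltW// Z_nu_gt0. Qed.

Lemma measurable_dens_nu beta : measurable_fun setT (dens_nu beta).
Proof.
apply: measurable_funM; last first.
  by apply: measurable_indic; exact: measurable_circle.
by apply: measurable_funM => //; apply: continuous_measurable_fun; exact: continuous_wt.
Qed.

Lemma nuE beta X : measurable X ->
  nu beta X = (\int[lam]_(q in X) (dens_nu beta q)%:E)%E.
Proof.
move=> mX; rewrite /nu /gibbs integral_mkcondr; apply: eq_integral => q _.
by rewrite epatch_indic /dens_nu !EFinM.
Qed.

Lemma nu_integrableP beta f : measurable_fun setT f ->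
  (nu beta).-integrable setT (EFin \o f) <->
  lam.-integrable (@circle R) (EFin \o (fun q => f q * ((Z_nu beta)^-1 * wt beta q))).
Proof.
move=> mf.
apply: (iff_trans (@integrable_densityP _ _ _ lam (nu beta) _ (measurable_dens_nu beta)
  (dens_nu_ge0 beta) (@nuE beta) _ mf)).
have := integrable_mkcond (mu := lam)
  (EFin \o (fun q => f q * ((Z_nu beta)^-1 * wt beta q))) (@measurable_circle R).
rewrite (_ : _ \_ _ = EFin \o (fun q => f q * dens_nu beta q)); first exact: iff_sym.
by apply/funext => q; rewrite /= epatch_indic /dens_nu /= -EFinM !mulrA.
Qed.

Lemma nu_integralE beta f : measurable_fun setT f ->
  \int[nu beta]_q f q =
  \int[lam]_(q in @circle R) (f q * ((Z_nu beta)^-1 * wt beta q)).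
Proof.
move=> mf; rewrite /Rintegral; congr fine.
have := @integral_density _ _ _ lam (nu beta) _ (measurable_dens_nu beta)
  (dens_nu_ge0 beta) (@nuE beta) _ mf => ->.
rewrite [in RHS]integral_mkcond; apply: eq_integral => q _ /=.
by rewrite epatch_indic /dens_nu /= -EFinM !mulrA.
Qed.

Lemma continuous_nu_dens beta f : continuous f ->
  continuous (fun q => f q * ((Z_nu beta)^-1 * wt beta q)).
Proof.
move=> cf; apply: continuous_mul => //; apply: continuous_mul.
  exact: continuous_cst.
exact: continuous_wt.
Qed.

Lemma nu_integrable beta f : continuous f -> (nu beta).-integrable setT (EFin \o f).
Proof.
move=> cf; apply/nu_integrableP; first exact: continuous_measurable_fun.
by apply: continuous_integrable_circle; exact: continuous_nu_dens.
Qed.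

Lemma nu_RintegralE beta f : continuous f ->
  \int[nu beta]_q f q =
  (Z_nu beta)^-1 * \int[lam]_(q in `[0, pi *+ 2]) (f q * wt beta q).
Proof.
move=> cf; rewrite nu_integralE; last exact: continuous_measurable_fun.
rewrite Rintegral_circle; last exact: continuous_nu_dens.
rewrite -RintegralZl//; first by apply: eq_Rintegral => q _; rewrite mulrCA.
by apply: continuous_integrable_itv; apply: continuous_mul => //; exact: continuous_wt.
Qed.

Lemma nu_setT beta : nu beta setT = 1%E.
Proof.
have fT : nu beta setT \is a fin_num.
  have := integrable_fin_num measurableT (nu_integrable beta (@continuous_cst _ 1)).
  by rewrite /= integral_cst// mul1e.
have : \int[nu beta]_q 1 = 1.
  rewrite nu_RintegralE; last exact: continuous_cst.
  under eq_Rintegral do rewrite mul1r.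
  by rewrite -Z_nuE mulVf// gt_eqF// Z_nu_gt0.
by rewrite Rintegral_cst// mul1r => fE; rewrite -(fineK fT); congr EFin.
Qed.

HB.instance Definition _ beta := Measure.on (nu beta).
HB.instance Definition _ beta :=
  Measure_isProbability.Build _ _ _ (nu beta) (nu_setT beta).

HB.instance Definition _ beta := Probability.on (kappa beta).

Section momentum.
Variable beta : R.
Hypothesis beta_gt0 : 0 < beta.

Let s_neq0 : Num.sqrt beta^-1 != 0 :> R.
Proof. by rewrite gt_eqF// sqrtr_gt0 invr_gt0. Qed.

Definition dens_kappa p : R := normal_peak (Num.sqrt beta^-1) * expR (- (beta * (p ^+ 2 / 2))).

Lemma dens_kappaE : normal_pdf 0 (Num.sqrt beta^-1) = dens_kappa.
Proof.
rewrite normal_pdfE//; apply/funext => p; congr (_ * expR _).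
rewrite subr0 sqr_sqrtr ?invr_ge0 ?(ltW beta_gt0)//.
by field; rewrite gt_eqF.
Qed.

Lemma kappaE X : measurable X ->
  kappa beta X = (\int[lam]_(p in X) (dens_kappa p)%:E)%E.
Proof. by move=> _; rewrite /kappa /normal_prob dens_kappaE. Qed.

Lemma dens_kappa_ge0 p : 0 <= dens_kappa p.
Proof. by rewrite mulr_ge0 ?expR_ge0 ?normal_peak_ge0. Qed.

Lemma continuous_dens_kappa : continuous dens_kappa.
Proof. by rewrite -dens_kappaE; apply: continuous_normal_pdf; exact: s_neq0. Qed.

Lemma measurable_dens_kappa : measurable_fun setT dens_kappa.
Proof. exact: continuous_measurable_fun continuous_dens_kappa. Qed.

(** The energy is a sum of a function of q and a function of p, so both the weight and the partition
    function factor. *)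
Lemma mu_rectangle X Y : measurable X -> measurable Y ->
  mu beta (X `*` Y) = (nu beta X * kappa beta Y)%E.
Proof.
move=> mX mY; rewrite nuE// kappaE//.
set s := Num.sqrt beta^-1.
have pk0 : 0 < normal_peak s by exact: normal_peak_gt0.
have mwt : measurable_fun setT (fun q => (wt beta q * \1_circle q)%R).
  apply: measurable_funM; first by apply: continuous_measurable_fun; exact: continuous_wt.
  by apply: measurable_indic; exact: measurable_circle.
have split_energy (x : R * R) : expR (- (beta * energy x)) =
    wt beta x.1 * ((normal_peak s)^-1 * dens_kappa x.2).
  rewrite /dens_kappa mulrA mulVf ?gt_eqF// mul1r -expRD; congr expR.
  by rewrite /energy; ring.
(* The Gaussian integral is not computed: it is the inverse of [normal_peak s] because [kappa] has
   total mass 1. *)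
have Zmu : partition_function (lam \x lam)%E (@circle R `*` setT)
    (fun x => beta * energy x) = Z_nu beta * (normal_peak s)^-1.
  rewrite /partition_function /Rintegral integral_mkcond.
  transitivity (fine (\int[lam \x lam]_z ((wt beta z.1 * \1_circle z.1)%:E *
      ((normal_peak s)^-1 * dens_kappa z.2)%:E)%E)).
    congr fine; apply: eq_integral => z _; rewrite epatch_indic -!EFinM split_energy.
    congr (_%:E); rewrite (_ : \1_(circle `*` setT) z = \1_circle z.1 :> R); first ring.
    by rewrite !indicE in_setX in_setT andbT.
  rewrite (@ge0_integral_tensor _ _ _ _ _ lam lam (fun q => (wt beta q * \1_circle q)%:E)
    (fun p => ((normal_peak s)^-1 * dens_kappa p)%:E)); last 4 first.
  - by move=> q; rewrite lee_fin mulr_ge0 ?expR_ge0.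
  - by move=> p; rewrite lee_fin mulr_ge0 ?dens_kappa_ge0// invr_ge0 ltW.
  - exact/measurable_EFinP.
  - by apply/measurable_EFinP/measurable_funM => //; exact: measurable_dens_kappa.
  under [X in (_ * X)%E]eq_integral do rewrite EFinM.
  rewrite [X in (_ * X)%E]ge0_integralZl//; last 3 first.
  - by apply/measurable_EFinP; exact: measurable_dens_kappa.
  - by move=> p _; rewrite lee_fin dens_kappa_ge0.
  - by rewrite lee_fin invr_ge0 ltW.
  rewrite -kappaE// probability_setT mule1.
  have -> : (\int[lam]_q (wt beta q * \1_circle q)%:E =
      \int[lam]_(q in @circle R) (wt beta q)%:E)%E.
    rewrite [RHS]integral_mkcond; apply: eq_integral => q _.
    by rewrite epatch_indic EFinM.
  have -> : (\int[lam]_(x in @circle R) (wt beta x)%:E = (Z_nu beta)%:E)%E.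
    rewrite /Z_nu /partition_function /Rintegral fineK//.
    apply: integrable_fin_num; first exact: measurable_circle.
    by apply: continuous_integrable_circle; exact: continuous_wt.
  by [].
rewrite /mu /gibbs integral_mkcond.
transitivity (\int[lam \x lam]_z ((dens_nu beta z.1 * \1_X z.1)%:E *
      (dens_kappa z.2 * \1_Y z.2)%:E))%E.
  apply: eq_integral => z _; rewrite epatch_indic -!EFinM Zmu split_energy.
  congr (_%:E); rewrite (_ : \1__ z = \1_X z.1 * \1_Y z.2 * \1_circle z.1 :> R).
    rewrite /dens_nu invfM invrK; field; rewrite gt_eqF ?Z_nu_gt0// gt_eqF//.
  by rewrite !indicE in_setI !in_setX in_setT andbT -!natrM !mulnb.
rewrite (@ge0_integral_tensor _ _ _ _ _ lam lam (fun q => (dens_nu beta q * \1_X q)%:E)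
    (fun p => (dens_kappa p * \1_Y p)%:E)); last 4 first.
- by move=> q; rewrite lee_fin mulr_ge0 ?dens_nu_ge0.
- by move=> p; rewrite lee_fin mulr_ge0 ?dens_kappa_ge0.
- by apply/measurable_EFinP/measurable_funM; [exact: measurable_dens_nu|exact: measurable_indic].
- by apply/measurable_EFinP/measurable_funM; [exact: measurable_dens_kappa|exact: measurable_indic].
by congr (_ * _)%E; rewrite [RHS]integral_mkcond; apply: eq_integral => x _;
  rewrite epatch_indic EFinM.
Qed.

(** A measure that agrees with the product measure on rectangles is equal to it; Fubini's theorem
    thereby becomes available for [mu]. *)
Lemma muE X : measurable X -> mu beta X = (nu beta \x kappa beta)%E X.
Proof.
move=> mX; apply/esym/product_measure_unique => // A B mA mB.
exact: mu_rectangle.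
Qed.

Lemma mu_integralE (f : R * R -> \bar R) :
  (\int[mu beta]_x f x = \int[nu beta \x kappa beta]_x f x)%E.
Proof. by apply: eq_measure_integral => X mX _; exact: muE. Qed.

Lemma mu_integrableP (f : R * R -> \bar R) :
  (mu beta).-integrable setT f <-> (nu beta \x kappa beta)%E.-integrable setT f.
Proof. by split => /integrableP[mf fi]; apply/integrableP; split => //; move: fi; rewrite mu_integralE. Qed.

Lemma mu_integrable_tensor f g :
  (nu beta).-integrable setT (EFin \o f) -> (kappa beta).-integrable setT (EFin \o g) ->
  (mu beta).-integrable setT (EFin \o tensor f g).
Proof. by move=> fi gi; apply/mu_integrableP; exact: integrable_tensor. Qed.

Lemma mu_Rintegral_tensor f g :
  (nu beta).-integrable setT (EFin \o f) -> (kappa beta).-integrable setT (EFin \o g) ->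
  \int[mu beta]_x tensor f g x = (\int[nu beta]_q f q) * (\int[kappa beta]_p g p).
Proof.
by move=> fi gi; rewrite -Rintegral_tensor// /Rintegral mu_integralE.
Qed.

End momentum.
End marginals.

(** * Gaussian integrability and integration by parts *)

Section kappa_moments.
Context {R : realType}.
Implicit Types (f g : R -> R) (p : R).
Local Notation lam := (@lebesgue_measure R).

(** Polynomial growth is measured by powers of 1 + p^2, which are at least 1 and multiply: closure
    under sums and products is then immediate. The class contains the Hermite functions and the
    cut-offs. *)
Definition slow f := continuous f /\
  exists C n, forall p, `|f p| <= C * (1 + p ^+ 2) ^+ n.

Let w_ge1 p : 1 <= 1 + p ^+ 2. Proof. by rewrite lerDl sqr_ge0. Qed.
Let w_ge0 p : 0 <= 1 + p ^+ 2. Proof. exact: le_trans ler01 (w_ge1 p). Qed.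

Lemma slow_bounded f (M : R) : continuous f -> (forall p, `|f p| <= M) -> slow f.
Proof. by move=> cf fM; split => //; exists M, 0%N => p; rewrite expr0 mulr1. Qed.

Lemma slow_cst (c : R) : slow (fun=> c).
Proof. by apply: (@slow_bounded _ `|c|) => //; exact: continuous_cst. Qed.

Lemma slow_id : slow (fun p => p).
Proof.
split; first by move=> x; exact: cvg_id.
exists 1, 1%N => p; rewrite expr1 mul1r -(real_normK (num_real p)).
have := sqr_ge0 (`|p| - 1); rewrite sqrrB1; have := normr_ge0 p.
by move: `|p| => x; lra.
Qed.

Lemma slow_mul f g : slow f -> slow g -> slow (fun p => f p * g p).
Proof.
move=> [cf [C [n fC]]] [cg [D [k gD]]]; split; first exact: continuous_mul.
by exists (C * D), (n + k)%N => p; rewrite normrM exprD mulrACA ler_pM.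
Qed.

Lemma slow_add f g : slow f -> slow g -> slow (fun p => f p + g p).
Proof.
move=> [cf [C [n fC]]] [cg [D [k gD]]]; split; first exact: continuous_add.
exists (`|C| + `|D|), (n + k)%N => p; rewrite (le_trans (ler_normD _ _))//.
rewrite mulrDl lerD//.
  rewrite (le_trans (fC p))// (@le_trans _ _ (`|C| * (1 + p ^+ 2) ^+ n))//.
    by rewrite ler_wpM2r ?ler_norm// exprn_ge0.
  by rewrite ler_wpM2l// ler_weXn2l// leq_addr.
rewrite (le_trans (gD p))// (@le_trans _ _ (`|D| * (1 + p ^+ 2) ^+ k))//.
  by rewrite ler_wpM2r ?ler_norm// exprn_ge0.
by rewrite ler_wpM2l// ler_weXn2l// leq_addl.
Qed.

Lemma slow_opp f : slow f -> slow (fun p => - f p).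
Proof.
move=> /(slow_mul (slow_cst (-1))); congr slow.
by apply/funext => p; rewrite mulN1r.
Qed.

(** Raise e^y >= 1 + y to the power n at y = c p^2 / (n + 1); dividing by n + 1 rather than n covers
    n = 0. The factor a = max (1, 1/c) gives 1 + p^2 <= a (1 + c p^2). *)
Lemma gauss_decay (c : R) n : 0 < c ->
  exists M, forall p, (1 + p ^+ 2) ^+ n * expR (- (c * p ^+ 2)) <= M.
Proof.
move=> c0; pose a := Num.max 1 c^-1; exists ((a * n.+1%:R) ^+ n) => p.
have a1 : 1 <= a by rewrite /a le_max lexx.
have ac : 1 <= a * c.
  by rewrite -ler_pdivrMr// mul1r /a le_max lexx orbT.
have a0 : 0 <= a by exact: le_trans ler01 a1.
have n1 : 0 < n.+1%:R :> R by rewrite ltr0n.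
have H : 1 + p ^+ 2 <= a * n.+1%:R * expR (c * p ^+ 2 / n.+1%:R).
  rewrite (@le_trans _ _ (a * (1 + c * p ^+ 2)))//.
    by rewrite mulrDr mulr1 lerD// mulrA ler_peMl ?sqr_ge0.
  rewrite -mulrA ler_wpM2l//.
  rewrite (@le_trans _ _ (n.+1%:R * (1 + c * p ^+ 2 / n.+1%:R)))//.
    by rewrite mulrDr mulr1 [X in _ <= _ + X]mulrC divfK ?gt_eqF// lerD2r ler1n.
  by rewrite ler_wpM2l ?(ltW n1)// expR_ge1Dx.
have Hn : (1 + p ^+ 2) ^+ n <= (a * n.+1%:R) ^+ n * expR (c * p ^+ 2).
  rewrite (le_trans (lerXn2r n _ _ H))// ?nnegrE//.
    by rewrite !mulr_ge0 ?expR_ge0.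
  rewrite exprMn -expRM_natl ler_wpM2l ?exprn_ge0 ?mulr_ge0// ler_expR.
  have h : 0 <= c * p ^+ 2 by rewrite mulr_ge0 ?sqr_ge0 ?ltW.
  rewrite mulrCA ler_piMr// ler_pdivrMr// mul1r ler_nat//.
by rewrite (le_trans (ler_wpM2r (expR_ge0 _) Hn))// -mulrA -expRD subrr expR0 mulr1.
Qed.

Variable beta : R.
Hypothesis beta_gt0 : 0 < beta.

Lemma kappa_integrableP f : measurable_fun setT f ->
  (kappa beta).-integrable setT (EFin \o f) <->
  lam.-integrable setT (EFin \o (fun p => f p * dens_kappa beta p)).
Proof.
exact: (@integrable_densityP _ _ _ lam (kappa beta) _ (measurable_dens_kappa beta_gt0)
  (@dens_kappa_ge0 _ beta) (@kappaE _ _ beta_gt0)).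
Qed.

Lemma kappa_RintegralE f : measurable_fun setT f ->
  \int[kappa beta]_p f p = \int[lam]_p (f p * dens_kappa beta p).
Proof.
move=> mf; rewrite /Rintegral; congr fine.
exact: (@integral_density _ _ _ lam (kappa beta) _ (measurable_dens_kappa beta_gt0)
  (@dens_kappa_ge0 _ beta) (@kappaE _ _ beta_gt0) _ mf).
Qed.

(** Half of the Gaussian exponent absorbs the polynomial growth; the other half is the integrable
    Gaussian with parameter [beta / 2]. *)
Lemma kappa_integrable f : slow f -> (kappa beta).-integrable setT (EFin \o f).
Proof.
move=> [cf [C [n fC]]]; apply/kappa_integrableP.
  exact: continuous_measurable_fun.
have C0 : 0 <= C.
  by have := le_trans (normr_ge0 _) (fC 0); rewrite expr0n addr0 expr1n mulr1.
have b4 : 0 < beta / 4 by rewrite divr_gt0.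
have b2 : 0 < beta / 2 by rewrite divr_gt0.
have [M HM] := gauss_decay n b4.
set s := Num.sqrt beta^-1; set s2 := Num.sqrt (beta / 2)^-1.
have pk : 0 <= normal_peak s by exact: normal_peak_ge0.
have pk2 : 0 < normal_peak s2 by rewrite normal_peak_gt0// gt_eqF// sqrtr_gt0 invr_gt0.
have ig : lam.-integrable setT
    (EFin \o (fun p => normal_peak s * C * M / normal_peak s2 * dens_kappa (beta / 2) p)).
  rewrite (_ : EFin \o _ = fun p => ((normal_peak s * C * M / normal_peak s2)%:E *
    (EFin \o dens_kappa (beta / 2)) p)%E); last by apply/funext => p /=; rewrite EFinM.
  apply: integrableZl => //.
  by rewrite -dens_kappaE//; exact: integrable_normal_pdf.
apply: le_integrable ig => //.
- apply/measurable_EFinP; apply: measurable_funM; first exact: continuous_measurable_fun.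
  exact: measurable_dens_kappa.
- move=> p _ /=; rewrite lee_fin [leRHS]ger0_norm; last first.
    rewrite mulr_ge0 ?dens_kappa_ge0// mulr_ge0 ?invr_ge0 ?(ltW pk2)//.
    have M0 : 0 <= M by rewrite (le_trans _ (HM 0))// mulr_ge0 ?expR_ge0 ?exprn_ge0.
    by rewrite !mulr_ge0.
  rewrite normrM (ger0_norm (dens_kappa_ge0 _ _)) /dens_kappa -/s -/s2.
  have -> : expR (- (beta * (p ^+ 2 / 2))) =
      expR (- (beta / 4 * p ^+ 2)) * expR (- (beta / 2 * (p ^+ 2 / 2))).
    by rewrite -expRD; congr expR; field.
  rewrite (_ : _ * C * M / _ * _ = C * M * (normal_peak s * expR (- (beta / 2 * (p ^+ 2 / 2))))); last first.
    by field; rewrite gt_eqF.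
  rewrite (_ : _ * (_ * (_ * _)) = (`|f p| * expR (- (beta / 4 * p ^+ 2))) *
    (normal_peak s * expR (- (beta / 2 * (p ^+ 2 / 2))))); last by ring.
  rewrite ler_wpM2r ?mulr_ge0 ?expR_ge0//.
  apply: (le_trans (ler_wpM2r (expR_ge0 _) (fC p))); rewrite -[leLHS]mulrA.
  by apply: ler_wpM2l => //; exact: HM.
Qed.

Lemma Lfun2_kappa f : slow f -> f \in Lfun (kappa beta) 2%:E.
Proof.
move=> sf; apply: Lfun2P; first by apply: continuous_measurable_fun; case: sf.
exact: kappa_integrable (slow_mul sf sf).
Qed.

Lemma is_derive_dens_kappa p :
  is_derive p 1 (dens_kappa beta) (- (beta * p) * dens_kappa beta p).
Proof.
have h : is_derive p 1 (fun p => - (beta * (p ^+ 2 / 2))) (- (beta * p)).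
  pose k := - (beta / 2); rewrite (_ : (fun p => _) = fun p => k * (p * p)); last first.
    by apply/funext => x; rewrite /k; field.
  apply: is_derive_val (der_mul (der_cst _ _) (der_mul (der_id p) (der_id p))) _.
  by rewrite /k; field.
apply: is_derive_val (der_mul (der_cst _ _) (der_exp h)) _.
by rewrite /dens_kappa; ring.
Qed.

(** The function f times the density is a primitive of (f' - beta p f) times the density. Over
    [-k, k] the integral of the latter tends to 0 by the decay of the primitive, and to the full
    integral by dominated convergence. *)
Lemma kappa_by_parts f f' : (forall p, is_derive p 1 f (f' p)) -> slow f -> slow f' ->
  \int[kappa beta]_p (f' p) = beta * \int[kappa beta]_p (p * f p).
Proof.
move=> df sf sf'; pose h p := f' p - beta * (p * f p).
have sg : slow (fun p => beta * (p * f p)).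
  by apply: slow_mul; [exact: slow_cst|apply: slow_mul => //; exact: slow_id].
have sh : slow h by apply: slow_add => //; exact: slow_opp.
suff h0 : \int[kappa beta]_p h p = 0.
  apply/eqP; rewrite -subr_eq0; apply/eqP; rewrite -h0 RintegralB//;
    [|exact: kappa_integrable..].
  rewrite RintegralZl//; apply: kappa_integrable.
  by apply: slow_mul => //; exact: slow_id.
have [ch _] := sh; have [cf [C [n fC]]] := sf.
have mh : measurable_fun setT h by exact: continuous_measurable_fun.
rewrite kappa_RintegralE//; pose F p := f p * dens_kappa beta p.
pose F' p := h p * dens_kappa beta p.
have cF' : continuous F' by apply: continuous_mul => //; exact: continuous_dens_kappa.
have iF' : lam.-integrable setT (EFin \o F').
  by apply/kappa_integrableP => //; exact: kappa_integrable.
have dF p : is_derive p 1 F (F' p).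
  apply: is_derive_val (der_mul (df p) (is_derive_dens_kappa p)) _.
  by rewrite /F' /h; ring.
have b2 : 0 < beta / 2 by rewrite divr_gt0.
(* One power more than the growth of f, so that the boundary terms decay like 1 / (1 + p^2). *)
have [M HM] := gauss_decay n.+1 b2.
pose K := normal_peak (Num.sqrt beta^-1) * C * M.
have FK p : `|F p| <= K / (1 + p ^+ 2).
  rewrite ler_pdivlMr ?(lt_le_trans ltr01 (w_ge1 p))//.
  rewrite /F normrM (ger0_norm (dens_kappa_ge0 _ _)) /dens_kappa.
  rewrite (_ : beta * (p ^+ 2 / 2) = beta / 2 * p ^+ 2); last by field.
  set E := expR _; set W := 1 + p ^+ 2.
  rewrite (_ : _ * _ * W = `|f p| * (normal_peak (Num.sqrt beta^-1) * E * W)); last by ring.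
  apply: (le_trans (ler_wpM2r _ (fC p))).
    by rewrite !mulr_ge0 ?expR_ge0 ?normal_peak_ge0 ?w_ge0.
  have -> : C * W ^+ n * (normal_peak (Num.sqrt beta^-1) * E * W) =
      normal_peak (Num.sqrt beta^-1) * (C * ((W ^+ n.+1) * E)).
    by rewrite exprSr; move: (W ^+ n) => Wn; ring.
  rewrite /K -mulrA ler_wpM2l ?normal_peak_ge0// ler_wpM2l//.
    by have := le_trans (normr_ge0 _) (fC 0); rewrite expr0n addr0 expr1n mulr1.
  exact: HM.
have cvg1 : \int[lam]_(p in `[- k%:R, k%:R]) F' p @[k --> \oo] --> (0 : R).
  apply/cvgrPdist_le => e e0; near=> k.
  have k0 : 0 < k%:R :> R by rewrite ltr0n; near: k; exact: nbhs_infty_gt.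
  rewrite sub0r normrN (Rintegral_FTC2 _ dF)//; last by rewrite gtrN.
  apply: (le_trans (ler_normB _ _)); apply: (le_trans (lerD (FK _) (FK _))).
  have K0 : 0 <= K.
    by have := le_trans (normr_ge0 _) (FK 0); rewrite expr0n addr0 divr1.
  rewrite sqrrN -mulrDl ler_pdivrMr ?(lt_le_trans ltr01)//.
  apply: (@le_trans _ _ (e * k%:R)).
    by rewrite -ler_pdivrMl//; near: k; exact: nbhs_infty_ger.
  rewrite ler_wpM2l ?(ltW e0)//.
  rewrite (@le_trans _ _ (k%:R * k%:R))//; last by rewrite -expr2 lerDr.
  by rewrite ler_peMl ?(ltW k0)// ler1n -(ltr0n R).
have cvg2 : \int[lam]_(p in `[- k%:R, k%:R]) F' p @[k --> \oo] --> \int[lam]_p F' p.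
  pose f_ k p := ((F' \_ `[- k%:R, k%:R]) p)%:E.
  have mF' : measurable_fun setT F' by exact: continuous_measurable_fun.
  have mf_ k : measurable_fun setT (f_ k).
    apply/measurable_EFinP; apply/(measurable_restrictT _ _).1 => //.
    exact: measurable_funTS.
  have f_f : {ae lam, forall p, setT p -> f_ ^~ p @ \oo --> (EFin \o F') p}.
    apply/aeW => p _; apply: cvg_near_cst; near=> k.
    rewrite /f_ patchE mem_set//= in_itv/= -ler_norml.
    by near: k; exact: nbhs_infty_ger.
  have ig : lam.-integrable setT (fun p => `|F' p|%:E).
    exact: (integrable_norm iF').
  have f_g : {ae lam, forall p k, setT p -> (`|f_ k p| <= `|F' p|%:E)%E}.
    apply/aeW => p k _; rewrite /f_ patchE.
    by case: ifP => _ /=; rewrite lee_fin// normr0.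
  have mF'E : measurable_fun setT (EFin \o F') by exact/measurable_EFinP.
  have [_ _ cv] := @dominated_convergence _ _ _ lam setT measurableT f_ (EFin \o F')
    (fun p => `|F' p|%:E) mf_ mF'E f_f ig f_g.
  rewrite (_ : (fun k => _) = (fun k => fine (\int[lam]_(p in setT) (f_ k p)))).
    by apply: fine_cvg; rewrite /Rintegral fineK//; exact: integrable_fin_num.
  apply/funext => k; rewrite /Rintegral [in LHS]integral_mkcond; congr fine.
  by apply: eq_integral => p _; rewrite /f_ restrict_EFin.
by apply: (cvg_unique _ cvg2 cvg1).
Unshelve. all: end_near. Qed.

End kappa_moments.

(** * An abstract Galerkin estimate *)

Section euclidean.
Context {R : rcfType}.

(** The discriminant criterion, for arbitrary coefficients, so that it serves vectors, families of
    vectors and integrals over an interval alike. *)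
Lemma quadratic_form_CS (a b c : R) :
  (forall s t, 0 <= s ^+ 2 * a + 2 * s * t * b + t ^+ 2 * c) -> b ^+ 2 <= a * c.
Proof.
move=> Q; have c_ge0 : 0 <= c by have := Q 0 1; rewrite expr0n /= !(mul0r, mulr0) expr1n mul1r !add0r.
have [c0|c0] := eqVneq c 0.
  rewrite c0 mulr0; have [->|b0] := eqVneq b 0; first by rewrite expr0n.
  have := Q 1 (- (a + 1) / (2 * b)).
  rewrite c0 mulr0 addr0 expr1n mul1r mulr1 (_ : 2 * _ * _ = - (a + 1)); first lra.
  by field.
have cp : 0 < c by rewrite lt0r c0.
have := Q c (- b); rewrite (_ : _ + _ = c * (a * c - b ^+ 2)); last ring.
by rewrite pmulr_rge0// subr_ge0.
Qed.

Section dot.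
Variable n : nat.
Implicit Types u v w : 'cV[R]_n.

Definition dot u v : R := \sum_i u i 0 * v i 0.
Definition nrm u : R := Num.sqrt (dot u u).

Lemma dotC u v : dot u v = dot v u.
Proof. by apply: eq_bigr => i _; rewrite mulrC. Qed.

Lemma dotDl u v w : dot (u + v) w = dot u w + dot v w.
Proof. by rewrite -big_split; apply: eq_bigr => i _; rewrite mxE mulrDl. Qed.

Lemma dotZl a u v : dot (a *: u) v = a * dot u v.
Proof. by rewrite mulr_sumr; apply: eq_bigr => i _; rewrite mxE mulrA. Qed.

Lemma dotDr u v w : dot w (u + v) = dot w u + dot w v.
Proof. by rewrite dotC dotDl !(dotC w). Qed.

Lemma dotZr a u v : dot u (a *: v) = a * dot u v.
Proof. by rewrite dotC dotZl dotC. Qed.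

Lemma dotNl u v : dot (- u) v = - dot u v.
Proof. by rewrite -scaleN1r dotZl mulN1r. Qed.

Lemma dotNr u v : dot u (- v) = - dot u v.
Proof. by rewrite dotC dotNl dotC. Qed.

Lemma dot0l u : dot 0 u = 0.
Proof. by rewrite /dot big1// => i _; rewrite mxE mul0r. Qed.

Lemma dot0r u : dot u 0 = 0.
Proof. by rewrite dotC dot0l. Qed.

Lemma dot_ge0 u : 0 <= dot u u.
Proof. by apply: sumr_ge0 => i _; rewrite -expr2 sqr_ge0. Qed.

Lemma dot_eq0 u : dot u u = 0 -> u = 0.
Proof.
move=> /eqP; rewrite psumr_eq0 => [|i _]; last by rewrite -expr2 sqr_ge0.
move=> /allP h; apply/colP => i; rewrite mxE; apply/eqP.
by have := h i (mem_index_enum _); rewrite /= -expr2 sqrf_eq0.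
Qed.

Lemma mulmx_trE u v : u^T *m v = (dot u v)%:M.
Proof.
apply/matrixP => i j; rewrite !ord1 !mxE eqxx mulr1n.
by apply: eq_bigr => k _; rewrite mxE.
Qed.

Lemma nrm_ge0 u : 0 <= nrm u.
Proof. exact: sqrtr_ge0. Qed.

Lemma sqr_nrm u : nrm u ^+ 2 = dot u u.
Proof. by rewrite sqr_sqrtr// dot_ge0. Qed.

Lemma dot_CS u v : dot u v <= nrm u * nrm v.
Proof.
rewrite (le_trans (ler_norm _))// -(@ler_sqr R) ?nnegrE ?mulr_ge0 ?nrm_ge0//.
rewrite real_normK ?num_real// exprMn !sqr_nrm; apply: quadratic_form_CS => s t.
have := dot_ge0 (s *: u + t *: v).
by rewrite !(dotDl, dotDr, dotZl, dotZr) (dotC v u) => /le_trans; apply; lra.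
Qed.

Lemma nrmZ a u : nrm (a *: u) = `|a| * nrm u.
Proof. by rewrite /nrm dotZl dotZr mulrA -expr2 sqrtrM ?sqr_ge0// sqrtr_sqr. Qed.

Lemma nrm_triangle u v : nrm (u + v) <= nrm u + nrm v.
Proof.
rewrite -(@ler_sqr R) ?nnegrE ?addr_ge0 ?nrm_ge0//.
rewrite sqr_nrm !(dotDl, dotDr) (dotC v u) sqrrD !sqr_nrm.
have := dot_CS u v; lra.
Qed.

Lemma nrm_eq0 u : nrm u = 0 -> u = 0.
Proof. by move=> u0; apply: dot_eq0; rewrite -sqr_nrm u0 expr0n. Qed.

End dot.

Lemma dot_mulmx n k (A : 'M[R]_(n, k)) u v : dot u (A *m v) = dot (A^T *m u) v.
Proof.
rewrite /dot; under eq_bigr do rewrite mxE mulr_sumr.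
rewrite exchange_big /=; apply: eq_bigr => j _.
by rewrite mxE mulr_suml; apply: eq_bigr => i _; rewrite mxE mulrA (mulrC (u i 0)).
Qed.

End euclidean.

Lemma unitmx_inj (F : fieldType) n (M : 'M[F]_n) :
  (forall x : 'cV_n, M *m x = 0 -> x = 0) -> M \in unitmx.
Proof.
move=> Minj; rewrite -unitmx_tr -row_free_unit -kermx_eq0; apply/eqP/row_matrixP => i.
rewrite row0; apply: trmx_inj; rewrite trmx0; apply: Minj.
by rewrite -{1}[M]trmxK -trmx_mul -row_mul mulmx_ker row0 trmx0.
Qed.

(** The last row confines x to the orthogonal of u and the last column adds a Lagrange multiplier s;
    once x = 0, s vanishes because u does not. It serves twice: for [D^T D] modulo [w], and for
    [Lhat_mx]. *)
Lemma bordered_unitmx (F : fieldType) n (M : 'M[F]_n) (u : 'cV_n) : u != 0 ->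
  (forall x s, u^T *m x = 0 -> M *m x + s *: u = 0 -> x = 0) ->
  block_mx M u u^T (0 : 'M[F]_1) \in unitmx.
Proof.
move=> u0 inj; apply: unitmx_inj => z.
rewrite -[z]vsubmxK; set x := usubmx z; set s := dsubmx z.
rewrite mul_block_col mul0mx addr0 -[X in _ = X]vsubmxK !linear0.
move=> /eq_col_mx[Mx ux].
have s00 : s = (s 0 0)%:M by apply/matrixP => i j; rewrite !ord1 [RHS]mxE eqxx mulr1n.
move: Mx; rewrite s00 scalar_mxC mul_scalar_mx => Mx.
have x0 := inj _ _ ux Mx; move: Mx; rewrite x0 mulmx0 add0r => /eqP.
by rewrite scaler_eq0 (negbTE u0) orbF => /eqP ->; rewrite raddf0 col_mx0.
Qed.

(** * A tridiagonal system of momentum modes *)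

Section abstract_galerkin.
Context {R : realType}.
(** In the application [D] is the compressed position derivative and [w] holds the coordinates of 1.
    [DB] expresses that [D + D^T] is bounded, [Dc] is a Poincare inequality, and [Dd] replaces the
    identity D w = 0 that would hold without truncation. *)
Variables (n : nat) (D : 'M[R]_n) (w : 'cV[R]_n) (B c d omega : R).
Hypotheses (B0 : 0 <= B) (c0 : 0 <= c) (d0 : 0 <= d) (omega0 : 0 < omega).
Hypothesis DB : forall v, nrm (D *m v) <= nrm (D^T *m v) + B * nrm v.
Hypothesis Dc : forall v, dot w v = 0 -> nrm v <= c * nrm (D *m v).
Hypothesis Dd : nrm (D *m w) <= d.
Hypothesis womega : omega <= nrm w.

Let w_gt0 : 0 < nrm w. Proof. exact: lt_le_trans womega. Qed.

(* psi = D h, where h solves D^T D h = x modulo w on the orthogonal of w *)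
Lemma dual_test_vector (x : 'cV[R]_n) : dot w x = 0 ->
  exists psi, [/\ dot psi (D *m x) = nrm x ^+ 2, nrm psi <= c * nrm x &
    nrm (D *m psi) <= (1 + c * d / omega + B * c) * nrm x].
Proof.
move=> wx.
(* Solves for h in the orthogonal of w, with -t as multiplier. By [Dc] the form of [D^T D] is
   definite there. *)
pose M := block_mx (D^T *m D) w w^T (0 : 'M[R]_1).
have Mu : M \in unitmx.
  apply: bordered_unitmx => [|y s wy].
    by apply: contraTneq w_gt0 => ->; rewrite /nrm dot0l sqrtr0 ltxx.
  move=> /(congr1 (dot y)).
  rewrite dotDr dotZr dot0r -mulmxA dot_mulmx trmxK.
  have wy0 : dot w y = 0.
    by move/matrixP/(_ 0 0): wy; rewrite mulmx_trE !mxE eqxx mulr1n.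
  rewrite (dotC y w) wy0 mulr0 addr0 -sqr_nrm => /eqP; rewrite sqrf_eq0 => /eqP Dy.
  by apply: nrm_eq0; apply/eqP; rewrite eq_le nrm_ge0 andbT (le_trans (Dc wy0))// Dy mulr0.
pose z := invmx M *m col_mx x 0; pose h := usubmx z; pose t := - dsubmx z 0 0.
have : M *m z = col_mx x 0 by rewrite mulKVmx.
rewrite -[z]vsubmxK -/h mul_block_col mul0mx addr0 => /eq_col_mx[eq1 eq2].
have wh : dot w h = 0.
  by move/matrixP/(_ 0 0): eq2; rewrite mulmx_trE !mxE eqxx mulr1n.
have DDh : D^T *m (D *m h) = x + t *: w.
  move: eq1; rewrite (_ : dsubmx z = (- t)%:M); last first.
    by apply/matrixP => i j; rewrite !ord1 [RHS]mxE eqxx mulr1n opprK.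
  rewrite scalar_mxC mul_scalar_mx scaleNr mulmxA => /eqP.
  by rewrite subr_eq => /eqP.
pose psi := D *m h; exists psi.
have x_ge0 := nrm_ge0 x; have psi_ge0 := nrm_ge0 psi.
have psix : dot psi (D *m x) = nrm x ^+ 2.
  by rewrite dot_mulmx DDh dotDl dotZl wx mulr0 addr0 sqr_nrm.
have psic : nrm psi <= c * nrm x.
  (* |psi|^2 = <h, D^T D h> = <h, x> <= c |psi| |x|, the multiplier being orthogonal to h; then
     divide by |psi|. *)
  have [->|/eqP psi0] := eqVneq (nrm psi) 0; first by rewrite mulr_ge0.
  have psi_gt0 : 0 < nrm psi by rewrite lt0r psi_ge0 andbT; apply/eqP.
  rewrite -(ler_pM2l psi_gt0) -expr2 sqr_nrm {1}/psi dotC dot_mulmx.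
  rewrite -[X in dot X _]/(D^T *m psi) DDh dotDl dotZl wh mulr0 addr0.
  rewrite (le_trans (dot_CS _ _))// mulrC mulrA ler_wpM2r// mulrC.
  by have := Dc wh.
split => //.
apply: (le_trans (DB _)); rewrite DDh.
(* Pairing the equation with w gives t |w|^2 = <psi, D w>: the multiplier is small because w is
   nearly in the kernel of D. *)
have t_le : `|t| * nrm w <= c * d / omega * nrm x.
  have tw : t * nrm w ^+ 2 = dot psi (D *m w).
    by rewrite dot_mulmx DDh dotDl dotZl (dotC x) wx add0r sqr_nrm.
  rewrite -(ler_pM2r w_gt0).
  have -> : `|t| * nrm w * nrm w = `|dot psi (D *m w)|.
    by rewrite -tw normrM [X in _ = _ * X]ger0_norm ?sqr_ge0// -mulrA -expr2.
  have abs_dot : `|dot psi (D *m w)| <= nrm psi * nrm (D *m w).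
    rewrite ler_norml dot_CS andbT lerNl -dotNl (le_trans (dot_CS _ _))//.
    by rewrite -scaleN1r nrmZ normrN1 mul1r.
  apply: (le_trans abs_dot); apply: (@le_trans _ _ (c * nrm x * d)).
    by rewrite ler_pM ?nrm_ge0.
  rewrite (_ : c * d / omega * nrm x * nrm w = c * nrm x * d * (nrm w / omega)); last by field; rewrite gt_eqF.
  by rewrite ler_peMr ?mulr_ge0// ler_pdivlMr// mul1r.
have := nrm_triangle x (t *: w); rewrite nrmZ.
have := ler_wpM2l B0 psic.
lra.
Qed.

Variables (L : nat) (gamma t : R) (x g : nat -> 'cV[R]_n).
Hypotheses (L_gt1 : (1 < L)%N) (gamma_gt0 : 0 < gamma).
Hypothesis x_trunc : forall l, (L <= l)%N -> x l = 0.
Hypothesis wx0 : dot w (x 0) = 0.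
(** At [l = 0] the index [l.-1] is again 0, but its coefficient [Num.sqrt 0] vanishes. The term
    [t *: w] makes room for the multiplier of the mean zero constraint. *)
Hypothesis gE : forall l, (l < L)%N -> g l =
  Num.sqrt l%:R *: (D *m x l.-1) - Num.sqrt l.+1%:R *: (D^T *m x l.+1)
  - (gamma * l%:R) *: x l + (if l == 0 then t *: w else 0).

Let N := Num.sqrt (\sum_(l < L) nrm (x l) ^+ 2).
Let G := Num.sqrt (\sum_(l < L) nrm (g l) ^+ 2).
Let P := \sum_(l < L) (0 < l)%N%:R * nrm (x l) ^+ 2.

Let N2 : N ^+ 2 = \sum_(l < L) nrm (x l) ^+ 2.
Proof. by rewrite sqr_sqrtr// sumr_ge0// => l _; rewrite sqr_ge0. Qed.

Let G2 : G ^+ 2 = \sum_(l < L) nrm (g l) ^+ 2.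
Proof. by rewrite sqr_sqrtr// sumr_ge0// => l _; rewrite sqr_ge0. Qed.

Lemma sum_dot_CS : - (\sum_(l < L) dot (x l) (g l)) <= N * G.
Proof.
apply: (@le_trans _ _ `|\sum_(l < L) dot (x l) (g l)|); first by rewrite -normrN ler_norm.
rewrite -(@ler_sqr R) ?nnegrE ?mulr_ge0 ?sqrtr_ge0//.
rewrite real_normK ?num_real// exprMn N2 G2; apply: quadratic_form_CS => s r.
rewrite !mulr_sumr -!big_split /=; apply: sumr_ge0 => l _.
have := dot_ge0 (s *: x l + r *: g l).
by rewrite !(dotDl, dotDr, dotZl, dotZr) (dotC (g l)) !sqr_nrm => /le_trans; apply; lra.
Qed.

(** Against x the terms in [D] and [D^T] telescope. The ends vanish, by [Num.sqrt 0] at l = 0 and by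
    truncation at l = L, and the multiplier is orthogonal to [x 0]. Only gamma l |x_l|^2 remains,
    with l >= 1 on the modes counted in [P]. *)
Lemma dissipation : gamma * P <= N * G.
Proof.
apply: le_trans sum_dot_CS.
pose a l := Num.sqrt l%:R * dot (x l) (D *m x l.-1).
have E (l : 'I_L) : dot (x l) (g l) = (a l - a l.+1) - gamma * (l%:R * nrm (x l) ^+ 2).
  have s1 : dot (x l.+1) (D *m x l) = dot (x l) (D^T *m x l.+1).
    by rewrite dot_mulmx dotC.
  rewrite gE// !(dotDr, dotNr, dotZr) sqr_nrm /a /= s1.
  have -> : dot (x l) (if l == 0 :> nat then t *: w else 0) = 0.
    by case: ifP => [/eqP ->|_]; rewrite ?dot0r// dotZr dotC wx0 mulr0.
  ring.
under eq_bigr do rewrite E.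
rewrite sumrB -mulr_sumr -(big_mkord xpredT (fun l => a l - a l.+1)).
have -> : \sum_(0 <= l < L) (a l - a l.+1) = 0.
  under eq_bigr do rewrite -opprB.
  by rewrite sumrN telescope_sumr// /a x_trunc// dot0l sqrtr0 mulr0 mul0r subr0 oppr0.
rewrite sub0r opprK ler_wpM2l ?(ltW gamma_gt0)//; apply: ler_sum => l _.
rewrite ler_wpM2r ?sqr_ge0// ler_nat; by case: (l : nat).
Qed.

Let nrm_le_P l : (0 < l)%N -> nrm (x l) <= Num.sqrt P.
Proof.
have P0 : 0 <= P by apply: sumr_ge0 => k _; rewrite mulr_ge0 ?sqr_ge0.
move=> l0; rewrite -(@ler_sqr R) ?nnegrE ?sqrtr_ge0 ?nrm_ge0// (sqr_sqrtr P0).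
have [lL|Ll] := ltnP l L; last by rewrite x_trunc// sqr_nrm dot0l.
rewrite /P (bigD1 (Ordinal lL))//= l0 mul1r lerDl sumr_ge0// => k _.
by rewrite mulr_ge0 ?sqr_ge0.
Qed.

Let nrm_le_G l : (l < L)%N -> nrm (g l) <= G.
Proof.
move=> lL; rewrite -(@ler_sqr R) ?nnegrE ?sqrtr_ge0 ?nrm_ge0// G2.
by rewrite (bigD1 (Ordinal lL))//= lerDl sumr_ge0// => k _; rewrite sqr_ge0.
Qed.

(** [c] comes from |psi| and the bracket from |D psi|; the factor 2 bounds [Num.sqrt 2], the
    coefficient of the mode 2. *)
Let c1 : R := c + 2 * (1 + c * d / omega + B * c).

Let c1_ge0 : 0 <= c1.
Proof.
have h1 : 0 <= c * d / omega by rewrite !mulr_ge0 ?invr_ge0 ?(ltW omega0).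
have h2 : 0 <= B * c by rewrite mulr_ge0.
by rewrite /c1 addr_ge0// mulr_ge0// !addr_ge0.
Qed.

(** The equation of the mode 1 reads D x_0 = g_1 + sqrt 2 D^T x_2 + gamma x_1. Tested against psi,
    its left side is |x_0|^2, and [D^T] passes to psi as [D], which is why |D psi| had to be
    bounded. *)
Lemma macroscopic_bound : nrm (x 0) <= c1 * (G + (1 + gamma) * Num.sqrt P).
Proof.
have [psi [psix psic Dpsi]] := dual_test_vector wx0.
have [x00|x00] := eqVneq (nrm (x 0)) 0.
  by rewrite x00 mulr_ge0// addr_ge0 ?mulr_ge0 ?sqrtr_ge0// addr_ge0 ?(ltW gamma_gt0).
have x0_gt0 : 0 < nrm (x 0) by rewrite lt0r x00 nrm_ge0.
have g1 := gE L_gt1; rewrite /= addr0 sqrtr1 scale1r mulr1 in g1.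
rewrite -(ler_pM2l x0_gt0) -expr2 -psix.
have -> : dot psi (D *m x 0) = dot psi (g 1) +
    Num.sqrt 2 * dot (D *m psi) (x 2) + gamma * dot psi (x 1).
  rewrite g1 !(dotDr, dotNr, dotZr) (dot_mulmx D^T) trmxK; ring.
have s2 : Num.sqrt 2 <= 2 :> R.
  by rewrite -(@ler_sqr R) ?nnegrE ?sqrtr_ge0// sqr_sqrtr//; lra.
have D0 := le_trans (nrm_ge0 _) Dpsi.
set E := (1 + _ + _) in Dpsi.
set X := nrm (x 0) in psix psic Dpsi *; set Q := Num.sqrt P.
have Q0 : 0 <= Q by exact: sqrtr_ge0.
have G0 : 0 <= G by exact: sqrtr_ge0.
have h1 : dot psi (g 1) <= c * X * G.
  by rewrite (le_trans (dot_CS _ _))// ler_pM ?nrm_ge0// nrm_le_G.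
have h2 : dot (D *m psi) (x 2) <= E * X * Q.
  by rewrite (le_trans (dot_CS _ _))// ler_pM ?nrm_ge0// nrm_le_P.
have h3 : dot psi (x 1) <= c * X * Q.
  by rewrite (le_trans (dot_CS _ _))// ler_pM ?nrm_ge0// nrm_le_P.
have h2' : Num.sqrt 2 * dot (D *m psi) (x 2) <= 2 * (E * X * Q).
  apply: (le_trans (ler_wpM2l (sqrtr_ge0 _) h2)); apply: ler_wpM2r => //.
  by rewrite mulr_ge0.
have h3' : gamma * dot psi (x 1) <= gamma * (c * X * Q).
  by rewrite ler_wpM2l// ltW.
have EXG : 0 <= E * X * G by rewrite mulr_ge0.
have EXQ : 0 <= E * X * Q by rewrite mulr_ge0.
have gEXQ : 0 <= gamma * (E * X * Q) by rewrite mulr_ge0 ?(ltW gamma_gt0).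
have cXQ : 0 <= c * X * Q by rewrite !mulr_ge0 ?nrm_ge0.
rewrite /c1 -/E.
rewrite (_ : X * _ = c * X * G + 2 * (E * X * G) + c * X * Q + 2 * (E * X * Q)
  + gamma * (c * X * Q) + 2 * (gamma * (E * X * Q))); last ring.
lra.
Qed.

(** The two preceding bounds combine into an inequality N^2 <= a G^2 + b N G. The 10 is 2 + 8: a
    factor 2 from (u + v)^2 <= 2 (u^2 + v^2), multiplied by 1 for G^2 and by 4 m for (1 + gamma)^2
    P. *)
Lemma galerkin_estimate :
  N <= (1 + 10 * c1 ^+ 2) * Num.max gamma gamma^-1 * G.
Proof.
have hX := macroscopic_bound; have hP := dissipation.
have P0 : 0 <= P by apply: sumr_ge0 => k _; rewrite mulr_ge0 ?sqr_ge0.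
have NP : N ^+ 2 <= nrm (x 0) ^+ 2 + P.
  rewrite N2 /P; case: L L_gt1 => // L' _; rewrite !big_ord_recl /= mul0r add0r.
  by rewrite lerD2l; apply: ler_sum => l _; rewrite mul1r.
set m := Num.max gamma gamma^-1.
have gm : gamma <= m by rewrite le_max lexx.
have gVm : gamma^-1 <= m by rewrite le_max lexx orbT.
have m1 : 1 <= m.
  rewrite /m; have [h|h] := leP 1 gamma; first by rewrite (le_trans h).
  by rewrite (le_trans _ gVm)// invf_ge1// ltW.
have N0 : 0 <= N by exact: sqrtr_ge0.
have G0 : 0 <= G by exact: sqrtr_ge0.
have NG0 : 0 <= N * G by rewrite mulr_ge0.
have m0 : 0 <= m by exact: le_trans ler01 m1.
have Pm : P <= m * (N * G).
  rewrite (@le_trans _ _ (gamma^-1 * (N * G)))//; last by rewrite ler_wpM2r.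
  by rewrite ler_pdivlMl.
(* Each of P, gamma P and gamma^2 P is at most m N G, since gamma P <= N G; no square of m
   appears. *)
have gPm : (1 + gamma) ^+ 2 * P <= 4 * m * (N * G).
  rewrite (_ : _ * P = P + 2 * (gamma * P) + gamma * (gamma * P)); last ring.
  have h1 : gamma * (gamma * P) <= m * (N * G).
    by rewrite ler_pM ?mulr_ge0 ?(ltW gamma_gt0).
  have h2 : N * G <= m * (N * G) by rewrite ler_peMl.
  lra.
have X2 : nrm (x 0) ^+ 2 <= 2 * c1 ^+ 2 * (G ^+ 2 + (1 + gamma) ^+ 2 * P).
  have /(_ _) := lerXn2r 2 _ _ hX; rewrite !nnegrE => /(_ (nrm_ge0 _)) h.
  have /h/le_trans : 0 <= c1 * (G + (1 + gamma) * Num.sqrt P).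
    apply: mulr_ge0 => //; apply: addr_ge0 => //; apply: mulr_ge0; last exact: sqrtr_ge0.
    by apply: addr_ge0 => //; exact: ltW.
  apply; have -> : (1 + gamma) ^+ 2 * P = ((1 + gamma) * Num.sqrt P) ^+ 2.
    by rewrite exprMn (sqr_sqrtr P0).
  move: ((1 + gamma) * Num.sqrt P) => r.
  have := mulr_ge0 (sqr_ge0 c1) (sqr_ge0 (G - r)); lra.
have c2 : 0 <= c1 ^+ 2 by exact: sqr_ge0.
set k := (1 + _) * m.
have kE : k = m + 2 * c1 ^+ 2 * m + 8 * c1 ^+ 2 * m by rewrite /k; ring.
have c2m : c1 ^+ 2 <= c1 ^+ 2 * m by rewrite ler_peMr.
have key : N ^+ 2 <= 2 * c1 ^+ 2 * G ^+ 2 + (8 * c1 ^+ 2 * m + m) * (N * G).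
  have := ler_wpM2l c2 gPm; lra.
(* If the bound failed, then G <= N, so that G^2 <= N G and [key] would give N^2 <= k N G < N^2. *)
rewrite leNgt; apply/negP => kG.
have GN : G <= N.
  rewrite (le_trans _ (ltW kG))// ler_peMl// kE.
  have := mulr_ge0 c2 m0; lra.
have Npos : 0 < N by rewrite (le_lt_trans _ kG)// mulr_ge0// kE; have := mulr_ge0 c2 m0; lra.
have : k * G * N < N * N by rewrite ltr_pM2r.
apply/negP; rewrite -leNgt -expr2 (le_trans key)// kE.
have G2N : G ^+ 2 <= N * G by rewrite expr2 ler_wpM2r.
have h := ler_wpM2l c2 G2N.
have h' : c1 ^+ 2 * (N * G) <= c1 ^+ 2 * m * (N * G) by rewrite ler_wpM2r.
lra.
Qed.

End abstract_galerkin.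

(** * The position basis *)

Section orthonormal.
Context d (T : measurableType d) (R : realType).
Variables (m : {measure set T -> \bar R}) (n : nat) (b : 'I_n -> T -> R).
Local Notation L2 := (Lfun m 2%:E).
Hypothesis bL : forall i, b i \in L2.
Hypothesis borth : forall i j, inner m (b i) (b j) = (i == j)%:R.
Implicit Types (f g : T -> R) (u v : 'cV[R]_n).

Definition comb u : T -> R := \sum_i u i 0 *: b i.
Definition coords f : 'cV[R]_n := \col_i inner m f (b i).

Lemma combE u x : comb u x = \sum_i u i 0 * b i x.
Proof. by rewrite /comb fct_sumE; apply: eq_bigr => i _. Qed.

Lemma comb_Lfun2 u : comb u \in L2.
Proof. by apply: Lfun2_sum => i; exact: Lfun2Z. Qed.

Lemma comb_span u : lin_span b (comb u).
Proof. by exists (fun i => u i 0). Qed.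

Lemma inner_combl u g : g \in L2 -> inner m (comb u) g = dot u (coords g).
Proof.
by move=> gL; rewrite inner_lin_combl//; apply: eq_bigr => i _; rewrite mxE innerC.
Qed.

Lemma coords_comb u : coords (comb u) = u.
Proof.
apply/colP => i; rewrite mxE inner_lin_combl// (bigD1 i)//= borth eqxx mulr1.
by rewrite big1 ?addr0// => j /negbTE ji; rewrite borth ji mulr0.
Qed.

Lemma inner_comb u v : inner m (comb u) (comb v) = dot u v.
Proof. by rewrite inner_combl ?comb_Lfun2// coords_comb. Qed.

Lemma norm2_comb u : norm2 m (comb u) = nrm u.
Proof. by rewrite /norm2 inner_comb. Qed.

Lemma combD u v : comb (u + v) = comb u + comb v.
Proof. by rewrite /comb -big_split; apply: eq_bigr => i _; rewrite mxE scalerDl. Qed.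

Lemma combZ a u : comb (a *: u) = a *: comb u.
Proof. by rewrite /comb scaler_sumr; apply: eq_bigr => i _; rewrite mxE scalerA. Qed.

Lemma combN u : comb (- u) = - comb u.
Proof. by rewrite -scaleN1r combZ scaleN1r. Qed.

Lemma combB u v : comb (u - v) = comb u - comb v.
Proof. by rewrite combD combN. Qed.

Lemma comb_delta i : comb (delta_mx i 0) = b i.
Proof.
rewrite /comb (bigD1 i)//= mxE !eqxx scale1r big1 ?addr0// => j /negbTE ji.
by rewrite mxE ji scale0r.
Qed.

Lemma lin_span_comb f : lin_span b f -> f = comb (coords f).
Proof.
move=> [c ->]; pose u : 'cV[R]_n := \col_i c i.
have -> : \sum_i c i *: b i = comb u by apply: eq_bigr => i _; rewrite mxE.
by rewrite coords_comb.
Qed.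

Lemma coordsD f g : f \in L2 -> g \in L2 -> coords (f + g) = coords f + coords g.
Proof. by move=> fL gL; apply/colP => i; rewrite !mxE innerDl. Qed.

Lemma coordsB f g : f \in L2 -> g \in L2 -> coords (f - g) = coords f - coords g.
Proof. by move=> fL gL; apply/colP => i; rewrite !mxE innerBl. Qed.

Lemma sqr_norm2_proj f : f \in L2 ->
  norm2 m (f - comb (coords f)) ^+ 2 = norm2 m f ^+ 2 - nrm (coords f) ^+ 2.
Proof.
move=> fL; have cL := comb_Lfun2 (coords f).
rewrite !sqr_norm2 sqr_nrm !(innerBl, innerBr) ?Lfun2B//.
by rewrite (innerC _ f) inner_combl// inner_comb; ring.
Qed.

Lemma bessel f : f \in L2 -> nrm (coords f) <= norm2 m f.
Proof.
move=> fL; rewrite -(@ler_sqr R) ?nnegrE ?nrm_ge0 ?norm2_ge0//.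
by rewrite -subr_ge0 -sqr_norm2_proj// sqr_ge0.
Qed.

(** The element picked by [xget] lies in the span, so it is determined as a function by its
    coordinates, and orthogonality of the residual to each [b i] fixes these. *)
Lemma orth_projE f : f \in L2 -> orth_proj m (lin_span b) f = comb (coords f).
Proof.
move=> fL; rewrite /orth_proj; set Q := [set g | _ /\ _].
have : Q (xget 0 Q).
  apply: xgetPex; exists (comb (coords f)); split; first exact: comb_span.
  move=> w /lin_span_comb ->; rewrite innerBl ?comb_Lfun2// inner_comb.
  by rewrite innerC inner_combl// dotC subrr.
move: (xget 0 Q) => g [Wg gorth].
rewrite (lin_span_comb Wg); congr comb; apply/colP => i.
have gL : g \in L2 by rewrite (lin_span_comb Wg) comb_Lfun2.
have bi : lin_span b (b i) by rewrite -comb_delta; exact: comb_span.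
by have := gorth _ bi; rewrite innerBl// !mxE => /eqP; rewrite subr_eq0 => /eqP.
Qed.

End orthonormal.

(** * Trigonometric functions and their orthogonality *)

Section trigonometric_basis.
Context {R : realType}.
Implicit Types (k : nat) (q : R).
Local Notation lam := (@lebesgue_measure R).

Definition trig k q : R :=
  if odd k then sin ((uphalf k)%:R * q) else cos ((k./2)%:R * q).

(* exchanges the indices of sin (j q) and cos (j q) *)
Definition conj_index k := if odd k then k.+1 else k.-1.

(** The sign is the one that appears when [trig k] is differentiated into [trig (conj_index k)]:
    plus for a sine, minus for a cosine. *)
Definition freq k : R := if odd k then (uphalf k)%:R else - (uphalf k)%:R.

Lemma conj_indexK k : conj_index (conj_index k) = k.
Proof.
rewrite /conj_index; case: (boolP (odd k)) => ok /=; first by rewrite ok.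
by case: k ok => //= k; rewrite negbK => ->.
Qed.

Lemma uphalf_even k : ~~ odd k -> uphalf k = k./2.
Proof. by move=> /negbTE ok; rewrite uphalf_half ok. Qed.

Lemma uphalf_conj k : uphalf (conj_index k) = uphalf k.
Proof.
rewrite /conj_index; case: ifP => [ok|/negbT ok].
  by rewrite /= uphalf_half ok.
by rewrite (uphalf_even ok); case: k ok => //= k; rewrite negbK => ok.
Qed.

Lemma freq_conj k : freq (conj_index k) = - freq k.
Proof.
rewrite /freq uphalf_conj /conj_index; case: (boolP (odd k)) => ok /=.
  by rewrite ok.
by case: k ok => [|k] /=; rewrite ?oppr0// negbK => ->; rewrite opprK.
Qed.

Lemma conj_index_lt K k : (k < (2 * K).-1)%N -> (conj_index k < (2 * K).-1)%N.
Proof.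
rewrite /conj_index; case: ifP => [ok|_] kK; last exact: leq_ltn_trans (leq_pred k) kK.
case: K kK => // K; rewrite mulnS /= => kK; rewrite ltn_neqAle kK andbT.
by apply: contraTneq ok => [[->]]; rewrite oddM.
Qed.

Lemma der_trig k q : is_derive q 1 (trig k) (freq k * trig (conj_index k) q).
Proof.
rewrite /trig /freq /conj_index.
have dl (c : R) : is_derive q 1 (fun q : R => c * q) c.
  by apply: is_derive_val (der_scale c (der_id q)) _; rewrite mulr1.
case: (boolP (odd k)) => ok /=.
  rewrite ok /=; apply: is_derive_val (der_comp (is_derive_sin _) (dl _)) _.
  by rewrite mulrC.
rewrite (uphalf_even ok); apply: is_derive_val (der_comp (is_derive_cos _) (dl _)) _.
case: k ok => [|k] /=; first by rewrite !mulr0 oppr0 mul0r.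
by rewrite negbK => ->; rewrite mulNr mulrC mulNr.
Qed.

Lemma continuous_trig k : continuous (trig k).
Proof. exact: is_derive_continuous (der_trig k). Qed.

Lemma sin_cos_2pi (j : nat) : sin (j%:R * (pi *+ 2)) = 0 :> R /\ cos (j%:R * (pi *+ 2)) = 1 :> R.
Proof.
elim: j => [|j [s c]]; first by rewrite mul0r sin0 cos0.
rewrite -natr1 mulrDl mul1r -[sin _]/((sin : R -> R) (_ + _)) (@sinD2pi R) (@cosD2pi R).
by rewrite s c.
Qed.

Lemma trig_2pi k : trig k (pi *+ 2) = trig k 0.
Proof.
rewrite /trig !mulr0 sin0 cos0.
by case: ifP => _; [have [->]:= sin_cos_2pi (uphalf k)|have [_ ->]:= sin_cos_2pi k./2].
Qed.

(** The value 2 at j = 0 arises because [conj_index 0 = 0] counts the constant twice. *)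
Lemma trig_sqrD j q : trig j q * trig j q +
  trig (conj_index j) q * trig (conj_index j) q = if j == 0 then 2 else 1.
Proof.
have cs (x : R) : cos x * cos x + sin x * sin x = 1.
  by rewrite -!expr2 cos2Dsin2.
rewrite /trig /conj_index; case: (boolP (odd j)) => oj /=.
  by rewrite oj /= addrC cs; case: j oj.
case: j oj => [|j] /=; first by rewrite mul0r cos0 mul1r.
by rewrite negbK => -> /=; rewrite cs.
Qed.

Let T j k := \int[lam]_(q in `[0, pi *+ 2]) (trig j q * trig k q).

Let T_by_parts j k : freq j * T (conj_index j) k + freq k * T j (conj_index k) = 0.
Proof.
have ci a b : lam.-integrable `[0, pi *+ 2] (EFin \o (fun q => trig a q * trig b q)).
  by apply: continuous_integrable_itv; apply: continuous_mul; exact: continuous_trig.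
have cs (c : R) a b : continuous (fun q => c * (trig a q * trig b q)).
  by apply: continuous_mul; [exact: continuous_cst|apply: continuous_mul; exact: continuous_trig].
rewrite -!RintegralZl// -RintegralD//; last 2 first.
- exact: continuous_integrable_itv.
- exact: continuous_integrable_itv.
pose f q := freq j * (trig (conj_index j) q * trig k q) +
  freq k * (trig j q * trig (conj_index k) q).
have df q : is_derive q 1 (fun q => trig j q * trig k q) (f q).
  by apply: is_derive_val (der_mul (der_trig j q) (der_trig k q)) _; rewrite /f; ring.
rewrite (Rintegral_FTC2 twopi_gt0 df); last by apply: continuous_add.
by rewrite !trig_2pi subrr.
Qed.

(** For j > 0, integration by parts makes the integrals of sin^2 and cos^2 at the same frequency
    equal, and their sum is known. *)
Let T_diag j : T j j = if j == 0 then pi *+ 2 else pi.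
Proof.
have T1 : T j j + T (conj_index j) (conj_index j) = (pi *+ 2) * (if j == 0 then 2 else 1).
  rewrite /T -RintegralD//; last 2 first.
  - by apply: continuous_integrable_itv; apply: continuous_mul; exact: continuous_trig.
  - by apply: continuous_integrable_itv; apply: continuous_mul; exact: continuous_trig.
  transitivity (\int[lam]_(q in `[0, pi *+ 2]) (if j == 0 then 2 else 1 : R)).
    by apply: eq_Rintegral => q _; rewrite trig_sqrD.
  by rewrite Rintegral_itv_cst ?ltW ?twopi_gt0// subr0 mulrC.
case: j T1 => [|j] T1; first by move: T1; rewrite /conj_index /=; lra.
have f0 : freq j.+1 != 0.
  by rewrite /freq; case: ifP => _; rewrite ?oppr_eq0 pnatr_eq0.
have := T_by_parts j.+1 (conj_index j.+1).
rewrite freq_conj conj_indexK mulNr => /eqP; rewrite subr_eq0 => /eqP /(mulfI f0) T2.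
by move: T1; rewrite T2 /=; lra.
Qed.

(** Two integrations by parts give (freq j ^ 2 - freq k ^ 2) T j k = 0, which settles distinct
    frequencies without product formulas. *)
Lemma trig_orth j k : T j k = (j == k)%:R * (if j == 0 then pi *+ 2 else pi).
Proof.
have [->|jk] := eqVneq j k; first by rewrite T_diag mul1r.
(* Conjugate indices have equal squared frequencies and are treated apart: the integrand is then a
   multiple of the derivative of [trig j] squared. *)
rewrite mul0r; have [jck|jck] := eqVneq k (conj_index j).
  have j0 : freq j != 0.
    rewrite /freq; have : uphalf j != 0%N.
      by apply: contraNneq jk => u0; rewrite jck /conj_index; case: (j) u0.
    by rewrite -(@pnatr_eq0 R); case: ifP => _; rewrite ?oppr_eq0.
  have := T_by_parts j j; rewrite jck (_ : T (conj_index j) j = T j (conj_index j)).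
    by rewrite -mulr2n => /eqP; rewrite mulrn_eq0 /= mulf_eq0 (negbTE j0) => /eqP.
  by apply: eq_Rintegral => q _; rewrite mulrC.
have A1 := T_by_parts (conj_index j) k.
have A2 := T_by_parts j (conj_index k).
rewrite conj_indexK freq_conj in A1; rewrite conj_indexK freq_conj in A2.
have A3 : (freq j ^+ 2 - freq k ^+ 2) * T j k = 0.
  move: A1 A2; move: (T (conj_index j) (conj_index k)) => X A1 A2.
  have -> : (freq j ^+ 2 - freq k ^+ 2) * T j k =
    - freq j * (- freq j * T j k + freq k * X) + freq k * (freq j * X + - freq k * T j k) by ring.
  by rewrite A1 A2 !mulr0 addr0.
move/eqP: A3; rewrite mulf_eq0 => /orP[|/eqP//]; rewrite subr_eq0 => /eqP fjk.
have {fjk} : uphalf j = uphalf k.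
  have E i : freq i ^+ 2 = (uphalf i ^ 2)%:R.
    by rewrite natrX /freq; case: ifP; rewrite ?sqrrN.
  by move/eqP: fjk; rewrite !E eqr_nat eqn_exp2r// => /eqP.
move: jk jck; rewrite /conj_index => /eqP jk /eqP jck ujk.
exfalso; move: (odd_double_half j) (odd_double_half k); move: ujk jk jck.
rewrite !uphalf_half; case: (odd j); case: (odd k) => /=.
all: move: (j./2) (k./2) => a c; lia.
Qed.

End trigonometric_basis.

(** * The basis [G_k] and the Poincare inequality of [nu] *)

Section position_basis.
Context {R : realType}.
Variable beta : R.
Hypothesis beta_gt0 : 0 < beta.
Implicit Types (k n K : nat) (q : R) (f g : R -> R).
Local Notation lam := (@lebesgue_measure R).
Local Notation nu := (nu beta).
Local Notation G := (G_k beta).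
Local Notation Z := (Z_nu beta).

Definition G_amp k : R := if k == 0 then Num.sqrt (Z / (pi *+ 2)) else Num.sqrt (Z / pi).

Lemma G_kE k q : G k q = G_amp k * trig k q * expR (beta / 2 * V_pot q).
Proof.
rewrite /G_k /G_amp mulrAC; case: eqVneq => [->|_].
  by rewrite /trig /= mul0r cos0 mulr1.
by rewrite mulrAC.
Qed.

Lemma G_amp_conj k : G_amp (conj_index k) = G_amp k.
Proof.
by rewrite /G_amp /conj_index; case: k => [|[|k]] //; case: (odd _).
Qed.

Lemma G_amp_gt0 k : 0 < G_amp k.
Proof.
rewrite /G_amp; case: ifP => _; rewrite sqrtr_gt0 divr_gt0 ?Z_nu_gt0 ?twopi_gt0//.
exact: pi_gt0.
Qed.

Lemma der_V q : is_derive q 1 (@V_pot R) (sin q).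
Proof.
apply: is_derive_val (der_add (der_cst 1 q) (der_opp (is_derive_cos q))) _.
by rewrite add0r opprK.
Qed.

Lemma derive1_V q : derive1 (@V_pot R) q = sin q.
Proof. exact: derive1_val (der_V q). Qed.

(** The first term stays in a truncated span, which is stable under [conj_index]. The second
    differentiates the weight e^(beta V / 2) and is the only source of truncation errors. *)
Definition dG k q : R := freq k * G (conj_index k) q + beta / 2 * (sin q * G k q).

Lemma der_G k q : is_derive q 1 (G k) (dG k q).
Proof.
rewrite (_ : G k = fun q => G_amp k * trig k q * expR (beta / 2 * V_pot q)); last first.
  by apply/funext => x; rewrite G_kE.
apply: is_derive_val (der_mul (der_scale _ (der_trig k q))
  (der_exp (der_scale _ (der_V q)))) _.
by rewrite /dG !G_kE G_amp_conj; ring.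
Qed.

Lemma continuous_G k : continuous (G k).
Proof. exact: is_derive_continuous (der_G k). Qed.

Lemma continuous_sinM f : continuous f -> continuous (fun q => sin q * f q).
Proof. by apply: continuous_mul; exact: continuous_sin. Qed.

Lemma continuous_dG k : continuous (dG k).
Proof.
apply: continuous_add.
  by apply: continuous_mul; [exact: continuous_cst|exact: continuous_G].
apply: continuous_mul; first exact: continuous_cst.
by apply: continuous_sinM; exact: continuous_G.
Qed.

Lemma V_2pi : V_pot (pi *+ 2) = V_pot (0 : R).
Proof. by rewrite /V_pot cos2pi cos0. Qed.

Lemma G_2pi k : G k (pi *+ 2) = G k 0.
Proof. by rewrite !G_kE trig_2pi V_2pi. Qed.

Lemma der_wt q : is_derive q 1 (wt beta) (- (beta * sin q) * wt beta q).
Proof.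
apply: is_derive_val (der_exp (der_opp (der_scale beta (der_V q)))) _.
by rewrite /wt; ring.
Qed.

Lemma Lfun2_nu f : continuous f -> f \in Lfun nu 2%:E.
Proof.
move=> cf; apply: Lfun2P; first exact: continuous_measurable_fun.
by apply: nu_integrable; exact: continuous_mul.
Qed.

(** The derivative of f times the weight integrates to 0 over a period, and the weight has
    logarithmic derivative - beta sin q. *)
Lemma nu_by_parts f f' : (forall q, is_derive q 1 f (f' q)) -> continuous f' ->
  f (pi *+ 2) = f 0 -> \int[nu]_q f' q = beta * \int[nu]_q (sin q * f q).
Proof.
move=> df cf' f2pi; have cf := is_derive_continuous df.
have cs := continuous_sinM cf.
rewrite -RintegralZl//; last exact: nu_integrable.
have cbs : continuous (fun q => beta * (sin q * f q)).
  by apply: continuous_mul => //; exact: continuous_cst.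
apply/eqP; rewrite -subr_eq0; apply/eqP.
rewrite -RintegralB//; [|exact: nu_integrable..].
rewrite nu_RintegralE; last by apply: continuous_add => //; exact: continuous_opp.
have dfw q : is_derive q 1 (fun q => f q * wt beta q)
    ((f' q - beta * (sin q * f q)) * wt beta q).
  by apply: is_derive_val (der_mul (df q) (der_wt q)) _; ring.
rewrite (Rintegral_FTC2 twopi_gt0 dfw).
  by rewrite f2pi /wt V_2pi subrr mulr0.
apply: continuous_mul; last exact: continuous_wt.
by apply: continuous_add => //; exact: continuous_opp.
Qed.

Lemma inner_nu_by_parts f f' g g' :
  (forall q, is_derive q 1 f (f' q)) -> continuous f' -> f (pi *+ 2) = f 0 ->
  (forall q, is_derive q 1 g (g' q)) -> continuous g' -> g (pi *+ 2) = g 0 ->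
  inner nu f' g + inner nu f g' = beta * inner nu (fun q => sin q * f q) g.
Proof.
move=> df cf' f2 dg cg' g2.
have cf := is_derive_continuous df; have cg := is_derive_continuous dg.
rewrite /inner -RintegralD//; [|by apply: nu_integrable; exact: continuous_mul..].
have dfg q : is_derive q 1 (fun q => f q * g q) (f' q * g q + f q * g' q).
  exact: der_mul.
rewrite (nu_by_parts dfg); last 2 first.
- by apply: continuous_add; exact: continuous_mul.
- by rewrite f2 g2.
by congr (_ * _); apply: eq_Rintegral => q _; rewrite mulrA.
Qed.

(** The two factors e^(beta V / 2) cancel the Gibbs weight, which leaves the trigonometric
    integrals. *)
Lemma G_orth j k : inner nu (G j) (G k) = (j == k)%:R.
Proof.
have Z0 := Z_nu_gt0 beta; have pi0 := @pi_gt0 R.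
rewrite /inner nu_RintegralE; last by apply: continuous_mul; exact: continuous_G.
transitivity (Z^-1 * (G_amp j * G_amp k * \int[lam]_(q in `[0, pi *+ 2]) (trig j q * trig k q))).
  congr (_ * _); rewrite -RintegralZl//; last first.
    by apply: continuous_integrable_itv; apply: continuous_mul; exact: continuous_trig.
  apply: eq_Rintegral => q _; rewrite !G_kE /wt.
  have -> : expR (- (beta * V_pot q)) = (expR (beta / 2 * V_pot q))^-1 * (expR (beta / 2 * V_pot q))^-1.
    by rewrite -expRN -expRD; congr expR; field.
  have : expR (beta / 2 * V_pot q) != 0 by rewrite expR_eq0.
  by move: (expR _) => e e0; field.
rewrite trig_orth; have [<-|_] := eqVneq j k; last by rewrite mul0r !mulr0.
rewrite mul1r -expr2 /G_amp; case: ifP => _; rewrite sqr_sqrtr ?divr_ge0 ?ltW//.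
- by rewrite divfK ?mulVf// gt_eqF// twopi_gt0.
- by rewrite twopi_gt0.
- by rewrite divfK ?mulVf// gt_eqF.
Qed.

(** By Cauchy-Schwarz, |f q - f 0|^2 is at most 2 pi times the Lebesgue integral of f'^2, which
    [wt_ge] compares with the integral against [nu]. The constant is explicit but not sharp. *)
Lemma poincare : exists2 C, 0 < C & forall f f',
  (forall q, is_derive q 1 f (f' q)) -> continuous f' -> \int[nu]_q f q = 0 ->
  norm2 nu f <= C * norm2 nu f'.
Proof.
have Z0 := Z_nu_gt0 beta; have pi0 := @twopi_gt0 R.
pose C2 : R := pi *+ 2 * Z * expR (`|beta| * 2).
have C20 : 0 < C2 by rewrite !mulr_gt0 ?expR_gt0.
exists (Num.sqrt C2); first by rewrite sqrtr_gt0.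
move=> f f' df cf' mf; have cf := is_derive_continuous df.
rewrite /norm2 -sqrtrM ?(ltW C20)// ler_sqrt; last first.
  by rewrite mulr_ge0 ?(ltW C20)// inner_ge0.
have cff : continuous (fun q => f' q * f' q) by exact: continuous_mul.
set J := \int[lam]_(q in `[0, pi *+ 2]) (f' q * f' q).
have J0 : 0 <= J by apply: Rintegral_ge0 => q _; rewrite -expr2 sqr_ge0.
have JE : J <= Z * expR (`|beta| * 2) * inner nu f' f'.
  rewrite /inner nu_RintegralE//; set I := \int[lam]_(x in _) _.
  have -> : Z * expR (`|beta| * 2) * (Z^-1 * I) = expR (`|beta| * 2) * I.
    by field; rewrite gt_eqF.
  rewrite /I.
  rewrite -RintegralZl//; last first.
    by apply: continuous_integrable_itv; apply: continuous_mul => //; exact: continuous_wt.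
  apply: le_Rintegral => //; first exact: continuous_integrable_itv.
    apply: continuous_integrable_itv; apply: continuous_mul; first exact: continuous_cst.
    by apply: continuous_mul => //; exact: continuous_wt.
  move=> q _; rewrite mulrCA ler_peMr -?expr2 ?sqr_ge0//.
  rewrite -(@ler_pM2l _ (expR (- (`|beta| * 2)))) ?expR_gt0// mulr1 mulrA -expRD addNr.
  by rewrite expR0 mul1r wt_ge.
have fq q : q \in `[0, pi *+ 2] -> (f q - f 0) ^+ 2 <= J * (pi *+ 2).
  rewrite in_itv /= => /andP[]; rewrite le_eqVlt => /predU1P[<- _|q0 q2].
    by rewrite subrr expr0n mulr_ge0// ltW.
  rewrite -(Rintegral_FTC2 q0 df cf'); set I := \int[lam]_(x in _) _.
  apply: (@le_trans _ _ (\int[lam]_(x in `[0, q]) (f' x * f' x) * q)).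
    apply: quadratic_form_CS => s t.
    have -> : s ^+ 2 * \int[lam]_(x in `[0, q]) (f' x * f' x) + 2 * s * t * I + t ^+ 2 * q =
      \int[lam]_(x in `[0, q]) (s ^+ 2 * (f' x * f' x) + 2 * s * t * f' x + t ^+ 2).
      rewrite RintegralD//; last 2 first.
      - apply: continuous_integrable_itv; apply: continuous_add;
          by apply: continuous_mul => //; exact: continuous_cst.
      - by apply: continuous_integrable_itv; exact: continuous_cst.
      rewrite RintegralD//; last 2 first.
      - by apply: continuous_integrable_itv; apply: continuous_mul => //; exact: continuous_cst.
      - by apply: continuous_integrable_itv; apply: continuous_mul => //; exact: continuous_cst.
      rewrite Rintegral_itv_cst ?(ltW q0)// subr0.
      by rewrite RintegralZl ?RintegralZl//; exact: continuous_integrable_itv.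
    apply: Rintegral_ge0 => x _.
    have -> : s ^+ 2 * (f' x * f' x) + 2 * s * t * f' x + t ^+ 2 = (s * f' x + t) ^+ 2.
      by ring.
    exact: sqr_ge0.
  rewrite ler_pM ?(ltW q0)//.
    by apply: Rintegral_ge0 => x _; rewrite -expr2 sqr_ge0.
  rewrite -subr_ge0 Rintegral_itvB ?bnd_simp ?(ltW q0)//.
    by apply: Rintegral_ge0 => x _; rewrite -expr2 sqr_ge0.
  exact: continuous_integrable_itv.
have c1 : continuous (fun q => (f q - f 0) * (f q - f 0)).
  by apply: continuous_mul; apply: continuous_add => //; exact: continuous_cst.
(* As f has mean zero, subtracting the constant f 0 only increases the norm. *)
apply: (@le_trans _ _ (\int[nu]_q ((f q - f 0) * (f q - f 0)))).
  have -> : \int[nu]_q ((f q - f 0) * (f q - f 0)) = inner nu f f + f 0 ^+ 2.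
    transitivity (\int[nu]_q (f q * f q + (- 2 * f 0) * f q + f 0 ^+ 2)).
      by apply: eq_Rintegral => q _; ring.
    rewrite RintegralD//; last 2 first.
    - apply: nu_integrable; apply: continuous_add; apply: continuous_mul => //.
      exact: continuous_cst.
    - by apply: nu_integrable; exact: continuous_cst.
    rewrite RintegralD//; last 2 first.
    - by apply: nu_integrable; apply: continuous_mul.
    - by apply: nu_integrable; apply: continuous_mul => //; exact: continuous_cst.
    rewrite RintegralZl//; last exact: nu_integrable.
    by rewrite mf mulr0 addr0 Rintegral_cst//= nu_setT mulr1.
  by rewrite lerDl sqr_ge0.
rewrite nu_RintegralE// -(ler_pM2l Z0) mulrA divff ?gt_eqF// mul1r.
apply: (@le_trans _ _ (\int[lam]_(q in `[0, pi *+ 2]) (J * (pi *+ 2) * wt beta q))).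
  apply: le_Rintegral => //.
  - by apply: continuous_integrable_itv; apply: continuous_mul => //; exact: continuous_wt.
  - apply: continuous_integrable_itv; apply: continuous_mul; last exact: continuous_wt.
    exact: continuous_cst.
  - by move=> q qI; rewrite ler_wpM2r ?expR_ge0// -expr2 fq.
rewrite RintegralZl//; last by apply: continuous_integrable_itv; exact: continuous_wt.
rewrite -Z_nuE mulrC ler_pM2l// /C2 mulrC.
have := ler_wpM2l (ltW pi0) JE; rewrite (mulrC (pi *+ 2) J) => /le_trans; apply.
by rewrite !mulrA.
Qed.

End position_basis.

Section lin_span.
Context d (T : measurableType d) (R : realType) (n : nat).
Variable b : 'I_n -> T -> R.

Lemma lin_spanD f g :
  lin_span b f -> lin_span b g -> lin_span b (f + g).
Proof.
move=> [c ->] [c' ->]; exists (fun i => c i + c' i).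
by rewrite -big_split; apply: eq_bigr => i _; rewrite scalerDl.
Qed.

Lemma lin_spanZ a f :
  lin_span b f -> lin_span b (a *: f).
Proof.
move=> [c ->]; exists (fun i => a * c i).
by rewrite scaler_sumr; apply: eq_bigr => i _; rewrite scalerA.
Qed.

Lemma lin_span0 : lin_span b 0.
Proof. by exists (fun=> 0); rewrite big1// => i _; rewrite scale0r. Qed.

Lemma lin_span_gen i : lin_span b (b i).
Proof.
exists (fun j => (j == i)%:R); rewrite (bigD1 i)//= eqxx scale1r big1 ?addr0//.
by move=> j /negbTE ->; rewrite scale0r.
Qed.

Lemma lin_span_sum k (F : 'I_k -> T -> R) :
  (forall i, lin_span b (F i)) -> lin_span b (\sum_i F i).
Proof. by move=> h; elim/big_ind : _ => //; [exact: lin_span0|exact: lin_spanD]. Qed.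

End lin_span.

(** The projection reproduces f, so the residual of f + g is that of g. It isolates the part of a
    derivative that leaves the Galerkin space. *)
Lemma norm2_residual_le d (T : measurableType d) (R : realType)
    (m : {measure set T -> \bar R}) n (b : 'I_n -> T -> R) f g :
  (forall i, b i \in Lfun m 2%:E) -> (forall i j, inner m (b i) (b j) = (i == j)%:R) ->
  lin_span b f -> g \in Lfun m 2%:E ->
  norm2 m (f + g - comb b (coords m b (f + g))) <= norm2 m g.
Proof.
move=> bL bo fW gL; have fE := lin_span_comb bL bo fW.
have fL : f \in Lfun m 2%:E by rewrite fE; exact: comb_Lfun2.
rewrite coordsD// combD -fE opprD addrACA subrr add0r.
rewrite -(@ler_sqr R) ?nnegrE ?norm2_ge0// sqr_norm2_proj//.
by rewrite lerBlDr lerDl sqr_ge0.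
Qed.

(** * The matrix of the position derivative *)

Section galerkin_matrix.
Context {R : realType}.
Variable beta : R.
Hypothesis beta_gt0 : 0 < beta.
Variable K : nat.
Local Notation n := ((2 * K).-1).
Local Notation nu := (nu beta).
Local Notation sb := (Num.sqrt beta).
Implicit Types (u v : 'cV[R]_n) (i j : 'I_n) (q : R).

Definition gbasis i : R -> R := G_k beta i.
Definition dbasis i : R -> R := dG beta i.

Lemma gbasis_Lfun2 i : gbasis i \in Lfun nu 2%:E.
Proof. by apply: Lfun2_nu; exact: continuous_G. Qed.

Lemma dbasis_Lfun2 i : dbasis i \in Lfun nu 2%:E.
Proof. by apply: Lfun2_nu; exact: continuous_dG. Qed.

Lemma gbasis_orth i j : inner nu (gbasis i) (gbasis j) = (i == j)%:R.
Proof. exact: G_orth. Qed.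

Let bL := gbasis_Lfun2.
Let dL := dbasis_Lfun2.
Let bo := gbasis_orth.

Lemma der_comb u q : is_derive q 1 (comb gbasis u) (comb dbasis u q).
Proof.
rewrite (_ : comb gbasis u = fun q => \sum_i u i 0 * gbasis i q); last first.
  by apply/funext => x; rewrite combE.
by rewrite combE; apply: der_sum => i; apply: der_scale; exact: der_G.
Qed.

Lemma continuous_comb_gbasis u : continuous (comb gbasis u).
Proof. exact: is_derive_continuous (der_comb u). Qed.

Lemma sinM_Lfun2 f : continuous f -> (fun q => sin q * f q) \in Lfun nu 2%:E.
Proof. by move=> cf; apply: Lfun2_nu; exact: continuous_sinM. Qed.

Lemma norm2_sinM f : continuous f -> norm2 nu (fun q => sin q * f q) <= norm2 nu f.
Proof.
move=> cf; rewrite ler_sqrt ?inner_ge0//; have cs := continuous_sinM cf.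
apply: le_Rintegral => //.
- exact: nu_integrable (continuous_mul cs cs).
- exact: nu_integrable (continuous_mul cf cf).
move=> q _; rewrite mulrACA -!expr2 ler_piMl ?sqr_ge0//.
Qed.

Definition Dmx : 'M[R]_n := \matrix_(i, j) (sb^-1 * inner nu (gbasis i) (dbasis j)).

Definition one_coords : 'cV[R]_n := coords nu gbasis (cst 1).

Lemma one_Lfun2 : cst 1 \in Lfun nu 2%:E.
Proof. by apply: Lfun2_nu; exact: continuous_cst. Qed.

Let sb_gt0 : 0 < sb. Proof. by rewrite sqrtr_gt0. Qed.

Lemma Dmx_mul u : Dmx *m u = sb^-1 *: coords nu gbasis (comb dbasis u).
Proof.
apply/colP => i; rewrite !mxE inner_lin_combl; [|exact: dL|exact: bL].
rewrite mulr_sumr; apply: eq_bigr => j _; rewrite !mxE innerC.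
by rewrite -mulrA; congr (_ * _); rewrite mulrC.
Qed.

Lemma sinM_comb u :
  (fun q => sin q * comb gbasis u q) = \sum_j u j 0 *: (fun q => sin q * gbasis j q).
Proof.
apply/funext => q; rewrite combE mulr_sumr fct_sumE.
by apply: eq_bigr => j _; rewrite fctE mulrCA.
Qed.

(** In [nu] the derivative is antisymmetric up to multiplication by beta sin q; the scaling of [Dmx]
    turns beta into beta / sqrt beta = sqrt beta. *)
Lemma Dmx_sym i j :
  Dmx i j + Dmx j i = sb * inner nu (fun q => sin q * gbasis j q) (gbasis i).
Proof.
rewrite !mxE -mulrDr (innerC nu (gbasis i)).
rewrite (@inner_nu_by_parts _ _ _ _ _ _ (der_G beta j) (@continuous_dG _ beta j)
  (G_2pi beta j) (der_G beta i) (@continuous_dG _ beta i) (G_2pi beta i)).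
rewrite mulrA; congr (_ * _).
by rewrite -{2}(sqr_sqrtr (ltW beta_gt0)) expr2 mulKf ?gt_eqF.
Qed.

Lemma Dmx_tr u :
  Dmx *m u + Dmx^T *m u = sb *: coords nu gbasis (fun q => sin q * comb gbasis u q).
Proof.
rewrite -mulmxDl; apply/colP => i; rewrite mxE [RHS]mxE [coords _ _ _ _ _]mxE.
transitivity (\sum_j sb * (u j 0 * inner nu (fun q => sin q * gbasis j q) (gbasis i))).
  by apply: eq_bigr => j _; rewrite mxE [Dmx^T _ _]mxE Dmx_sym mulrAC mulrA.
rewrite -mulr_sumr; congr (_ * _).
rewrite sinM_comb inner_lin_combl//.
by move=> j; apply: sinM_Lfun2; exact: continuous_G.
Qed.

(** [D + D^T] is sqrt beta times the compression of multiplication by sin q, a contraction. *)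
Lemma Dmx_bounded u : nrm (Dmx *m u) <= nrm (Dmx^T *m u) + sb * nrm u.
Proof.
have cc := @continuous_comb_gbasis u.
rewrite -[Dmx *m u](addrK (Dmx^T *m u)) Dmx_tr addrC.
apply: (le_trans (nrm_triangle _ _)); rewrite -scaleN1r nrmZ normrN1 mul1r lerD2l.
rewrite nrmZ ger0_norm ?(ltW sb_gt0)// ler_pM2l//.
apply: (le_trans (bessel bL bo (sinM_Lfun2 cc))).
by apply: (le_trans (norm2_sinM cc)); rewrite norm2_comb.
Qed.

Definition conj_ord i : 'I_n := Ordinal (conj_index_lt (ltn_ord i)).

Lemma conj_ordK : involutive conj_ord.
Proof. by move=> i; apply: val_inj; exact: conj_indexK. Qed.

(** Read at the conjugate index, differentiation is multiplication by the frequency, up to a bounded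
    term. *)
Lemma coords_dcomb u i : coords nu gbasis (comb dbasis u) (conj_ord i) 0 =
  freq i * u i 0 + beta / 2 * coords nu gbasis (fun q => sin q * comb gbasis u q) (conj_ord i) 0.
Proof.
have cG j : (fun q => sin q * gbasis j q) \in Lfun nu 2%:E.
  by apply: sinM_Lfun2; exact: continuous_G.
rewrite !mxE inner_lin_combl; [|exact: dL|exact: bL].
rewrite sinM_comb.
rewrite inner_lin_combl; [|exact: cG|exact: bL].
have E j : inner nu (dbasis j) (gbasis (conj_ord i)) =
    freq j * (j == i)%:R + beta / 2 * inner nu (fun q => sin q * gbasis j q) (gbasis (conj_ord i)).
  have -> : dbasis j = freq j *: gbasis (conj_ord j) + (beta / 2) *: (fun q => sin q * gbasis j q).
    by [].
  rewrite innerDl ?innerZl ?Lfun2Z// bo (inj_eq (inv_inj conj_ordK))//.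
under eq_bigr do rewrite E mulrDr.
rewrite big_split /= mulr_sumr; congr (_ + _).
  rewrite (bigD1 i)//= eqxx mulr1 mulrC big1 ?addr0// => j /negbTE ->.
  by rewrite !mulr0.
by apply: eq_bigr => j _; rewrite mulrCA.
Qed.

(** The function 1 has derivative 0, so only the projection error e = 1 - Pi 1 contributes: the
    derivative of Pi 1 has the same coordinates as - (beta / 2) sin q e, and e has norm at most
    1. *)
Lemma Dmx_one : nrm (Dmx *m one_coords) <= sb / 2.
Proof.
have cc := @continuous_comb_gbasis one_coords.
have cs := continuous_sinM cc.
pose e q : R := 1 - comb gbasis one_coords q.
have ce : continuous e by apply: continuous_add; [exact: continuous_cst|exact: continuous_opp].
(* This comes from integrating the derivative of the conjugate basis function: its sin q term has
   factor beta / 2, integration by parts produces beta, and the difference remains. *)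
have mean_G i : freq i * one_coords i 0 =
    - (beta / 2) * coords nu gbasis (fun q => sin q * 1) (conj_ord i) 0.
  have := nu_by_parts beta (der_G beta (conj_ord i)) (@continuous_dG _ beta (conj_ord i))
    (G_2pi beta (conj_ord i)).
  rewrite /dG conj_indexK freq_conj.
  have iG j : nu.-integrable setT (EFin \o G_k beta j).
    by apply: nu_integrable; exact: continuous_G.
  have isG j : nu.-integrable setT (EFin \o (fun q => sin q * G_k beta j q)).
    by apply: nu_integrable; apply: continuous_sinM; exact: continuous_G.
  rewrite RintegralD//; last 2 first.
  - apply: nu_integrable; apply: continuous_mul; first exact: continuous_cst.
    exact: continuous_G.
  - apply: nu_integrable; apply: continuous_mul; first exact: continuous_cst.
    by apply: continuous_sinM; exact: continuous_G.
  rewrite !RintegralZl// !mxE.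
  have -> : inner nu (fun q => sin q * 1) (gbasis (conj_ord i)) =
      \int[nu]_q (sin q * G_k beta (conj_ord i) q).
    by apply: eq_Rintegral => q _; rewrite mulr1.
  have -> : inner nu (cst 1) (gbasis i) = \int[nu]_q G_k beta i q.
    by apply: eq_Rintegral => q _; rewrite mul1r.
  lra.
have coordsE : coords nu gbasis (comb dbasis one_coords) =
    (- (beta / 2)) *: coords nu gbasis (fun q => sin q * e q).
  apply/colP => k; rewrite -[k]conj_ordK; set i := conj_ord k.
  rewrite coords_dcomb mean_G mxE.
  have -> : (fun q => sin q * e q) = (fun q => sin q * 1) - (fun q => sin q * comb gbasis one_coords q).
    by apply/funext => q; rewrite /e mulrBr.
  rewrite (coordsB bL); [|by apply: sinM_Lfun2; exact: continuous_cst|exact: sinM_Lfun2].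
  by rewrite !mxE; ring.
rewrite Dmx_mul coordsE scalerA nrmZ.
have -> : `|sb^-1 * - (beta / 2)| = sb / 2.
  rewrite mulrN normrN ger0_norm ?mulr_ge0 ?invr_ge0 ?ltW// mulrA; congr (_ / 2).
  by rewrite -{2}(sqr_sqrtr (ltW beta_gt0)) expr2 mulKf ?gt_eqF.
rewrite ler_piMr ?divr_ge0 ?(ltW sb_gt0)//; apply: (le_trans (bessel bL bo (sinM_Lfun2 ce))).
apply: (le_trans (norm2_sinM ce)).
have eE : e = cst 1 - comb gbasis one_coords by [].
rewrite -(@ler_sqr R) ?nnegrE ?norm2_ge0// eE (sqr_norm2_proj bL bo one_Lfun2).
rewrite expr1n sqr_norm2 (_ : inner nu (cst 1) (cst 1) = 1); first by rewrite lerBlDr lerDl sqr_ge0.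
rewrite /inner; under eq_Rintegral do rewrite mulr1.
by rewrite Rintegral_cst//= nu_setT mulr1.
Qed.

End galerkin_matrix.

Lemma continuous_sum (R : realType) n (F : 'I_n -> R -> R) :
  (forall i, continuous (F i)) -> continuous (fun x => \sum_i F i x).
Proof.
elim: n F => [|n IH] F cF.
  under eq_fun do rewrite big_ord0.
  exact: continuous_cst.
under eq_fun do rewrite big_ord_recl.
by apply: continuous_add => //; exact: IH.
Qed.

(** * A Poincare inequality uniform in the truncation *)

Section galerkin_poincare.
Context {R : realType}.
Variable beta : R.
Hypothesis beta_gt0 : 0 < beta.
Local Notation nu := (nu beta).
Local Notation sb := (Num.sqrt beta).
Implicit Types (q : R) (K : nat).

(** The coordinate on [G_k beta 0] suffices: as V >= 0, this function is bounded below by its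
    amplitude, whatever K. *)
Lemma one_coords_ge : exists2 omega, 0 < omega &
  forall K, (0 < K)%N -> omega <= nrm (one_coords beta K).
Proof.
have G0 q : G_amp beta 0 <= G_k beta 0 q.
  rewrite G_kE /trig /= mul0r cos0 mulr1 ler_peMr ?(ltW (G_amp_gt0 _ _))//.
  rewrite -expR0 ler_expR mulr_ge0 ?divr_ge0 ?(ltW beta_gt0)//.
  by rewrite subr_ge0 cos_le1.
exists (G_amp beta 0); first exact: G_amp_gt0.
move=> K K0; have n0 : (0 < (2 * K).-1)%N by case: K K0 => // K _; rewrite mulnS.
pose i0 := Ordinal n0.
apply: (@le_trans _ _ (one_coords beta K i0 0)).
  rewrite mxE /inner.
  apply: (@le_trans _ _ (\int[nu]_q (G_amp beta 0))).
    by rewrite Rintegral_cst//= nu_setT mulr1.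
  apply: le_Rintegral => //.
  - by apply: nu_integrable; exact: continuous_cst.
  - apply: nu_integrable; apply: continuous_mul; first exact: continuous_cst.
    exact: continuous_G.
  - by move=> q _; rewrite mul1r; exact: G0.
apply: (le_trans (ler_norm _)); rewrite -sqrtr_sqr ler_sqrt ?dot_ge0//.
rewrite /dot (bigD1 i0)//= -expr2 lerDl sumr_ge0// => i _.
by rewrite -expr2 sqr_ge0.
Qed.

Section sin_span.
Variable K : nat.
Local Notation n := ((2 * K).-1).
Local Notation W := (lin_span (@gbasis R beta K)).
Local Notation ebV := (fun q => expR (beta / 2 * V_pot q)).

Lemma span_trig k : (k < n)%N -> W (fun q => trig k q * ebV q).
Proof.
move=> kn; have := lin_spanZ ((G_amp beta k)^-1) (lin_span_gen (@gbasis R beta K) (Ordinal kn)).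
congr (lin_span _); apply/funext => q; rewrite fctE /gbasis G_kE /=.
by rewrite /GRing.scale /= -mulrA mulKf// gt_eqF// G_amp_gt0.
Qed.

Lemma span_cos j : (j < K)%N -> W (fun q => cos (j%:R * q) * ebV q).
Proof.
move=> jK; have := @span_trig j.*2; rewrite /trig odd_double doubleK; apply.
lia.
Qed.

Lemma span_sin j : (j < K)%N -> W (fun q => sin (j%:R * q) * ebV q).
Proof.
case: j => [_|j jK].
  have := lin_span0 (@gbasis R beta K); congr (lin_span _).
  by apply/funext => q; rewrite mul0r sin0 mul0r.
have := @span_trig j.*2.+1; rewrite /trig [uphalf _]/= /= odd_double doubleK /=.
by apply; lia.
Qed.

(** Product formulas turn the frequency j into j - 1 and j + 1, and a frequency step is an index
    step of 2; hence the condition on k. *)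
Lemma span_sinM k : (k.+2 < n)%N -> W (fun q => sin q * G_k beta k q).
Proof.
move=> kn; have [ok|ok] := boolP (odd k).
  have [j kE] : exists j, k = j.*2.+1.
    by exists k./2; rewrite -[LHS]odd_double_half ok.
  have h1 : (j < K)%N by lia. have h2 : (j.+2 < K)%N by lia.
  have := lin_spanZ (G_amp beta k / 2) (lin_spanD (span_cos h1) (lin_spanZ (-1) (span_cos h2))).
  congr (lin_span _); apply/funext => q; rewrite !fctE G_kE /trig ok.
  have -> : uphalf k = j.+1 by rewrite kE /= doubleK.
  have -> : j%:R * q = j.+1%:R * q - q by rewrite -natr1 mulrDl mul1r addrK.
  have -> : j.+2%:R * q = j.+1%:R * q + q by rewrite -[in LHS]natr1 mulrDl mul1r.
  by rewrite cosB cosD /GRing.scale /=; field.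
have [j kE] : exists j, k = j.*2.
  by exists k./2; rewrite -[LHS]odd_double_half (negbTE ok).
have h1 : (j.+1 < K)%N by lia.
case: j kE h1 => [|j] kE h1.
  have := lin_spanZ (G_amp beta k) (span_sin h1).
  congr (lin_span _); apply/funext => q; rewrite !fctE G_kE /trig (negbTE ok) kE /=.
  by rewrite mul0r cos0 mul1r /GRing.scale /=; ring.
have h2 : (j < K)%N by lia.
have := lin_spanZ (G_amp beta k / 2) (lin_spanD (span_sin h1) (lin_spanZ (-1) (span_sin h2))).
congr (lin_span _); apply/funext => q; rewrite !fctE G_kE /trig (negbTE ok).
have -> : k./2 = j.+1 by rewrite kE doubleK.
have -> : j%:R * q = j.+1%:R * q - q by rewrite -natr1 mulrDl mul1r addrK.
have -> : j.+2%:R * q = j.+1%:R * q + q by rewrite -[in LHS]natr1 mulrDl mul1r.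
by rewrite sinB sinD /GRing.scale /=; field.
Qed.

End sin_span.

Section truncation.
Variable K : nat.
Local Notation n := ((2 * K).-1).
Local Notation b := (@gbasis R beta K).
Local Notation db := (@dbasis R beta K).
Local Notation bL := (@gbasis_Lfun2 R beta K).
Local Notation bo := (@gbasis_orth R beta K).
Variable u : 'cV[R]_n.

(** The part of u of highest frequency K - 1, the only one that multiplication by sin q may take out
    of the span. *)
Definition top_modes : 'cV[R]_n := \col_i (if (i.+2 < n)%N then 0 else u i 0).
Let r := coords nu b (comb db u).
Let z := r - (beta / 2) *: coords nu b (fun q => sin q * comb b u q).

Let z_conj i : z (conj_ord i) 0 = freq i * u i 0.
Proof.
by rewrite [LHS]mxE [X in _ + X]mxE [X in _ - X]mxE /r coords_dcomb addrK.
Qed.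

Let z_le : nrm z <= nrm r + beta / 2 * nrm u.
Proof.
apply: (le_trans (nrm_triangle _ _)); rewrite -scaleN1r nrmZ normrN1 mul1r lerD2l.
rewrite nrmZ ger0_norm ?divr_ge0 ?(ltW beta_gt0)// ler_wpM2l ?divr_ge0 ?(ltW beta_gt0)//.
have cc := @continuous_comb_gbasis R beta K u.
apply: (le_trans (bessel bL bo (sinM_Lfun2 beta cc))).
by apply: (le_trans (norm2_sinM beta cc)); rewrite (norm2_comb bL bo).
Qed.

(** Without its sin q term, the projected derivative has coordinates [freq i * u i 0], and on the
    top modes the frequency is K - 1. High modes are thus controlled with a gain of order 1/K. *)
Lemma top_modes_le : (K%:R - 1) * nrm top_modes <= nrm r + beta / 2 * nrm u.
Proof.
apply: le_trans z_le.
have [K0|K0] := leP (K%:R - 1) (0 : R).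
  by rewrite (le_trans _ (nrm_ge0 z))// mulr_le0_ge0 ?nrm_ge0.
rewrite -(@ler_sqr R) ?nnegrE ?mulr_ge0 ?nrm_ge0 ?(ltW K0)// exprMn !sqr_nrm.
rewrite /dot mulr_sumr (reindex_inj (inv_inj (@conj_ordK K))) /=.
rewrite (reindex_inj (inv_inj (@conj_ordK K))) [leRHS](reindex_inj (inv_inj (@conj_ordK K))) /=.
apply: ler_sum => i _; rewrite conj_ordK z_conj mxE; case: ifPn => [_|ni].
  by rewrite mulr0 mulr0 -expr2 sqr_ge0.
rewrite -!expr2 exprMn ler_wpM2r ?sqr_ge0//.
have ui : uphalf i = K.-1.
  by have := ltn_ord i; rewrite uphalf_half; have := odd_double_half i; case: (odd i) => /=; lia.
have K1 : (0 < K)%N by rewrite -(ltr_nat R); lra.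
have -> : freq i ^+ 2 = (K.-1)%:R ^+ 2 :> R.
  by rewrite /freq ui; case: ifP; rewrite ?sqrrN.
by rewrite -subn1 natrB.
Qed.

(** The derivative splits into [f1], in the span, and [f2], which is beta / 2 sin q times the top
    modes; the projection can lose at most the norm of [f2]. *)
Lemma norm2_dcomb_le : norm2 nu (comb db u) <= nrm r + beta / 2 * nrm top_modes.
Proof.
pose low : 'cV[R]_n := u - top_modes.
have lowE : u = low + top_modes by rewrite /low subrK.
pose f1 : R -> R := \sum_i ((u i 0 * freq i) *: b (conj_ord i)) +
  (beta / 2) *: (\sum_i low i 0 *: (fun q => sin q * b i q)).
pose f2 : R -> R := (beta / 2) *: (fun q => sin q * comb b top_modes q).
have ct := @continuous_comb_gbasis R beta K top_modes.
have f2L : f2 \in Lfun nu 2%:E by apply: Lfun2Z; exact: sinM_Lfun2.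
have E : comb db u = f1 + f2.
  rewrite /f1 /f2 -addrA -scalerDr -!sinM_comb.
  have -> : (fun q => sin q * comb b low q) + (fun q => sin q * comb b top_modes q) =
      (fun q => sin q * comb b u q).
    by apply/funext => q; rewrite fctE -mulrDr lowE combD.
  rewrite sinM_comb scaler_sumr -big_split; apply: eq_bigr => i _.
  apply/funext => q; rewrite !fctE /dbasis /dG /gbasis /GRing.scale /= fctE; ring.
have f1W : lin_span b f1.
  apply: lin_spanD; first by apply: lin_span_sum => i; apply: lin_spanZ; exact: lin_span_gen.
  apply: lin_spanZ; apply: lin_span_sum => i; rewrite !mxE.
  have [ni|ni] := ltnP i.+2 n; last by rewrite subrr scale0r; exact: lin_span0.
  by apply: lin_spanZ; exact: span_sinM.
have dL : comb db u \in Lfun nu 2%:E by apply: comb_Lfun2 => i; exact: dbasis_Lfun2.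
have cL : comb b r \in Lfun nu 2%:E by apply: comb_Lfun2; exact: bL.
rewrite -[comb db u](subrK (comb b r)) addrC.
apply: (le_trans (norm2_triangle cL (Lfun2B dL cL))).
rewrite (norm2_comb bL bo) lerD2l.
have := norm2_residual_le bL bo f1W f2L; rewrite -E => /le_trans; apply.
rewrite norm2Z ?sinM_Lfun2// ger0_norm ?divr_ge0 ?(ltW beta_gt0)//.
rewrite ler_wpM2l ?divr_ge0 ?(ltW beta_gt0)//.
by apply: (le_trans (norm2_sinM beta ct)); rewrite (norm2_comb bL bo).
Qed.

End truncation.

(** The continuous Poincare inequality controls u by the full derivative, and this by its projection
    and the top modes. The top modes are bounded by the projection and by |u|, with a factor 1 / (K
    - 1) that lets |u| be absorbed for K large. *)
Lemma galerkin_poincare : exists2 c, 0 <= c & exists K0, forall K, (K0 <= K)%N ->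
  forall u, dot (one_coords beta K) u = 0 -> nrm u <= c * nrm (Dmx beta K *m u).
Proof.
have [Cp Cp0 HCp] := poincare beta.
have sb0 : 0 < sb by rewrite sqrtr_gt0.
exists (2 * Cp * (1 + beta / 2) * sb); first by rewrite !mulr_ge0 ?addr_ge0 ?divr_ge0 ?ltW.
(* With K - 1 >= M = Cp beta^2 + 1, the returning term Cp (beta / 2)^2 |u| / M is at most |u| / 4;
   the factor 2 of the constant leaves room to absorb it. *)
exists (Num.truncn (Cp * beta ^+ 2 + 1)).+2 => K KK u wu.
have K1 : Cp * beta ^+ 2 + 1 <= K%:R - 1.
  rewrite lerBrDr; have := truncnS_gt (Cp * beta ^+ 2 + 1).
  move=> /ltW h; apply: (le_trans (lerD h (lexx 1))).
  by rewrite natr1 ler_nat.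
rewrite Dmx_mul; set r := coords _ _ _.
have -> : 2 * Cp * (1 + beta / 2) * sb * nrm (sb^-1 *: r) = 2 * Cp * (1 + beta / 2) * nrm r.
  by rewrite nrmZ ger0_norm ?invr_ge0 ?ltW// -!mulrA mulVKf// gt_eqF.
have bL := @gbasis_Lfun2 R beta K; have bo := @gbasis_orth R beta K.
have mean0 : \int[nu]_q comb (@gbasis R beta K) u q = 0.
  rewrite -wu dotC -(inner_combl bL u (@one_Lfun2 R beta)).
  by apply: eq_Rintegral => q _; rewrite mulr1.
have cd : continuous (comb (@dbasis R beta K) u).
  rewrite (_ : comb _ _ = fun q => \sum_i u i 0 * dbasis beta i q); last first.
    by apply/funext => q; rewrite combE.
  apply: continuous_sum => i; apply: continuous_mul; first exact: continuous_cst.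
  exact: continuous_dG.
have := HCp _ _ (der_comb beta u) cd mean0; rewrite norm2_comb// => h1.
have := norm2_dcomb_le u; rewrite -/r; set tp := nrm (top_modes u) => h2.
have := top_modes_le u; rewrite -/r -/tp => h3.
have tp0 : 0 <= tp by exact: nrm_ge0.
have r0 : 0 <= nrm r by exact: nrm_ge0.
have u0 : 0 <= nrm u by exact: nrm_ge0.
have b0 := beta_gt0.
have h4 : Cp * beta ^+ 2 * tp + tp <= nrm r + beta / 2 * nrm u.
  apply: le_trans h3; have -> : Cp * beta ^+ 2 * tp + tp = (Cp * beta ^+ 2 + 1) * tp by ring.
  exact: (ler_wpM2r tp0 K1).
have h5 : nrm u <= Cp * nrm r + Cp * (beta / 2) * tp.
  by rewrite (le_trans h1)// -mulrA -mulrDr ler_pM2l.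
pose M := Cp * beta ^+ 2 + 1.
have M1 : 1 <= M by rewrite lerDr mulr_ge0 ?sqr_ge0 ?ltW.
have h6 : M * nrm u <= M * (Cp * nrm r) + Cp * (beta / 2) * (nrm r + beta / 2 * nrm u).
  have h7 : 0 <= Cp * (beta / 2) by rewrite mulr_ge0 ?divr_ge0 ?ltW.
  have := ler_wpM2l h7 h4; have := ler_wpM2l (le_trans ler01 M1) h5.
  rewrite /M; lra.
have h8 : Cp * (beta / 2) * nrm r <= M * (Cp * (beta / 2) * nrm r).
  by rewrite ler_peMl// mulr_ge0// mulr_ge0 ?divr_ge0 ?ltW.
have h9 : Cp * beta ^+ 2 * nrm u <= M * nrm u by rewrite ler_wpM2r// lerDl.
have h10 : 0 <= Cp * (1 + beta / 2) * nrm r.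
  by rewrite mulr_ge0// mulr_ge0 ?(ltW Cp0)// addr_ge0// divr_ge0// ltW.
rewrite -(ler_pM2l (lt_le_trans ltr01 M1)).
have h11 := mulr_ge0 (le_trans ler01 M1) h10.
lra.
Qed.

End galerkin_poincare.

(** * Hermite functions *)

Section hermite.
Context {R : realType}.
Implicit Types (l k : nat) (p y : R).

(** The recurrence comes from differentiating a polynomial times e^(-y^2/2). It replaces the
    iterated derivatives of [hermite] by algebra. *)
Fixpoint hermite_poly l : {poly R} :=
  if l is l'.+1 then 'X * hermite_poly l' - (hermite_poly l')^`() else 1.

Lemma hermite_poly_deriv l : (hermite_poly l)^`() = hermite_poly l.-1 *+ l.
Proof.
elim: l => [|l IH]; first by rewrite mulr0n -[hermite_poly 0]/(1%:P) derivC.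
rewrite /= derivB derivM derivX mul1r IH derivMn.
case: l IH => [|l] IH; first by rewrite !mulr0n mulr0 addr0 subr0 mulr1n.
rewrite [in LHS]mulrnAr -addrA -mulrnBl -/(hermite_poly l.+1).
by rewrite -[X in _ + X *+ _]/(hermite_poly l.+1) -mulrS.
Qed.

Lemma der_horner (P : {poly R}) y : is_derive y 1 (horner P) (P^`()).[y].
Proof. exact: is_derive_poly. Qed.

Lemma hermiteE l y : hermite l y = (hermite_poly l).[y].
Proof.
suff H z : derive1n l (fun z : R => expR (- (z ^+ 2 / 2))) z =
    (-1) ^+ l * (hermite_poly l).[z] * expR (- (z ^+ 2 / 2)).
  rewrite /hermite H.
  transitivity ((-1) ^+ l * (-1) ^+ l * (hermite_poly l).[y] *
      (expR (y ^+ 2 / 2) * expR (- (y ^+ 2 / 2)))); first by ring.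
  by rewrite -expRD subrr expR0 mulr1 -[X in X * _]expr2 sqrr_sign mul1r.
elim: l z => [|l IH] z; first by rewrite derive1n0 expr0 hornerC !mul1r.
rewrite derive1nS (_ : derive1n l _ = fun z => (-1) ^+ l * (hermite_poly l).[z] * expR (- (z ^+ 2 / 2))); last first.
  exact/funext.
have h : is_derive z 1 (fun z : R => - (z ^+ 2 / 2)) (- z).
  rewrite (_ : (fun z => _) = fun z : R => - 2^-1 * (z * z)); last first.
    by apply/funext => x; field.
  apply: is_derive_val (der_scale _ (der_mul (der_id z) (der_id z))) _.
  by field.
apply: derive1_val; apply: is_derive_val (der_mul (der_scale _ (der_horner _ z)) (der_exp h)) _.
rewrite /= hornerD hornerN hornerM hornerX (exprS (-1) l); move: (expR _) => E. ring.
Qed.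

Section scaled.
Variable beta : R.
Hypothesis beta_gt0 : 0 < beta.
Local Notation sb := (Num.sqrt beta).
Local Notation H := (H_l beta).

Let sb_gt0 : 0 < sb. Proof. by rewrite sqrtr_gt0. Qed.
Let sb2 : sb * sb = beta. Proof. by rewrite -expr2 sqr_sqrtr ?ltW. Qed.

Lemma H_lE l p : H l p = (Num.sqrt l`!%:R)^-1 * (hermite_poly l).[sb * p].
Proof. by rewrite /H_l hermiteE. Qed.

Let sf_gt0 l : 0 < Num.sqrt (l`!%:R : R).
Proof. by rewrite sqrtr_gt0 ltr0n fact_gt0. Qed.

Let sfS l : Num.sqrt (l.+1`!%:R : R) = Num.sqrt l.+1%:R * Num.sqrt l`!%:R.
Proof. by rewrite factS natrM sqrtrM. Qed.

Let ss l : Num.sqrt (l%:R : R) * Num.sqrt l%:R = l%:R.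
Proof. by rewrite -expr2 sqr_sqrtr. Qed.

Let mulrn_sqrt (x : R) l : x *+ l = x * (Num.sqrt l%:R * Num.sqrt l%:R).
Proof. by rewrite ss mulr_natr. Qed.

(** Differentiation lowers the index. At [l = 0] the index [l.-1] is again 0, but its coefficient is
    [Num.sqrt 0]. *)
Lemma der_H l p : is_derive p 1 (H l) (sb * (Num.sqrt l%:R * H l.-1 p)).
Proof.
rewrite (_ : H l = fun p => (Num.sqrt l`!%:R)^-1 * (hermite_poly l).[sb * p]); last first.
  by apply/funext => x; rewrite H_lE.
have ds : is_derive p 1 (fun p => sb * p) sb.
  by apply: is_derive_val (der_scale _ (der_id p)) _; rewrite mulr1.
apply: is_derive_val (der_scale _ (der_comp (der_horner _ _) ds)) _.
rewrite hermite_poly_deriv hornerMn H_lE; case: l => [|l]; first by rewrite mulr0n sqrtr0; ring.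
rewrite sfS /= (mulrn_sqrt (_.[_])).
have := sf_gt0 l; have : 0 < Num.sqrt (l.+1%:R : R) by rewrite sqrtr_gt0.
move: (Num.sqrt l.+1%:R) (Num.sqrt l`!%:R) => a b a0 b0.
by field; rewrite !gt_eqF.
Qed.

Lemma mulp_H l p : p * H l p =
  sb^-1 * (Num.sqrt l.+1%:R * H l.+1 p + Num.sqrt l%:R * H l.-1 p).
Proof.
have E k : (hermite_poly k.+1).[sb * p] = sb * p * (hermite_poly k).[sb * p] -
    (hermite_poly k.-1).[sb * p] * (Num.sqrt k%:R * Num.sqrt k%:R).
  rewrite /= hornerD hornerN hornerM hornerX hermite_poly_deriv hornerMn.
  by rewrite (mulrn_sqrt (_.[_])).
rewrite !H_lE E sfS; move: (_.[_]) => x.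
have c0 := sf_gt0 l; have a0 : 0 < Num.sqrt (l.+1%:R : R) by rewrite sqrtr_gt0.
case: l c0 a0 => [|l] c0 a0.
  rewrite sqrtr0 !mul0r mulr0 subr0 addr0.
  move: c0 a0; move: (Num.sqrt (1%:R : R)) (Num.sqrt (0`!%:R : R)) => a c c0 a0.
  by field; rewrite !gt_eqF.
rewrite [l.+1.-1]/= sfS; have := sf_gt0 l.
have : 0 < Num.sqrt (l.+1%:R : R) by rewrite sqrtr_gt0.
move: a0; move: (Num.sqrt l.+2%:R) (Num.sqrt l.+1%:R) (Num.sqrt l`!%:R) (_.[_]) => a b c z a0 b1 c0'.
by field; rewrite !gt_eqF.
Qed.

Lemma slow_horner (P : {poly R}) (a : R) : slow (fun p => P.[a * p]).
Proof.
elim/poly_ind: P => [|P c IH].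
  by under eq_fun do rewrite horner0; exact: slow_cst.
under eq_fun do rewrite hornerMXaddC.
apply: slow_add; last exact: slow_cst.
by apply: slow_mul => //; apply: slow_mul; [exact: slow_cst|exact: slow_id].
Qed.

Lemma slow_H l : slow (H l).
Proof.
rewrite (_ : H l = fun p => (Num.sqrt l`!%:R)^-1 * (hermite_poly l).[sb * p]); last first.
  by apply/funext => x; rewrite H_lE.
by apply: slow_mul; [exact: slow_cst|exact: slow_horner].
Qed.

(** Gaussian integration by parts makes raising the adjoint of lowering: sqrt (l+1) <H_(l+1), H_m> =
    sqrt m <H_l, H_(m-1)>. Induction then brings the index down to H_0 = 1. *)
Lemma H_orth j k : inner (kappa beta) (H j) (H k) = (j == k)%:R.
Proof.
have I a b : (kappa beta).-integrable setT (EFin \o (fun p => H a p * H b p)).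
  by apply: kappa_integrable => //; apply: slow_mul; exact: slow_H.
have lin s t a b c d : \int[kappa beta]_p (s * (H a p * H b p) + t * (H c p * H d p)) =
    s * inner (kappa beta) (H a) (H b) + t * inner (kappa beta) (H c) (H d).
  have sM r e f : slow (fun p => r * (H e p * H f p)).
    by apply: slow_mul; [exact: slow_cst|apply: slow_mul; exact: slow_H].
  rewrite RintegralD//; [|exact: kappa_integrable..].
  by rewrite !RintegralZl.
have rec l m : Num.sqrt l.+1%:R * inner (kappa beta) (H l.+1) (H m) =
    Num.sqrt m%:R * inner (kappa beta) (H l) (H m.-1).
  pose f' p := sb * Num.sqrt l%:R * (H l.-1 p * H m p) + sb * Num.sqrt m%:R * (H l p * H m.-1 p).
  have df p : is_derive p 1 (fun p => H l p * H m p) (f' p).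
    by apply: is_derive_val (der_mul (der_H l p) (der_H m p)) _; rewrite /f'; ring.
  have s1 : slow (fun p => H l p * H m p) by apply: slow_mul; exact: slow_H.
  have s2 : slow f'.
    by apply: slow_add; apply: slow_mul; first [exact: slow_cst|apply: slow_mul; exact: slow_H].
  have := kappa_by_parts beta_gt0 df s1 s2; rewrite lin.
  have -> : \int[kappa beta]_p (p * (H l p * H m p)) = \int[kappa beta]_p
      (sb^-1 * Num.sqrt l.+1%:R * (H l.+1 p * H m p) + sb^-1 * Num.sqrt l%:R * (H l.-1 p * H m p)).
    by apply: eq_Rintegral => p _; rewrite mulrA mulp_H; ring.
  have sb0 : sb != 0 by rewrite gt_eqF.
  rewrite lin => h0.
  have : sb * Num.sqrt l%:R * inner (kappa beta) (H l.-1) (H m) +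
      sb * Num.sqrt m%:R * inner (kappa beta) (H l) (H m.-1) =
      sb * sb * (sb^-1 * Num.sqrt l.+1%:R * inner (kappa beta) (H l.+1) (H m) +
        sb^-1 * Num.sqrt l%:R * inner (kappa beta) (H l.-1) (H m)).
    by rewrite sb2; exact: h0.
  move: (inner (kappa beta) (H l.-1) (H m)) (inner (kappa beta) (H l) (H m.-1))
    (inner (kappa beta) (H l.+1) (H m)) => X Y Z' h.
  apply: (mulfI sb0).
  have -> : sb * (Num.sqrt l.+1%:R * Z') = sb * sb * (sb^-1 * Num.sqrt l.+1%:R * Z' +
      sb^-1 * Num.sqrt l%:R * X) - sb * Num.sqrt l%:R * X by field.
  by rewrite -h; ring.
have H0 m : inner (kappa beta) (H 0) (H m) = (0 == m)%:R.
  case: m => [|m].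
    transitivity (\int[kappa beta]_p 1).
      by apply: eq_Rintegral => p _; rewrite H_lE /= hornerC fact0 sqrtr1 invr1 !mulr1.
    by rewrite Rintegral_cst//= probability_setT mulr1.
  have := rec m 0; rewrite sqrtr0 mul0r => /eqP; rewrite mulf_eq0 sqrtr_eq0 => /orP[|/eqP].
    by rewrite leNgt ltr0n.
  by rewrite innerC.
elim: j k => [|j IH] k; first exact: H0.
have a0 : Num.sqrt j.+1%:R != 0 :> R by rewrite gt_eqF// sqrtr_gt0.
case: k => [|k]; first by rewrite innerC H0.
apply: (mulfI a0); rewrite rec IH eqSS; have [->//|_] := eqVneq j k.
by rewrite !mulr0.
Qed.

End scaled.
End hermite.

(** * The generator on tensor products *)

Section tensor.
Context {R : realType}.
Variable beta : R.
Hypothesis beta_gt0 : 0 < beta.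
Local Notation mu := (mu beta).
Local Notation nu := (nu beta).
Local Notation kappa := (kappa beta).
Implicit Types (a c b e : R -> R).

Lemma measurable_tensor a b : measurable_fun setT a -> measurable_fun setT b ->
  measurable_fun setT (tensor a b).
Proof.
move=> ma mb; apply: measurable_funM.
  exact: (measurableT_comp ma measurable_fst).
exact: (measurableT_comp mb measurable_snd).
Qed.

Lemma Lfun2_tensor a b : continuous a -> slow b -> tensor a b \in Lfun mu 2%:E.
Proof.
move=> ca sb; have [cb _] := sb; apply: Lfun2P.
  by apply: measurable_tensor; exact: continuous_measurable_fun.
have h : mu.-integrable setT (EFin \o tensor (fun q => a q * a q) (fun p => b p * b p)).
  apply: mu_integrable_tensor => //.
    by apply: nu_integrable; exact: continuous_mul.
  by apply: kappa_integrable => //; exact: slow_mul.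
apply: eq_integrable h => // x _ /=.
by rewrite /tensor expr2 mulrACA.
Qed.

Lemma inner_tensor a b c e : continuous a -> slow b -> continuous c -> slow e ->
  inner mu (tensor a b) (tensor c e) = inner nu a c * inner kappa b e.
Proof.
move=> ca sb cc se; rewrite /inner -mu_Rintegral_tensor//.
- by apply: eq_Rintegral => x _; rewrite /tensor mulrACA.
- by apply: nu_integrable; exact: continuous_mul.
- by apply: kappa_integrable => //; exact: slow_mul.
Qed.

Lemma mu_Rintegral_cont_slow a b : continuous a -> slow b ->
  \int[mu]_x tensor a b x = (\int[nu]_q a q) * (\int[kappa]_p b p).
Proof.
move=> ca sb; apply: mu_Rintegral_tensor => //; first exact: nu_integrable.
exact: kappa_integrable.
Qed.

Section generator.
Variables (gamma : R) (n : nat) (c : 'I_n -> R).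
Variables (a a' b b' b'' : 'I_n -> R -> R).
Hypothesis da : forall i (q : R), is_derive q 1 (a i) (a' i q).
Hypothesis db : forall i (p : R), is_derive p 1 (b i) (b' i p).
Hypothesis db' : forall i (p : R), is_derive p 1 (b' i) (b'' i p).

Definition gen_tensor i : R * R -> R :=
  tensor (a' i) (fun p => p * b i p) - tensor (fun q => sin q * a i q) (b' i)
  + gamma *: tensor (a i) (fun p => - (p * b' i p) + beta^-1 * b'' i p).

Lemma dq_tensor (u u' v : 'I_n -> R -> R) : (forall i (q : R), is_derive q 1 (u i) (u' i q)) ->
  dq (\sum_i c i *: tensor (u i) (v i)) = \sum_i c i *: tensor (u' i) (v i).
Proof.
move=> du; apply/funext => x; rewrite /dq.
rewrite (_ : (fun q => _) = fun q => \sum_i c i * v i x.2 * u i q); last first.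
  apply/funext => q; rewrite fct_sumE; apply: eq_bigr => i _.
  by rewrite fctE /tensor /GRing.scale /=; ring.
rewrite (derive1_val (der_sum (fun i => der_scale (c i * v i x.2) (du i x.1)))).
rewrite fct_sumE; apply: eq_bigr => i _.
by rewrite fctE /tensor /GRing.scale /=; ring.
Qed.

Lemma dp_tensor (u v v' : 'I_n -> R -> R) : (forall i (p : R), is_derive p 1 (v i) (v' i p)) ->
  dp (\sum_i c i *: tensor (u i) (v i)) = \sum_i c i *: tensor (u i) (v' i).
Proof.
move=> dv; apply/funext => x; rewrite /dp.
rewrite (_ : (fun p => _) = fun p => \sum_i c i * u i x.1 * v i p); last first.
  apply/funext => p; rewrite fct_sumE; apply: eq_bigr => i _.
  by rewrite fctE /tensor /GRing.scale /=; ring.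
rewrite (derive1_val (der_sum (fun i => der_scale (c i * u i x.1) (dv i x.2)))).
rewrite fct_sumE; apply: eq_bigr => i _.
by rewrite fctE /tensor /GRing.scale /=; ring.
Qed.

Lemma gen_tensorE :
  gen beta gamma (\sum_i c i *: tensor (a i) (b i)) = \sum_i c i *: gen_tensor i.
Proof.
rewrite /gen /L_ham /L_FD (dq_tensor _ da) (dp_tensor _ db) (dp_tensor _ db').
have scaleE (r : R) (h : R * R -> R) x : (r *: h) x = r * h x by [].
apply/funext => x; rewrite fctE /= scaleE !fct_sumE derive1_V.
rewrite !mulr_sumr -sumrB -!big_split /= mulr_sumr -big_split /=.
apply: eq_bigr => i _; rewrite /gen_tensor !scaleE /tensor /=.
rewrite (_ : (_ + _ + _) x = a' i x.1 * (x.2 * b i x.2) - sin x.1 * a i x.1 * b' i x.2 +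
  gamma * (a i x.1 * (- (x.2 * b' i x.2) + beta^-1 * b'' i x.2)))//.
ring.
Qed.

End generator.
End tensor.

(** * The generator in the Galerkin basis *)

Section galerkin_generator.
Context {R : realType}.
Variable beta : R.
Hypothesis beta_gt0 : 0 < beta.
Variables (gamma : R) (K L : nat).
Local Notation mu := (mu beta).
Local Notation nu := (nu beta).
Local Notation kappa := (kappa beta).
Local Notation n := ((2 * K).-1).
Local Notation sb := (Num.sqrt beta).
Local Notation H := (H_l beta).
Local Notation e := (@e_enum R beta K L).
Implicit Types (i j : 'I_(n * L)) (k : 'I_n) (l : 'I_L).

Let sb_gt0 : 0 < sb. Proof. by rewrite sqrtr_gt0. Qed.
Let sb2 : sb * sb = beta. Proof. by rewrite -expr2 sqr_sqrtr ?ltW. Qed.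

Lemma L_gt0 i : (0 < L)%N.
Proof. by case: L i => // -[i]; rewrite muln0. Qed.

Lemma pos_idx_subproof i : (i %/ L < n)%N.
Proof. by rewrite ltn_divLR ?(L_gt0 i). Qed.

Lemma mom_idx_subproof i : (i %% L < L)%N.
Proof. by rewrite ltn_mod (L_gt0 i). Qed.

Lemma pair_idx_subproof k l : (k * L + l < n * L)%N.
Proof.
have := ltn_ord k; have := ltn_ord l; move: (k : nat) (l : nat) => a c cL aK.
apply: (@leq_trans (a.+1 * L)); last by rewrite leq_mul2r aK orbT.
by rewrite mulSn addnC ltn_add2r.
Qed.

Definition pos_idx i : 'I_n := Ordinal (pos_idx_subproof i).
Definition mom_idx i : 'I_L := Ordinal (mom_idx_subproof i).
Definition pair_idx k l : 'I_(n * L) := Ordinal (pair_idx_subproof k l).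

Lemma pos_pair_idx k l : pos_idx (pair_idx k l) = k.
Proof.
apply: val_inj; rewrite /= divnMDl ?divn_small ?addn0//.
exact: leq_ltn_trans (ltn_ord l).
Qed.

Lemma mom_pair_idx k l : mom_idx (pair_idx k l) = l.
Proof. by apply: val_inj; rewrite /= modnMDl modn_small. Qed.

Lemma pair_idxK i : pair_idx (pos_idx i) (mom_idx i) = i.
Proof. by apply: val_inj; rewrite /= -divn_eq. Qed.

Lemma sum_pair_idx (F : 'I_(n * L) -> R) :
  \sum_i F i = \sum_k \sum_l F (pair_idx k l).
Proof.
rewrite pair_bigA /= (reindex (fun kl : 'I_n * 'I_L => pair_idx kl.1 kl.2))//=.
exists (fun i => (pos_idx i, mom_idx i)) => [[k l]|i] _ /=.
  by rewrite pos_pair_idx mom_pair_idx.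
exact: pair_idxK.
Qed.

Lemma e_tensor i : e i = tensor (gbasis beta (pos_idx i)) (H (mom_idx i)).
Proof. by []. Qed.

Lemma e_Lfun2 i : e i \in Lfun mu 2%:E.
Proof. by apply: Lfun2_tensor => //; [exact: continuous_G|exact: slow_H]. Qed.

Lemma eq_pair_idx i j : (i == j) = (pos_idx i == pos_idx j) && (mom_idx i == mom_idx j).
Proof.
apply/eqP/andP => [->|[/eqP h1 /eqP h2]]; first by rewrite !eqxx.
by rewrite -(pair_idxK i) h1 h2 pair_idxK.
Qed.

Lemma e_orth i j : inner mu (e i) (e j) = (i == j)%:R.
Proof.
rewrite inner_tensor//; [|exact: continuous_G|exact: slow_H|exact: continuous_G|exact: slow_H].
by rewrite G_orth H_orth// eq_pair_idx -natrM mulnb.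
Qed.

Let a i := G_k beta (pos_idx i).
Let a' i := dG beta (pos_idx i).
Let b i := H (mom_idx i).
Let b' i p := sb * (Num.sqrt (mom_idx i)%:R * H (mom_idx i).-1 p).
Let b'' i p := sb * (Num.sqrt (mom_idx i)%:R *
  (sb * (Num.sqrt (mom_idx i).-1%:R * H (mom_idx i).-2 p))).

Definition gen_e i : R * R -> R := gen_tensor beta gamma a a' b b' b'' i.

Lemma gen_comb (x : 'cV[R]_(n * L)) :
  gen beta gamma (comb e x) = comb gen_e x.
Proof.
have d1 i (q : R) : is_derive q 1 (a i) (a' i q) by exact: der_G.
have d2 i (p : R) : is_derive p 1 (b i) (b' i p) by exact: der_H.
have d3 i (p : R) : is_derive p 1 (b' i) (b'' i p).
  by apply: der_scale; apply: der_scale; exact: der_H.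
exact: (gen_tensorE beta gamma (fun i => x i 0) d1 d2 d3).
Qed.

(** Hermite functions are eigenfunctions of [L_FD]: the second derivative cancels the lowering part
    of p H_(l-1). *)
Lemma hermite_FD (l : nat) p :
  - (p * (sb * (Num.sqrt l%:R * H l.-1 p))) + beta^-1 *
    (sb * (Num.sqrt l%:R * (sb * (Num.sqrt l.-1%:R * H l.-2 p)))) = - l%:R * H l p.
Proof.
case: l => [|l] /=; first by rewrite sqrtr0; ring.
have s0 : sb != 0 by rewrite gt_eqF.
have -> : - (p * (sb * (Num.sqrt l.+1%:R * H l p))) = - (sb * Num.sqrt l.+1%:R * (p * H l p)) by ring.
rewrite (mulp_H beta_gt0); have -> : beta^-1 = sb^-1 * sb^-1 by rewrite -invfM sb2.
have lE : l.+1%:R = Num.sqrt l.+1%:R * Num.sqrt l.+1%:R :> R.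
  by rewrite -expr2 sqr_sqrtr.
rewrite [in RHS]lE; move: (Num.sqrt l.+1%:R) (H l.+1 p) (H l.-1 p) => r h h'.
by field.
Qed.

Lemma gen_eE i : gen_e i = tensor (a' i) (fun p => p * b i p)
  - tensor (fun q => sin q * a i q) (b' i) - (gamma * (mom_idx i)%:R) *: e i.
Proof.
rewrite /gen_e /gen_tensor; congr (_ + _); rewrite -scaleNr.
apply/funext => x; have scaleE (r : R) (h : R * R -> R) : (r *: h) x = r * h x by [].
rewrite !scaleE /tensor hermite_FD /e_enum /e_kl /a /=; ring.
Qed.

Let slow_pb i : slow (fun p => p * b i p).
Proof. by apply: slow_mul; [exact: slow_id|exact: slow_H]. Qed.

Let slow_b' i : slow (b' i).
Proof.
by apply: slow_mul; [exact: slow_cst|apply: slow_mul; [exact: slow_cst|exact: slow_H]].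
Qed.

Lemma gen_e_Lfun2 i : gen_e i \in Lfun mu 2%:E.
Proof.
rewrite gen_eE; apply: Lfun2B; last by apply: Lfun2Z; exact: e_Lfun2.
apply: Lfun2B; apply: Lfun2_tensor => //; first exact: continuous_dG.
by apply: continuous_sinM; exact: continuous_G.
Qed.

(** Raising by one comes from p d/dq alone and carries [D]. Lowering receives [D] from p d/dq and -
    (D + D^T) from the force term, in total - D^T. *)
Lemma inner_e_gen j i : inner mu (gen_e i) (e j) =
  (Dmx beta K (pos_idx j) (pos_idx i) * Num.sqrt (mom_idx i).+1%:R * (mom_idx j == (mom_idx i).+1 :> nat)%:R
  - Dmx beta K (pos_idx i) (pos_idx j) * Num.sqrt (mom_idx i)%:R * ((mom_idx j).+1 == mom_idx i :> nat)%:R)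
  - gamma * (mom_idx i)%:R * (i == j)%:R.
Proof.
have e1 : tensor (a' i) (fun p => p * b i p) \in Lfun mu 2%:E.
  by apply: Lfun2_tensor => //; exact: continuous_dG.
have e2 : tensor (fun q => sin q * a i q) (b' i) \in Lfun mu 2%:E.
  by apply: Lfun2_tensor => //; apply: continuous_sinM; exact: continuous_G.
have ej := e_Lfun2 j; have ei := e_Lfun2 i.
rewrite gen_eE innerBl ?innerZl ?Lfun2B ?Lfun2Z// innerBl// e_orth.
congr (_ - _); rewrite e_tensor.
have c1 : continuous (a' i) by exact: continuous_dG.
have c2 : continuous (fun q => sin q * a i q) by apply: continuous_sinM; exact: continuous_G.
have c3 : continuous (gbasis beta (pos_idx j)) by exact: continuous_G.
have s3 : slow (H (mom_idx j)) by exact: slow_H.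
rewrite (inner_tensor beta_gt0 c1 (slow_pb i) c3 s3).
rewrite (inner_tensor beta_gt0 c2 (slow_b' i) c3 s3).
set l := mom_idx i; set l' := mom_idx j.
have sH (r : R) m : r *: H m \in Lfun kappa 2%:E.
  by apply: Lfun2Z; apply: Lfun2_kappa => //; exact: slow_H.
have H2 m : H m \in Lfun kappa 2%:E by apply: Lfun2_kappa => //; exact: slow_H.
have lE : Num.sqrt (l%:R : R) * (l.-1 == l' :> nat)%:R = Num.sqrt l%:R * (l'.+1 == l :> nat)%:R.
  by case: (l : nat) => [|m]; rewrite ?sqrtr0 ?mul0r// eqSS eq_sym.
have k1 : inner kappa (fun p => p * b i p) (H l') =
    sb^-1 * (Num.sqrt l.+1%:R * (l' == l.+1 :> nat)%:R + Num.sqrt l%:R * (l'.+1 == l :> nat)%:R).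
  rewrite -lE (_ : (fun p => _) = sb^-1 *: (Num.sqrt l.+1%:R *: H l.+1 + Num.sqrt l%:R *: H l.-1)); last first.
    by apply/funext => p; rewrite /b (mulp_H beta_gt0).
  rewrite innerZl; [|exact: Lfun2D|exact: H2]; rewrite innerDl//.
  by rewrite [X in X + _]innerZl// [X in _ + X]innerZl// !(H_orth beta_gt0) (eq_sym l.+1).
have k2 : inner kappa (b' i) (H l') = sb * (Num.sqrt l%:R * (l'.+1 == l :> nat)%:R).
  rewrite -lE (_ : b' i = sb *: (Num.sqrt l%:R *: H l.-1))//.
  by rewrite innerZl// innerZl// (H_orth beta_gt0).
rewrite k1 k2.
have sb0 : sb != 0 by rewrite gt_eqF.
have D1 : inner nu (a' i) (gbasis beta (pos_idx j)) = sb * Dmx beta K (pos_idx j) (pos_idx i).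
  by rewrite mxE mulVKf// innerC.
have D2 : inner nu (fun q => sin q * a i q) (gbasis beta (pos_idx j)) =
    sb^-1 * (Dmx beta K (pos_idx j) (pos_idx i) + Dmx beta K (pos_idx i) (pos_idx j)).
  by rewrite (Dmx_sym beta_gt0) mulKf.
rewrite D1 D2; move: (Dmx _ _ _ _) (Dmx _ _ _ _) => d1 d2.
move: ((l' == l.+1 :> nat)%:R : R) ((l'.+1 == l :> nat)%:R : R) => x y.
by move: (Num.sqrt (l.+1%:R : R)) (Num.sqrt (l%:R : R)) => z t; field.
Qed.

(* the momentum modes of x, extended by 0 beyond the truncation *)
Definition mode (x : 'cV[R]_(n * L)) (m : nat) : 'cV[R]_n :=
  \col_k (if insub m is Some l then x (pair_idx k l) 0 else 0).

Lemma mode_ge x m : (L <= m)%N -> mode x m = 0.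
Proof. by move=> Lm; apply/colP => k; rewrite !mxE insubN// -leqNgt. Qed.

Lemma modeE x k l : mode x l k 0 = x (pair_idx k l) 0.
Proof. by rewrite mxE valK. Qed.

Lemma mode_dot x y : dot x y = \sum_(m < L) dot (mode x m) (mode y m).
Proof.
rewrite /dot sum_pair_idx exchange_big; apply: eq_bigr => l _.
by apply: eq_bigr => k _; rewrite !modeE.
Qed.

Lemma mode_coords_gen x (m : nat) : (m < L)%N ->
  mode (coords mu e (gen beta gamma (comb e x))) m =
  Num.sqrt m%:R *: (Dmx beta K *m mode x m.-1)
  - Num.sqrt m.+1%:R *: ((Dmx beta K)^T *m mode x m.+1) - (gamma * m%:R) *: mode x m.
Proof.
move=> mL; apply/colP => k; pose l := Ordinal mL; rewrite -[m]/(val l) modeE.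
set j := pair_idx k l; rewrite mxE gen_comb inner_lin_combl; [|exact: gen_e_Lfun2|exact: e_Lfun2].
under eq_bigr do rewrite inner_e_gen !mulrBr.
set D := Dmx beta K.
have -> : (Num.sqrt m%:R *: (D *m mode x m.-1) - Num.sqrt m.+1%:R *: (D^T *m mode x m.+1)
    - (gamma * m%:R) *: mode x m) k 0 =
    Num.sqrt m%:R * (\sum_k' D k k' * mode x m.-1 k' 0)
    - Num.sqrt m.+1%:R * (\sum_k' D k' k * mode x m.+1 k' 0) - gamma * m%:R * mode x m k 0.
  have subE (A1 A2 : 'cV[R]_n) : (A1 - A2) k 0 = A1 k 0 - A2 k 0 by rewrite !mxE.
  have scaleE r (A1 : 'cV[R]_n) : (r *: A1) k 0 = r * A1 k 0 by rewrite mxE.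
  have mulE (M : 'M[R]_n) (v : 'cV[R]_n) : (M *m v) k 0 = \sum_k' M k k' * v k' 0 by rewrite mxE.
  rewrite !subE !scaleE !mulE; congr (_ - _ * _ - _).
  by apply: eq_bigr => k' _; rewrite [D^T _ _]mxE.
have pj : pos_idx j = k by rewrite pos_pair_idx.
have mj : mom_idx j = m :> nat by rewrite mom_pair_idx.
have xj : x j 0 = mode x m k 0 by rewrite -[m]/(val l) modeE.
rewrite pj mj; rewrite !sumrB; clearbody j; congr (_ - _ - _).
- rewrite sum_pair_idx mulr_sumr; apply: eq_bigr => k' _.
  case: m mL {l mj xj} => [|m] mL.
    rewrite sqrtr0 mul0r big1// => l' _.
    by rewrite !mom_pair_idx !mulr0.
  pose l0 := Ordinal (ltnW mL); rewrite -[m.+1.-1]/(val l0) modeE.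
  rewrite (bigD1 l0)// big1 ?addr0 => [|l' /negbTE l'n]; last first.
    rewrite !mom_pair_idx /= eqSS (_ : (m == l') = false) ?mulr0//.
    by rewrite eq_sym -l'n.
  by rewrite !mom_pair_idx !pos_pair_idx /= eqxx mulr1 /D; ring.
- rewrite sum_pair_idx mulr_sumr; apply: eq_bigr => k' _.
  (* Truncation cuts the chain here: [mode] vanishes from L on, and no basis index matches. *)
  have [Lm|mL1] := leqP L m.+1.
    rewrite mode_ge// [X in _ * (_ * X)]mxE !mulr0 big1// => l' _.
    rewrite !mom_pair_idx /= (_ : (_ == _) = false) ?mulr0//.
    by apply/negbTE; apply: contraTneq (ltn_ord l') => <-; rewrite -leqNgt.
  pose l1 := Ordinal mL1; rewrite -[X in mode x X]/(val l1) modeE.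
  rewrite (bigD1 l1)// big1 ?addr0 => [|l' /negbTE l'n]; last first.
    rewrite !mom_pair_idx /= (_ : (_ == _) = false) ?mulr0//.
    by rewrite -l'n eq_sym.
  by rewrite !mom_pair_idx !pos_pair_idx /= eqxx mulr1 /D; ring.
- rewrite (bigD1 j)// big1 ?addr0 => [|i /negbTE ->]; last by rewrite !mulr0.
  rewrite eqxx mulr1 mj xj mulrC. exact: addr0.
Qed.

End galerkin_generator.

(** * The Galerkin system *)

Section orth_proj_unique.
Context d (T : measurableType d) (R : realType).
Variables (m : {measure set T -> \bar R}) (n : nat) (b : 'I_n -> T -> R).
Hypothesis bL : forall i, b i \in Lfun m 2%:E.
Hypothesis bo : forall i j, inner m (b i) (b j) = (i == j)%:R.

Lemma lin_span_inner0 k : lin_span b k -> inner m k k = 0 -> k = 0.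
Proof.
move=> /(lin_span_comb bL bo) kE; rewrite kE (inner_comb bL bo) => /dot_eq0 ->.
by apply/funext => x; rewrite combE big1// => i _; rewrite mxE mul0r.
Qed.

(** Two candidates differ by an element of W orthogonal to itself, which vanishes as a function
    because it lies in the span of an orthonormal family. This covers subspaces such as [V_KL0], for
    which no orthonormal basis is written down. *)
Lemma orth_proj_unique (W : set (T -> R)) f g : W `<=` lin_span b ->
  (forall h k, W h -> W k -> W (h - k)) -> f \in Lfun m 2%:E ->
  W g -> (forall w, W w -> inner m (f - g) w = 0) -> orth_proj m W f = g.
Proof.
move=> Wb WB fL Wg og; rewrite /orth_proj; set Q := [set g | _ /\ _].
have : Q (xget 0 Q) by apply: xgetPex; exists g.
move: (xget 0 Q) => h [Wh oh].
have EL k : W k -> k \in Lfun m 2%:E.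
  by move=> /Wb /(lin_span_comb bL bo) ->; exact: comb_Lfun2.
apply/eqP; rewrite -subr_eq0; apply/eqP; apply: lin_span_inner0.
  by apply: Wb; exact: WB.
have hg := WB _ _ Wh Wg.
have {1}-> : h - g = (f - g) - (f - h).
  by rewrite opprB [RHS]addrC addrA subrK.
have gL := EL _ Wg; have hL := EL _ Wh.
by rewrite innerBl ?Lfun2B// og// oh// subrr.
Qed.

End orth_proj_unique.

Section galerkin_solution.
Context {R : realType}.
Variable beta : R.
Hypothesis beta_gt0 : 0 < beta.
Local Notation mu := (mu beta).
Local Notation nu := (nu beta).
Local Notation kappa := (kappa beta).
Local Notation sb := (Num.sqrt beta).

Lemma cst1_tensor : @cst1 R = tensor (cst 1) (cst 1).
Proof. by apply/funext => x; rewrite /tensor mul1r. Qed.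

Lemma cst1_Lfun2 : @cst1 R \in Lfun mu 2%:E.
Proof.
rewrite cst1_tensor; apply: Lfun2_tensor => //; first exact: continuous_cst.
exact: slow_cst.
Qed.

Lemma H_0 : H_l beta 0 = cst 1.
Proof. by apply/funext => p; rewrite H_lE /= hornerC fact0 sqrtr1 invr1 mulr1. Qed.

Lemma norm2_tensor_cst1 (a : R -> R) : continuous a ->
  norm2 mu (tensor a (cst 1)) = norm2 nu a.
Proof.
move=> ca; rewrite /norm2 inner_tensor//; [|exact: slow_cst..].
by rewrite -H_0 H_orth// mulr1.
Qed.

(** Bessel's inequality for the function 1. It makes the last quotient of the bracket in the theorem
    nonnegative, also when its denominator is 0, since dividing by 0 gives 0. *)
Lemma Pi_q_defect_le1 K : norm2 mu (cst1 - Pi_q beta K cst1) ^+ 2 <= 1.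
Proof.
have bL := @gbasis_Lfun2 R beta K; have bo := @gbasis_orth R beta K.
have oL := @one_Lfun2 R beta.
pose a q : R := 1 - comb (@gbasis R beta K) (one_coords beta K) q.
have ca : continuous a.
  by apply: continuous_add; [exact: continuous_cst|apply: continuous_opp; exact: continuous_comb_gbasis].
have -> : cst1 - Pi_q beta K cst1 = tensor a (cst 1).
  apply/funext => x; rewrite fctE /tensor mulr1 /a combE /cst1 /Pi_q /=; congr (_ - _).
  by apply: eq_bigr => i _; rewrite mxE.
rewrite norm2_tensor_cst1// (_ : a = cst 1 - comb (@gbasis R beta K) (one_coords beta K))//.
rewrite (sqr_norm2_proj bL bo oL) sqr_norm2 (_ : inner nu (cst 1) (cst 1) = 1).
  by rewrite lerBlDr lerDl sqr_ge0.
rewrite /inner; under eq_Rintegral do rewrite mulr1.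
by rewrite Rintegral_cst//= nu_setT mulr1.
Qed.

Section fixed_size.
Variables (gamma : R) (K L : nat).
Hypotheses (K_gt0 : (0 < K)%N) (L_gt0 : (0 < L)%N).
Local Notation n := ((2 * K).-1).
Local Notation N := (n * L)%N.
Local Notation e := (@e_enum R beta K L).
Implicit Types x y : 'cV[R]_N.
Let eL : forall i, e i \in Lfun mu 2%:E := @e_Lfun2 R beta beta_gt0 K L.
Let eo : forall i j, inner mu (e i) (e j) = (i == j)%:R := @e_orth R beta beta_gt0 K L.

Definition mu_one : 'cV[R]_N := coords mu e cst1.

Lemma mode_mu_one l : mode mu_one l = if l == 0 then one_coords beta K else 0.
Proof.
have [lL|Ll] := ltnP l L; last first.
  by rewrite mode_ge//; case: eqP => // l0; move: Ll; rewrite l0 leqNgt L_gt0.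
apply/colP => k; rewrite -[l]/(val (Ordinal lL)) modeE mxE cst1_tensor e_tensor.
rewrite inner_tensor//; [|exact: continuous_cst|exact: slow_cst|exact: continuous_G|exact: slow_H].
rewrite pos_pair_idx mom_pair_idx.
have -> : inner kappa (cst 1) (H_l beta (Ordinal lL)) = (l == 0%N)%:R.
  by rewrite -H_0 H_orth//= eq_sym.
by case: eqP => _; rewrite mxE ?mulr1 ?mulr0.
Qed.

Lemma mu_one_dot x : dot mu_one x = dot (one_coords beta K) (mode x 0).
Proof.
rewrite mode_dot (bigD1 (Ordinal L_gt0))//= mode_mu_one eqxx big1 ?addr0// => l l0.
rewrite mode_mu_one; case: eqP => [l00|_]; last by rewrite dot0l.
by move: l0; rewrite (_ : l = Ordinal L_gt0) ?eqxx//; apply: val_inj.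
Qed.

Lemma nrm_mu_one : nrm mu_one = nrm (one_coords beta K).
Proof.
by rewrite /nrm mu_one_dot mode_mu_one.
Qed.

Hypothesis one_neq0 : 0 < nrm (one_coords beta K).

Let r : R := (nrm mu_one)^-1.
Let r_gt0 : 0 < r. Proof. by rewrite invr_gt0 nrm_mu_one. Qed.

Definition unit_one : 'cV[R]_N := r *: mu_one.

Lemma unit_one_dot : dot unit_one unit_one = 1.
Proof.
rewrite -sqr_nrm nrmZ ger0_norm ?(ltW r_gt0)// /r mulVf ?expr1n//.
by rewrite nrm_mu_one gt_eqF.
Qed.

Lemma u_KLE : u_KL beta K L = comb e unit_one.
Proof.
rewrite /u_KL /Pi_KL /V_KL (orth_projE eL eo cst1_Lfun2) (norm2_comb eL eo).
by rewrite combZ.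
Qed.

Lemma U_mxE : U_mx beta K L = unit_one.
Proof.
apply/colP => i; rewrite mxE u_KLE.
by have := coords_comb eL eo unit_one => /colP/(_ i); rewrite mxE.
Qed.

Lemma gen_eqE i : gen beta gamma (e i) = gen_e beta gamma i.
Proof. by rewrite -(comb_delta e i) gen_comb// comb_delta. Qed.

Lemma L_mx_mul x : L_mx beta gamma K L *m x = - coords mu e (gen beta gamma (comb e x)).
Proof.
have gL := @gen_e_Lfun2 R beta beta_gt0 gamma K L.
apply/colP => i; rewrite [LHS]mxE [RHS]mxE [coords _ _ _ _ _]mxE gen_comb//.
rewrite inner_lin_combl// -sumrN; apply: eq_bigr => j _.
by rewrite mxE gen_eqE innerNr// innerC mulNr mulrC.
Qed.

(** In coordinates, integrating against [mu] is the product with [mu_one], so the mean zero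
    condition is orthogonality to [unit_one]. *)
Lemma V_KL0P f : V_KL0 beta K L f <->
  f = comb e (coords mu e f) /\ dot unit_one (coords mu e f) = 0.
Proof.
have H x : \int[mu]_y comb e x y = dot mu_one x.
  rewrite dotC -(inner_combl eL x cst1_Lfun2).
  by apply: eq_Rintegral => y _; rewrite mulr1.
split=> [[/(lin_span_comb eL eo) fE /= f0]|[fE f0]].
  split => //; rewrite dotZl -H; apply/eqP; rewrite mulf_eq0; apply/orP; right.
  by apply/eqP; rewrite -[RHS]f0; congr (Rintegral _ _ _).
split; rewrite /= fE; first exact: comb_span.
rewrite H; apply/eqP; move/eqP: f0.
by rewrite dotZl mulf_eq0 (gt_eqF r_gt0).
Qed.

Lemma V_KL0_comb x : dot unit_one x = 0 -> V_KL0 beta K L (comb e x).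
Proof. by move=> ux; apply/V_KL0P; rewrite (coords_comb eL eo). Qed.

Definition project (c : 'cV[R]_N) : 'cV[R]_N := c - dot unit_one c *: unit_one.

Lemma dot_project c : dot unit_one (project c) = 0.
Proof. by rewrite dotDr dotNr dotZr unit_one_dot mulr1 subrr. Qed.

Lemma Pi_KL0E h : h \in Lfun mu 2%:E ->
  Pi_KL0 beta K L h = comb e (project (coords mu e h)).
Proof.
move=> hL; apply: (orth_proj_unique eL eo) => //.
- by move=> f [].
- move=> f g /V_KL0P[fE f0] /V_KL0P[gE g0].
  rewrite fE gE -combB; apply: V_KL0_comb.
  by rewrite dotDr dotNr f0 g0 subrr.
- by apply: V_KL0_comb; exact: dot_project.
- move=> w /V_KL0P[wE w0]; rewrite wE innerBl ?comb_Lfun2//.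
  rewrite innerC (inner_combl eL)// (inner_comb eL eo) dotDl dotNl dotZl w0 mulr0 subr0.
  by rewrite dotC subrr.
Qed.

Lemma gen_KL0E x : dot unit_one x = 0 ->
  gen_KL0 beta gamma K L (comb e x) =
  comb e (project (coords mu e (gen beta gamma (comb e x)))).
Proof.
move=> ux; rewrite /gen_KL0.
have -> : Pi_KL0 beta K L (comb e x) = comb e x.
  by rewrite Pi_KL0E ?comb_Lfun2// /project (coords_comb eL eo) ux scale0r subr0.
rewrite Pi_KL0E// gen_comb//; apply: comb_Lfun2; exact: gen_e_Lfun2.
Qed.

Variable C : R.
Hypothesis C_ge0 : 0 <= C.
(** The bound holds whatever the multiplier s, so it applies both to the kernel of the bordered
    matrix and to the equation projected onto [V_KL0]. *)
Hypothesis stable : forall x y s, dot unit_one x = 0 ->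
  L_mx beta gamma K L *m x + s *: unit_one = y -> nrm x <= C * nrm y.

Lemma Lhat_unit : Lhat_mx beta gamma K L \in unitmx.
Proof.
rewrite /Lhat_mx U_mxE; apply: bordered_unitmx.
  apply/eqP => u0; have := unit_one_dot; rewrite u0 dot0l => /eqP.
  by rewrite eq_sym oner_eq0.
move=> x s ux Lx; apply: nrm_eq0; apply/eqP; rewrite eq_le nrm_ge0 andbT.
have ux0 : dot unit_one x = 0.
  by move/matrixP/(_ 0 0): ux; rewrite mulmx_trE !mxE eqxx mulr1n.
by rewrite (le_trans (stable ux0 Lx))// /nrm dot0l sqrtr0 mulr0.
Qed.

(** The inverse is read off the bordered system. [L_mx] represents minus the generator, hence the
    sign of the right-hand side. *)
Definition galerkin_inverse (f : R * R -> R) : R * R -> R :=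
  comb e (usubmx (invmx (Lhat_mx beta gamma K L) *m col_mx (- coords mu e f) (0 : 'M[R]_1))).

Lemma galerkin_inverse_solve y (x := usubmx (invmx (Lhat_mx beta gamma K L) *m col_mx (- y) (0 : 'M[R]_1))) :
  dot unit_one x = 0 /\ exists s, L_mx beta gamma K L *m x + s *: unit_one = - y.
Proof.
rewrite /x; set z := invmx _ *m _.
have : Lhat_mx beta gamma K L *m z = col_mx (- y) 0 by rewrite mulKVmx// Lhat_unit.
rewrite -[z in LHS]vsubmxK /Lhat_mx U_mxE mul_block_col mul0mx addr0 => /eq_col_mx[h1 h2].
split; first by move/matrixP/(_ 0 0): h2; rewrite mulmx_trE !mxE eqxx mulr1n.
exists (dsubmx z 0 0); rewrite -h1; congr (_ + _).
have {2}-> : dsubmx z = (dsubmx z 0 0)%:M.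
  by apply/matrixP => i j; rewrite !ord1 [RHS]mxE eqxx mulr1n.
by rewrite scalar_mxC mul_scalar_mx.
Qed.

(** The multiplier of the bordered system is the component of the image along [unit_one], which is
    exactly what [project] removes. *)
Lemma galerkin_inverse_on :
  inverse_on (V_KL0 beta K L) (gen_KL0 beta gamma K L) galerkin_inverse.
Proof.
have MV f : V_KL0 beta K L f -> V_KL0 beta K L (gen_KL0 beta gamma K L f).
  move=> /V_KL0P[fE f0]; rewrite fE gen_KL0E//; apply: V_KL0_comb.
  exact: dot_project.
split => //.
- by move=> f _; rewrite /galerkin_inverse; apply: V_KL0_comb; have [] := galerkin_inverse_solve (coords mu e f).
- move=> f /V_KL0P[fE f0]; rewrite {1}fE gen_KL0E//; set x := coords mu e f.
  rewrite -fE /galerkin_inverse (coords_comb eL eo); set c := coords mu e _.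
  rewrite [RHS]fE -/x; congr (comb e _).
  (* The solution is exhibited: x itself, with the component of its image along [unit_one] as
     multiplier. *)
  have Lz : Lhat_mx beta gamma K L *m col_mx x ((dot unit_one c)%:M : 'M[R]_1) =
      col_mx (- project c) 0.
    rewrite /Lhat_mx U_mxE mul_block_col L_mx_mul -fE -/c mul0mx addr0.
    by rewrite scalar_mxC mul_scalar_mx mulmx_trE f0 raddf0 opprB addrC.
  by rewrite -Lz mulKmx ?Lhat_unit// col_mxKu.
- move=> f /V_KL0P[fE f0]; rewrite /galerkin_inverse.
  have [ux [s Lx]] := galerkin_inverse_solve (coords mu e f).
  move: (usubmx _) ux Lx => x ux Lx; rewrite gen_KL0E// [RHS]fE; congr (comb e _).
  have -> : coords mu e (gen beta gamma (comb e x)) = coords mu e f + s *: unit_one.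
    by apply: oppr_inj; rewrite -L_mx_mul opprD -Lx addrK.
  by rewrite /project dotDr dotZr unit_one_dot f0 add0r mulr1 addrK.
Qed.

Lemma op_norm_galerkin_inverse :
  (op_norm mu (V_KL0 beta K L) galerkin_inverse <= C%:E)%E.
Proof.
apply: ge_ereal_sup => _ [f [/V_KL0P[fE _] /= f1] <-]; rewrite lee_fin.
have [ux [s Lx]] := galerkin_inverse_solve (coords mu e f).
rewrite /galerkin_inverse (norm2_comb eL eo) (le_trans (stable ux Lx))//.
rewrite -scaleN1r nrmZ normrN1 mul1r ler_piMr//.
by have <- : norm2 mu f = nrm (coords mu e f) by rewrite [X in norm2 _ X]fE (norm2_comb eL eo).
Qed.

End fixed_size.

(** An instance of the abstract estimate. The order of the quantifiers matters: the constant and the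
    threshold for K are fixed before gamma and L. *)
Lemma galerkin_stability : exists2 C, 0 < C & exists K0, forall gamma K L, 0 < gamma ->
  (K0 <= K)%N -> (1 < L)%N ->
  (0 < K)%N /\ 0 < nrm (one_coords beta K) /\
  forall (x y : 'cV[R]_((2 * K).-1 * L)) s, dot (unit_one K L) x = 0 ->
    L_mx beta gamma K L *m x + s *: unit_one K L = y ->
    nrm x <= C * Num.max gamma gamma^-1 * nrm y.
Proof.
have [c c0 [K0 HP]] := galerkin_poincare beta_gt0.
have [om om0 Hom] := one_coords_ge beta_gt0.
have sb0 : 0 <= sb by exact: sqrtr_ge0.
have d0 : 0 <= sb / 2 by rewrite divr_ge0.
(* The constant of the abstract estimate for B = sqrt beta, d = sqrt beta / 2 and omega = om, none
   of which depends on K, L or gamma. *)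
pose c1 := c + 2 * (1 + c * (sb / 2) / om + sb * c).
exists (1 + 10 * c1 ^+ 2); first by rewrite ltr_pwDl// mulr_ge0 ?sqr_ge0.
exists (maxn 1 K0) => gamma K L gamma0; rewrite geq_max => /andP[K1 KK] L1.
split=> //; have one0 := lt_le_trans om0 (Hom _ K1); split=> // x y s ux Lx.
have L0 : (0 < L)%N by exact: ltnW.
have modeD (u v : 'cV[R]_((2 * K).-1 * L)) l : mode (u + v) l = mode u l + mode v l.
  by apply/colP => k; rewrite !mxE; case: insubP => [l' _ _|_]; rewrite ?mxE ?addr0.
have modeZ a (u : 'cV[R]_((2 * K).-1 * L)) l : mode (a *: u) l = a *: mode u l.
  by apply/colP => k; rewrite !mxE; case: insubP => [l' _ _|_]; rewrite ?mxE ?mulr0.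
have nrm_mode (u : 'cV[R]_((2 * K).-1 * L)) :
    nrm u = Num.sqrt (\sum_(l < L) nrm (mode u l) ^+ 2).
  by rewrite /nrm mode_dot; congr Num.sqrt; apply: eq_bigr => l _; rewrite sqr_nrm.
have wx0 : dot (one_coords beta K) (mode x 0) = 0.
  rewrite -mu_one_dot//; move: ux => /eqP.
  by rewrite dotZl mulf_eq0 invr_eq0 nrm_mu_one// (gt_eqF one0) => /eqP.
have ny : nrm y = nrm (- y) by rewrite -scaleN1r nrmZ normrN1 mul1r.
rewrite ny !nrm_mode.
(* [L_mx] represents minus the generator, hence - y; the multiplier s of the unit vector becomes - s
   / |w| in front of w. *)
have gE l : (l < L)%N -> mode (- y) l =
    Num.sqrt l%:R *: (Dmx beta K *m mode x l.-1) -
    Num.sqrt l.+1%:R *: ((Dmx beta K)^T *m mode x l.+1) - (gamma * l%:R) *: mode x l +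
    (if l == 0 then (- s / nrm (one_coords beta K)) *: one_coords beta K else 0).
  move=> lL; rewrite -Lx L_mx_mul// opprD opprK modeD mode_coords_gen//; congr (_ + _).
  rewrite -scaleNr modeZ modeZ mode_mu_one// scalerA nrm_mu_one//.
  by case: ifP => _; rewrite ?scaler0.
have h := @galerkin_estimate R _ (Dmx beta K) (one_coords beta K) sb c (sb / 2) om
  sb0 c0 d0 om0 (@Dmx_bounded R beta beta_gt0 K) (HP _ KK) (Dmx_one beta_gt0 K) (Hom _ K1)
  L gamma _ (mode x) (mode (- y)) L1 gamma0 (@mode_ge R K L x) wx0 gE.
exact: h.
Qed.

End galerkin_solution.

(** * The domain of the adjoint *)

Section A_bound.
Context {R : realType}.
Variable beta : R.
Local Notation mu := (mu beta).
Local Notation L2 := (Lfun mu 2%:E).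
Implicit Types f g h k u v : R * R -> R.

Lemma inner_ae d (T : measurableType d) (m : {measure set T -> \bar R}) (f g g' : T -> R) :
  f \in Lfun m 2%:E -> g \in Lfun m 2%:E -> g' \in Lfun m 2%:E ->
  {ae m, forall x, g x = g' x} -> inner m f g = inner m f g'.
Proof.
move=> fL gL g'L gg'; rewrite /inner /Rintegral; congr fine.
apply: ae_eq_integral => //.
- exact: measurable_int (integrable_mul fL gL).
- exact: measurable_int (integrable_mul fL g'L).
- by move: gg'; apply: filterS => x /= -> .
Qed.

(* A f = h solves h + T^* T h = T^* f, so |h|^2 + |T h|^2 = <T h, f>. *)
Lemma A_graph_bound f h : A_graph beta (f, h) -> f \in L2 ->
  h \in L2 /\ norm2 mu h <= norm2 mu f / 2.
Proof.
move=> [g1 /= [Tf [g2 /= [k [Th Tk]] ae1]]] fL.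
have [hL kL _] := Th; have [_ g2L ak] := Tk; have [_ g1L af] := Tf; rewrite /= in hL kL g2L g1L.
split=> //; have e1 := ak _ Th; have e2 := af _ Th; rewrite /= in e1 e2.
have e3 : inner mu h g1 = inner mu h h + inner mu h g2.
  rewrite -innerDr//; apply: inner_ae => //; exact: Lfun2D.
rewrite -(@ler_sqr R) ?nnegrE ?divr_ge0 ?norm2_ge0//.
have := le_inner kL fL; rewrite -e2 e3 e1 -!sqr_norm2.
(* |h|^2 <= |k| |f| - |k|^2 <= (|f| / 2)^2, where k = T h. *)
have := sqr_ge0 (norm2 mu k - norm2 mu f / 2); lra.
Qed.

(** The pairing identity is continuous in the graph norm, so it passes from [G] to its closure. *)
Lemma adjoint_closure (G : set ((R * R -> R) * (R * R -> R))) f g :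
  f \in L2 -> g \in L2 ->
  (forall u v, G (u, v) -> [/\ u \in L2, v \in L2 & inner mu u g = inner mu v f]) ->
  adjoint_op mu (closure_op mu G) (f, g).
Proof.
move=> fL gL HG; split => //= -[u v] [/= uL vL cl].
apply/eqP; rewrite -subr_eq0; apply/eqP.
have [//|/eqP d0] := eqVneq (inner mu u g - inner mu v f) 0.
have D0 : 0 < `|inner mu u g - inner mu v f| by rewrite normr_gt0; apply/eqP.
have S0 : 0 < norm2 mu g + norm2 mu f + 1.
  by rewrite ltr_wpDl// addr_ge0 ?norm2_ge0.
(* At this accuracy the two approximation errors together stay below the assumed discrepancy; the
   added 1 keeps the denominator positive. *)
have [[u' v'] /= [G' du dv]] := cl _ (divr_gt0 D0 S0).
have [u'L v'L e] := HG _ _ G'.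
have : `|inner mu u g - inner mu v f| <= norm2 mu (u - u') * norm2 mu g + norm2 mu (v - v') * norm2 mu f.
  have -> : inner mu u g - inner mu v f = inner mu (u - u') g - inner mu (v - v') f.
    by rewrite !innerBl// e; ring.
  apply: (le_trans (ler_normB _ _)).
  by rewrite lerD// inner_CS// Lfun2B.
move: D0 du dv; move: `|inner mu u g - inner mu v f| => D D0 du dv DE.
have h1 : norm2 mu (u - u') * norm2 mu g <= D / (norm2 mu g + norm2 mu f + 1) * norm2 mu g.
  by rewrite ler_wpM2r ?norm2_ge0// ltW.
have h2 : norm2 mu (v - v') * norm2 mu f <= D / (norm2 mu g + norm2 mu f + 1) * norm2 mu f.
  by rewrite ler_wpM2r ?norm2_ge0// ltW.
have := le_trans DE (lerD h1 h2); rewrite -mulrDr mulrAC ler_pdivlMr//.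
by rewrite !mulrDr mulr1 => h; exfalso; move: D0 h; clear; move: (D * norm2 mu g) (D * norm2 mu f) => a b; lra.
Qed.

End A_bound.

(** * Continuous functions on the plane *)

Section continuous_plane.
Context {R : realType}.
Implicit Types (u : R * R -> R) (q p : R).

Let step (n : nat) q : R := (Num.floor (n.+1%:R * q))%:~R / n.+1%:R.

Let step_cvg q : step n q @[n --> \oo] --> q.
Proof.
apply/cvgrPdist_le => eps eps0; near=> n.
have n0 : 0 < n.+1%:R :> R by rewrite ltr0n.
have /andP[h1 h2] := floor_itv (n.+1%:R * q).
have -> : q - step n q = (n.+1%:R * q - (Num.floor (n.+1%:R * q))%:~R) / n.+1%:R.
  by rewrite mulrBl mulrAC mulfV ?mul1r// gt_eqF.
rewrite ger0_norm ?divr_ge0 ?subr_ge0 ?(ltW n0)// ler_pdivrMr//.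
apply: (@le_trans _ _ 1); first by move: h2; rewrite intrD; lra.
rewrite -ler_pdivrMl// mulr1 (@le_trans _ _ n%:R) ?ler_nat//.
by near: n; exact: nbhs_infty_ger.
Unshelve. all: end_near. Qed.

Lemma continuous_section_l u p : continuous u -> continuous (fun q => u (q, p)).
Proof.
move=> cu q; have h : (x, p) @[x --> q] --> (q, p).
  exact: (cvg_pair (@cvg_id _ (nbhs q)) (cvg_cst p)).
exact: (cvg_comp _ _ h (cu (q, p))).
Qed.

Lemma continuous_section_r u q : continuous u -> continuous (fun p => u (q, p)).
Proof.
move=> cu p; have h : (q, x) @[x --> p] --> (q, p).
  exact: (cvg_pair (cvg_cst q) (@cvg_id _ (nbhs p))).
exact: (cvg_comp _ _ h (cu (q, p))).
Qed.

(** Measurability refers to the product sigma-algebra. Rounding q down to a multiple of 1 / (n + 1)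
    gives functions that converge pointwise to u and whose preimages are countable unions of
    rectangles. *)
Lemma continuous_plane_measurable u : continuous u -> measurable_fun setT u.
Proof.
move=> cu; apply: (@measurable_fun_cvg _ _ _ setT (fun n x => u (step n x.1, x.2))).
  move=> n _ Y mY; rewrite setTI.
  rewrite (_ : _ @^-1` Y = \bigcup_(k in [set: int])
    ([set q | Num.floor (n.+1%:R * q) = k] `*` ((fun p => u (k%:~R / n.+1%:R, p)) @^-1` Y))); last first.
    apply/seteqP; split=> [[q p] /= uY|[q p] [k _] /= [<-]//].
    by exists (Num.floor (n.+1%:R * q)).
  apply: countable_bigcupT_measurable => [|k]; first exact: countableP.
  apply: measurableX.
    rewrite (_ : [set q | _] = `[k%:~R / n.+1%:R, (k + 1)%:~R / n.+1%:R[%classic).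
      exact: measurable_itv.
    have n0 : 0 < n.+1%:R :> R by rewrite ltr0n.
    apply/seteqP; split=> q /=; rewrite in_itv /=.
      by move=> <-; rewrite ler_pdivrMr// ltr_pdivlMr// mulrC floor_itv.
    rewrite ler_pdivrMr// ltr_pdivlMr// mulrC => h.
    exact: floor_def.
  have := (continuous_measurable_fun (@continuous_section_r u (k%:~R / n.+1%:R) cu) measurableT mY).
  by rewrite setTI; apply.
move=> [q p] _ /=; have h : (step n q, p) @[n --> \oo] --> (q, p).
  have c1 := @step_cvg q; have c2 : p @[_ --> \oo] --> p by exact: cvg_cst.
  exact: (@cvg_pair nat R R \oo (nbhs q) (nbhs p) _ _ _ (fun n => step n q) (fun _ => p) c1 c2).
exact: (cvg_comp _ _ h (cu (q, p))).
Qed.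

(* a bound on the circle extends to the line by periodicity *)
Lemma periodic_bounded u : continuous u -> (forall q p, u (q + pi *+ 2, p) = u (q, p)) ->
  (exists M, forall q p, M < `|p| -> u (q, p) = 0) ->
  exists B, forall x, `|u x| <= B.
Proof.
move=> cu per [M uM].
have cK : compact (`[0, pi *+ 2] `*` `[- M, M] : set (R * R)).
  by apply: compact_setX; exact: segment_compact.
have cu' : {within `[0, pi *+ 2] `*` `[- M, M], continuous u} by exact: continuous_subspaceT.
have [B [Br HB]] := compact_bounded (continuous_compact cu' cK).
exists (`|B| + 1) => -[q p].
have perk (k : int) q' p' : u (q' + k%:~R * (pi *+ 2), p') = u (q', p').
  have pern (j : nat) q1 : u (q1 + j%:R * (pi *+ 2), p') = u (q1, p').
    elim: j q1 => [|j IH] q1; first by rewrite mul0r addr0.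
    by rewrite -natr1 mulrDl mul1r addrA per IH.
  case: k => j; first exact: pern.
  have -> : q' + (Negz j)%:~R * (pi *+ 2) = q' - j.+1%:R * (pi *+ 2) by rewrite NegzE intrN mulNr.
  by rewrite -[LHS](pern j.+1) subrK.
pose k := Num.floor (q / (pi *+ 2)); pose q0 := q - k%:~R * (pi *+ 2).
have -> : u (q, p) = u (q0, p) by rewrite -(perk k q0 p) /q0 subrK.
have [Mp|pM] := ltP M `|p|; first by rewrite uM// normr0 addr_ge0.
apply: HB; first by rewrite (le_lt_trans (ler_norm B))// ltrDl.
exists (q0, p) => //; split => /=; rewrite in_itv /=; last by rewrite -ler_norml.
have pi0 := @twopi_gt0 R; have /andP[h1 h2] := floor_itv (q / (pi *+ 2)).
have qE : q = q / (pi *+ 2) * (pi *+ 2) by rewrite divfK// gt_eqF.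
apply/andP; split.
  by rewrite subr_ge0 [X in _ <= X]qE ler_pM2r.
rewrite lerBlDr [X in X <= _]qE -[X in _ <= X + _]mul1r -mulrDl ler_pM2r//.
by move: h2; rewrite intrD addrC => /ltW.
Qed.

End continuous_plane.

(** * Tensor products in the domain of the adjoint *)

Section adjoint_domain.
Context {R : realType}.
Variable beta : R.
Hypothesis beta_gt0 : 0 < beta.
Local Notation mu := (mu beta).
Local Notation nu := (nu beta).
Local Notation kappa := (kappa beta).
Local Notation L2 := (Lfun mu 2%:E).
Implicit Types (u v w f g : R * R -> R) (q p : R) (a b : R -> R).

Let fiber_integrable w (B : R) q : continuous w -> (forall x, `|w x| <= B) ->
  kappa.-integrable setT (EFin \o (fun p => w (q, p))).
Proof.
move=> cw wB; apply: kappa_integrable => //.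
exact: (slow_bounded (@continuous_section_r _ w q cw)).
Qed.

Let bound_integrable (B : R) : kappa.-integrable setT (EFin \o (fun _ : R => B)).
Proof. by apply: kappa_integrable => //; exact: slow_cst. Qed.

Let itv1 q : [set` `]q - 1, q + 1[] q.
Proof. by rewrite /= in_itv /= ltrDl gtrDl oppr_lt0 ltr01. Qed.

Lemma fiber_mean_continuous w B : continuous w -> (forall x, `|w x| <= B) ->
  continuous (fun q => \int[kappa]_p w (q, p)).
Proof.
move=> cw wB q.
apply: (@continuity_under_integral _ _ _ kappa (fun q p => w (q, p)) setT measurableT (q - 1) (q + 1) _ _ (fun=> B)).
- by move=> x _; exact: fiber_integrable wB.
- by apply: aeW => p _ x _; exact: (@continuous_section_l _ w p cw).
- exact: bound_integrable.
- by move=> x _; apply: aeW.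
- by apply/mem_set; exact: itv1.
Qed.

(** Differentiation under the integral sign, dominated by the constant B', which is integrable for
    [kappa]. It makes [Pi_p] of a core function differentiable in q. *)
Lemma fiber_mean_derive w B B' : continuous w -> (forall x, `|w x| <= B) ->
  (forall q p, derivable (fun q' => w (q', p)) q 1) -> (forall x, `|dq w x| <= B') ->
  forall q, is_derive q 1 (fun q => \int[kappa]_p w (q, p)) (\int[kappa]_p dq w (q, p)).
Proof.
move=> cw wB dw w'B q.
have intw x : `]q - 1, q + 1[%classic x -> kappa.-integrable setT (EFin \o (fun p => w (x, p))).
  by move=> _; exact: fiber_integrable wB.
have derw x p : `]q - 1, q + 1[%classic x -> setT p -> derivable ((fun q p => w (q, p))^~ p) x 1.
  by move=> _ _; exact: dw.
have B'0 (p : R) : 0 <= B' by exact: le_trans (w'B (0, 0)).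
have w'B' x p : `]q - 1, q + 1[%classic x -> setT p -> `|partial1of2 (fun q p => w (q, p)) x p| <= B'.
  by move=> _ _; exact: w'B (x, p).
apply: DeriveDef.
  exact: (derivable_under_integral measurableT (itv1 q) intw derw B'0 (bound_integrable B') w'B').
rewrite -derive1E.
exact: (differentiation_under_integral measurableT (itv1 q) intw derw B'0 (bound_integrable B') w'B').
Qed.

Lemma bounded_Lfun2 w B : continuous w -> (forall x, `|w x| <= B) -> w \in L2.
Proof.
move=> cw wB; have mw := continuous_plane_measurable cw; apply: Lfun2P => //.
have B0 : 0 <= B by exact: le_trans (wB (0, 0)).
apply: (@le_integrable _ _ _ mu _ measurableT _ (EFin \o tensor (fun=> B ^+ 2) (fun=> 1))).
- by apply/measurable_EFinP; exact: measurable_funX.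
- move=> x _ /=; rewrite lee_fin /tensor mulr1 [leRHS]ger0_norm ?sqr_ge0//.
  by rewrite normrX lerXn2r ?nnegrE.
- apply: mu_integrable_tensor => //.
  by apply: nu_integrable; exact: continuous_cst.
Qed.

Lemma inner_fiber_mean w B a : continuous w -> (forall x, `|w x| <= B) -> continuous a ->
  inner mu w (tensor a (fun=> 1)) = inner nu (fun q => \int[kappa]_p w (q, p)) a.
Proof.
move=> cw wB ca.
have wL := bounded_Lfun2 cw wB.
have aL : tensor a (fun=> 1) \in L2 by apply: Lfun2_tensor => //; exact: slow_cst.
have /mu_integrableP := integrable_mul wL aL => /(_ beta_gt0) i0.
rewrite /inner /Rintegral mu_integralE// -(integral12_prod_meas1 i0); congr fine.
apply: eq_integral => q _; rewrite /fubini_F /=.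
rewrite (_ : (fun y => _) = (fun y => (a q)%:E * (w (q, y))%:E)%E); last first.
  by apply/funext => p; rewrite /tensor mulr1 mulrC EFinM.
have h := fiber_integrable q cw wB.
rewrite integralZl// /= EFinM muleC fineK//.
exact: integrable_fin_num.
Qed.

Lemma dq_period w : (forall q p, w (q + pi *+ 2, p) = w (q, p)) ->
  forall q p, dq w (q + pi *+ 2, p) = dq w (q, p).
Proof.
move=> per q p; rewrite /dq /derive1 /=.
by under eq_fun do rewrite addrA !per.
Qed.

Lemma dq_support w M : (forall q p, M < `|p| -> w (q, p) = 0) ->
  forall q p, M < `|p| -> dq w (q, p) = 0.
Proof.
move=> w0 q p Mp; rewrite /dq /=.
rewrite (_ : (fun q => _) = cst 0); last by apply/funext => x; exact: w0.
by rewrite derive1_cst.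
Qed.

Lemma L_ham_Pi_p w (w' : R -> R) : (forall q, is_derive q 1 (fun q => \int[kappa]_p w (q, p)) (w' q)) ->
  L_ham (Pi_p beta w) = tensor w' (fun p => p).
Proof.
move=> dw; apply/funext => x; rewrite /L_ham /dq /dp /Pi_p /=.
by rewrite (derive1_val (dw x.1)) derive1_cst mulr0 subr0 mulrC.
Qed.

(** On the core the operator sends w to p W'(q), where W is the fiber mean of w. Its product with
    a(q) b(p) is <p, b> <W', a>, and integration by parts in [nu] moves the derivative to a. *)
Lemma T_adj_tensor a a' b : (forall q, is_derive q 1 a (a' q)) -> continuous a' ->
  a (pi *+ 2) = a 0 -> slow b ->
  T_adj beta (tensor a b, inner kappa (fun p => p) b *:
    tensor (fun q => beta * sin q * a q - a' q) (fun=> 1)).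
Proof.
move=> da ca' a2 sb; have ca := is_derive_continuous da.
have cs := @continuous_sin R.
have ch : continuous (fun q => beta * sin q * a q - a' q).
  apply: continuous_add; last exact: continuous_opp.
  by apply: continuous_mul => //; apply: continuous_mul => //; exact: continuous_cst.
have hL : tensor (fun q => beta * sin q * a q - a' q) (fun=> 1) \in L2.
  by apply: Lfun2_tensor => //; exact: slow_cst.
apply: adjoint_closure.
- exact: Lfun2_tensor.
- exact: Lfun2Z.
move=> u v [w wC [<- <-]] {u v}.
have [wn per supp] := wC; have [M wM] := supp.
have [cw [dw _ [cdw _] _]] := wn 1%N.
have [B wB] := periodic_bounded cw per supp.
have [B' wB'] := periodic_bounded cdw (dq_period per) (ex_intro _ M (dq_support wM)).
have dW := fiber_mean_derive cw wB dw wB'.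
have cW' := fiber_mean_continuous cdw wB'.
rewrite (L_ham_Pi_p dW); split.
- exact: bounded_Lfun2 wB.
- by apply: Lfun2_tensor => //; exact: slow_id.
rewrite innerZr//; last exact: bounded_Lfun2 wB.
rewrite (inner_fiber_mean cw wB ch) inner_tensor//; last exact: slow_id.
rewrite mulrC; congr (_ * _).
have W2 : \int[kappa]_p w (pi *+ 2, p) = \int[kappa]_p w (0, p).
  by apply: eq_Rintegral => p _; rewrite -[pi *+ 2]add0r per.
have := inner_nu_by_parts beta dW cW' W2 da ca' a2.
have cW := is_derive_continuous dW.
set W := (fun q => _) in W2 cW dW cW' *; set W' := (fun q => _) in dW cW' *.
have e : inner nu W (fun q => beta * sin q * a q - a' q) =
   beta * inner nu (fun q => sin q * W q) a - inner nu W a'.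
  have -> : (fun q => beta * sin q * a q - a' q) = beta *: (fun q => sin q * a q) - a'.
    by apply/funext => q; rewrite -mulrA.
  have cwL := Lfun2_nu beta cW.
  have csa := continuous_mul cs ca.
  rewrite innerBr ?innerZr ?Lfun2Z ?Lfun2_nu//; congr (_ * _ - _).
  by apply: eq_Rintegral => q _; rewrite mulrA [W q * _]mulrC.
by rewrite e => <-; rewrite addrK.
Qed.

Lemma T_adjD f f' g g' : T_adj beta (f, g) -> T_adj beta (f', g') -> T_adj beta (f + f', g + g').
Proof.
move=> [/= fL gL h] [/= f'L g'L h']; split => /=; [exact: Lfun2D|exact: Lfun2D|].
move=> [u v] uv; have [/= uL vL _] := uv; rewrite !innerDr//.
by rewrite (h _ uv) (h' _ uv).
Qed.

Lemma T_adjZ c f g : T_adj beta (f, g) -> T_adj beta (c *: f, c *: g).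
Proof.
move=> [/= fL gL h]; split => /=; [exact: Lfun2Z|exact: Lfun2Z|].
move=> [u v] uv; have [/= uL vL _] := uv; rewrite !innerZr//.
by rewrite (h _ uv).
Qed.

End adjoint_domain.

(** * Upper bound on the hypocoercivity rate *)

Section smooth_bounded_functions.
Context {R : realType}.
Implicit Types (f g : R -> R) (x c d : R) (n k : nat).

(* n times differentiable, bounded together with these derivatives *)
Fixpoint smooth_bounded n f : Prop :=
  [/\ continuous f, exists B, forall x, `|f x| <= B &
  if n is n'.+1 then exists2 f', (forall x, is_derive x 1 f (f' x)) & smooth_bounded n' f'
  else True].

Lemma smooth_boundedW n f : smooth_bounded n.+1 f -> smooth_bounded n f.
Proof.
elim: n f => [|n IH] f [cf bf [f' df sf']]; first by [].
by split=> //; exists f' => //; exact: IH.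
Qed.

Lemma smooth_bounded_cst n c : smooth_bounded n (fun=> c).
Proof.
have bc c' : exists B : R, R -> `|c'| <= B by exists `|c'|.
elim: n c => [|n IH] c; split=> //; try exact: continuous_cst.
by exists (fun=> 0) => [x|]; [exact: der_cst|exact: IH].
Qed.

Lemma smooth_boundedD n f g : smooth_bounded n f -> smooth_bounded n g ->
  smooth_bounded n (fun x => f x + g x).
Proof.
have bD f1 g1 : (exists B, forall x, `|f1 x| <= B) -> (exists B, forall x, `|g1 x| <= B) ->
    exists B, forall x, `|f1 x + g1 x| <= B.
  move=> [B fB] [B' gB]; exists (B + B') => x.
  by rewrite (le_trans (ler_normD _ _))// lerD.
elim: n f g => [|n IH] f g [cf bf sf] [cg bg sg].
  by split => //; [exact: continuous_add|exact: bD].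
have [f' df sf'] := sf; have [g' dg sg'] := sg.
split; [exact: continuous_add|exact: bD|].
by exists (fun x => f' x + g' x) => [x|]; [exact: der_add|exact: IH].
Qed.

Lemma smooth_boundedM n f g : smooth_bounded n f -> smooth_bounded n g ->
  smooth_bounded n (fun x => f x * g x).
Proof.
have bM f1 g1 : (exists B, forall x, `|f1 x| <= B) -> (exists B, forall x, `|g1 x| <= B) ->
    exists B, forall x, `|f1 x * g1 x| <= B.
  move=> [B fB] [B' gB]; exists (B * B') => x.
  by rewrite normrM ler_pM.
elim: n f g => [|n IH] f g sf sg; have [cf bf hf] := sf; have [cg bg hg] := sg.
  by split => //; [exact: continuous_mul|exact: bM].
have [f' df sf'] := hf; have [g' dg sg'] := hg.
split; [exact: continuous_mul|exact: bM|].
exists (fun x => f' x * g x + f x * g' x) => [x|]; first exact: der_mul.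
by apply: smooth_boundedD; apply: IH => //; exact: smooth_boundedW.
Qed.

Lemma smooth_boundedZ n c f : smooth_bounded n f -> smooth_bounded n (fun x => c * f x).
Proof. by apply: smooth_boundedM; exact: smooth_bounded_cst. Qed.

Lemma smooth_bounded_affine n c d f : smooth_bounded n f ->
  smooth_bounded n (fun x => f (c * x + d)).
Proof.
have cA : continuous (fun x : R => c * x + d).
  apply: continuous_add; last exact: continuous_cst.
  by apply: continuous_mul; [exact: continuous_cst|move=> x; exact: cvg_id].
have cC f1 : continuous f1 -> continuous (fun x => f1 (c * x + d)).
  by move=> cf x; exact: (@continuous_comp _ _ _ (fun x => c * x + d) f1 x (cA x) (cf _)).
elim: n f => [|n IH] f [cf [B fB] hf].
  by split; [exact: cC|exists B|].
have [f' df sf'] := hf.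
split; [exact: cC|by exists B|].
exists (fun x => c * f' (c * x + d)) => [x|]; last by apply: smooth_boundedZ; exact: IH.
apply: is_derive_val (der_comp (df _) (der_add (der_scale c (der_id x)) (der_cst d x))) _.
by rewrite mulr1 addr0 mulrC.
Qed.

Lemma smooth_bounded_sin n : smooth_bounded n (@sin R) /\ smooth_bounded n (@cos R).
Proof.
have bs : exists B : R, forall x, `|sin x| <= B by exists 1 => x; exact: sin_max.
have bc : exists B : R, forall x, `|cos x| <= B by exists 1 => x; exact: cos_max.
elim: n => [|n [IHs IHc]].
  by split; split => //; [exact: continuous_sin|exact: continuous_cos].
split; (split; [by [exact: continuous_sin|exact: continuous_cos]|by []|]).
  by exists (@cos R) => // x; exact: is_derive_sin.
exists (fun x => -1 * sin x); last exact: smooth_boundedZ.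
by move=> x; rewrite mulN1r; exact: is_derive_cos.
Qed.

(** The derivatives of e^(-1/x) extended by 0 are combinations of these functions. Carrying k along
    makes the family closed under differentiation, so that smoothness follows by induction. *)
Let flat k x : R := if 0 < x then x^-1 ^+ k * expR (- x^-1) else 0.

Let flat_ge0 k x : 0 <= flat k x.
Proof.
rewrite /flat; case: ifP => // x0.
by rewrite mulr_ge0 ?expR_ge0// exprn_ge0// invr_ge0 ltW.
Qed.

Let flat_le k x : flat k x <= k`!%:R.
Proof.
rewrite /flat; case: ifP => x0; last by rewrite ler0n.
rewrite expRN ler_pdivrMr ?expR_gt0//.
case: k => [|k].
  by rewrite expr0 mul1r (le_trans _ (expR_ge1Dx _))// lerDl invr_ge0 ltW.
have y0 : 0 <= x^-1 by rewrite invr_ge0 ltW.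
have f0 : 0 < k.+1`!%:R :> R by rewrite ltr0n fact_gt0.
rewrite -ler_pdivrMl// mulrC.
by have := expR_ge1Dxn k y0; lra.
Qed.

Let flat_bounded k x : `|flat k x| <= k`!%:R.
Proof. by rewrite ger0_norm ?flat_ge0 ?flat_le. Qed.

(** Two powers of 1/x are traded for x^2, as [flat (k + 2)] is still bounded; the derivative at 0
    therefore exists and vanishes. *)
Let flat_sqr k x : `|flat k x| <= (k + 2)`!%:R * x ^+ 2.
Proof.
have [x0|x0] := ltP 0 x; last first.
  by rewrite /flat ltNge x0 /= normr0 mulr_ge0 ?sqr_ge0.
have -> : flat k x = flat (k + 2) x * x ^+ 2.
  rewrite /flat x0 exprD.
  have xV : x^-1 ^+ 2 * x ^+ 2 = 1 by rewrite -exprMn mulVf ?expr1n// gt_eqF.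
  by rewrite [RHS]mulrAC -[_ * _ * x ^+ 2]mulrA xV mulr1.
by rewrite normrM [`|x ^+ 2|]ger0_norm ?sqr_ge0// ler_wpM2r ?sqr_ge0// flat_bounded.
Qed.

Let der_sqr_bound f C : (forall x, `|f x| <= C * x ^+ 2) -> is_derive (0 : R) 1 f 0.
Proof.
move=> fC; have f0 : f 0 = 0.
  by apply/eqP; rewrite -normr_le0; have := fC 0; rewrite expr0n mulr0.
have h : (fun h : R => h^-1 *: (f (h *: 1 + 0) - f 0)) @ 0^' --> (0 : R).
  apply/cvgrPdist_le => e e0; near=> t.
  rewrite f0 subr0 addr0 sub0r normrN [t *: 1]mulr1 normrM normfV.
  have t0 : 0 < `|t| by rewrite normr_gt0; near: t; exact: nbhs_dnbhs_neq.
  rewrite ler_pdivrMl// (le_trans (fC t))// (le_trans (y := `|C| * (`|t| * `|t|)))//.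
    by rewrite -normrM -expr2 [`|t ^+ 2|]ger0_norm ?sqr_ge0// ler_wpM2r ?sqr_ge0 ?ler_norm.
  rewrite mulrCA ler_wpM2l// (le_trans (y := (`|C| + 1) * `|t|))//.
    by rewrite ler_wpM2r// lerDl.
  have C1 : 0 < `|C| + 1 by rewrite ltr_wpDl.
  rewrite -ler_pdivlMl// mulrC; near: t.
  apply: dnbhs0_le; exact: divr_gt0.
apply: DeriveDef; first by apply/cvg_ex; exists 0.
exact: cvg_lim.
Unshelve. all: end_near. Qed.

Let der_flat k x : is_derive x 1 (flat k) (flat k.+2 x + - k%:R * flat k.+1 x).
Proof.
have [x0|x0|x0] := ltgtP x 0.
- rewrite /flat !ltNge (ltW x0) /= mulr0 addr0.
  apply: near_eq_is_derive (der_cst 0 x); near=> y.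
  by rewrite ltNge ltW //=; near: y; exact: lt_nbhsl.
- have x0' : x != 0 by rewrite gt_eqF.
  have dX (y : R) : is_derive y 1 (fun y : R => y ^+ k) (k%:R * y ^+ k.-1).
    elim: k => [|k IH]; first by apply: is_derive_val (der_cst 1 y) _; rewrite mul0r.
    rewrite (_ : (fun y => _) = (fun y => y * y ^+ k)); last by apply/funext => z; rewrite exprS.
    apply: is_derive_val (der_mul (der_id y) IH) _.
    by case: k {IH} => [|k]; rewrite ?expr0 ?exprS -?(natr1 k.+1) /=; ring.
  have dV : is_derive x 1 (fun y : R => y^-1) (- x^-1 ^+ 2).
    apply: is_derive_val (is_deriveV x0' (der_id x)) _.
    by rewrite [_ *: _]mulr1 exprVn.
  have dF := der_mul (der_comp (dX _) dV) (der_exp (der_opp dV)).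
  have {}dF : is_derive x 1 (fun y : R => y^-1 ^+ k * expR (- y^-1))
      (flat k.+2 x + - k%:R * flat k.+1 x).
    apply: is_derive_val dF _; rewrite /flat x0.
    by case: k {dX} => [|k]; rewrite ?expr0 ?exprS /=; ring.
  apply: near_eq_is_derive dF; near=> y.
  by rewrite /flat ifT//; near: y; exact: lt_nbhsr.
- rewrite x0; apply: is_derive_val (der_sqr_bound (flat_sqr k)) _.
  by rewrite /flat ltxx mulr0 addr0.
Unshelve. all: end_near. Qed.

Let smooth_flat n k : smooth_bounded n (flat k).
Proof.
elim: n k => [|n IH] k.
  split=> //; first exact: is_derive_continuous (der_flat k).
  by exists k`!%:R.
split=> //; [exact: is_derive_continuous (der_flat k)|by exists k`!%:R|].
exists (fun x => flat k.+2 x + - k%:R * flat k.+1 x); first exact: der_flat.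
by apply: smooth_boundedD => //; exact: smooth_boundedZ.
Qed.

(** The product of e^(-1/(1+x)) and e^(-1/(1-x)), each extended by 0. *)
Lemma smooth_bump : exists f,
  [/\ forall n, smooth_bounded n f, 0 < f 0 & forall x, 1 < `|x| -> f x = 0].
Proof.
exists (fun x => flat 0 (1 * x + 1) * flat 0 (-1 * x + 1)); split=> [n||x].
- by apply: smooth_boundedM; exact: smooth_bounded_affine.
- by rewrite /flat !mulr0 add0r ltr01 !expr0 !mul1r mulr_gt0 ?expR_gt0.
- rewrite lter_normr /flat mul1r mulN1r => /orP[x1|x1].
    by rewrite [X in _ * X]ifF ?mulr0//; apply/negbTE; rewrite -leNgt; lra.
  by rewrite ifF ?mul0r//; apply/negbTE; rewrite -leNgt; lra.
Qed.

Lemma continuous_tensor f g : continuous f -> continuous g -> continuous (tensor f g).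
Proof.
move=> cf cg x; apply: cvgM.
  by apply: (@cvg_comp _ _ _ fst f _ _ _ (@cvg_fst _ _ (nbhs x.1) (nbhs x.2) _)); exact: cf.
by apply: (@cvg_comp _ _ _ snd g _ _ _ (@cvg_snd _ _ (nbhs x.1) (nbhs x.2) _)); exact: cg.
Qed.

Lemma Cn_tensor n f g : smooth_bounded n f -> smooth_bounded n g -> Cn n (tensor f g).
Proof.
elim: n f g => [|n IH] f g sf sg; have [cf bf hf] := sf; have [cg bg hg] := sg.
  by split=> //; exact: continuous_tensor.
have [f' df sf'] := hf; have [g' dg sg'] := hg.
have dq' (q p : R) : is_derive q 1 (fun q => tensor f g (q, p)) (tensor f' g (q, p)).
  apply: is_derive_val (der_mul (df q) (der_cst (g p) q)) _.
  by rewrite mulr0 addr0.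
have dp' (q p : R) : is_derive p 1 (fun p => tensor f g (q, p)) (tensor f g' (q, p)).
  by have := der_scale (f q) (dg p).
split; first exact: continuous_tensor.
split.
- by move=> q p; case: (dq' q p).
- by move=> q p; case: (dp' q p).
- rewrite (_ : dq _ = tensor f' g); first by apply: IH => //; exact: smooth_boundedW.
  by apply/funext => -[q p]; exact: derive1_val (dq' q p).
- rewrite (_ : dp _ = tensor f g'); first by apply: IH => //; exact: smooth_boundedW.
  by apply/funext => -[q p]; exact: derive1_val (dp' q p).
Qed.

End smooth_bounded_functions.

(** * The coercivity inequality at a cut-off test function *)

Section rate_upper_bound.
Context {R : realType}.
Variable beta : R.
Hypothesis beta_gt0 : 0 < beta.
Local Notation mu := (mu beta).
Local Notation nu := (nu beta).
Local Notation kappa := (kappa beta).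
Local Notation L2 := (Lfun mu 2%:E).
Implicit Types (q p : R) (a b : R -> R).

Lemma norm2_mono d (T : measurableType d) (m : {measure set T -> \bar R}) (f g : T -> R) :
  f \in Lfun m 2%:E -> g \in Lfun m 2%:E -> (forall x, `|f x| <= `|g x|) ->
  norm2 m f <= norm2 m g.
Proof.
move=> fL gL fg; rewrite /norm2 ler_wsqrtr//; apply: le_Rintegral => //.
- exact: integrable_mul.
- exact: integrable_mul.
- move=> x _; rewrite -!expr2 -(real_normK (num_real (f x))) -(real_normK (num_real (g x))).
  by rewrite lerXn2r ?nnegrE.
Qed.

Lemma norm2_cst d (T : measurableType d) (P : probability T R) (c : R) :
  norm2 P (fun=> c) = `|c|.
Proof.
rewrite /norm2 /inner Rintegral_cst//= probability_setT mulr1.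
by rewrite -expr2 sqrtr_sqr.
Qed.

Lemma norm2_le_bound d (T : measurableType d) (P : probability T R) (f : T -> R) (c : R) :
  f \in Lfun P 2%:E -> 0 <= c -> (forall x, `|f x| <= c) -> norm2 P f <= c.
Proof.
move=> fL c0 fc; rewrite -[leRHS]ger0_norm// -(norm2_cst P); apply: norm2_mono => //.
  apply: Lfun2P; first exact: measurable_cst.
  exact: finite_measure_integrable_cst.
by move=> q; rewrite [leRHS]ger0_norm.
Qed.

Lemma norm2_tensor a b : continuous a -> slow b ->
  norm2 mu (tensor a b) = norm2 nu a * norm2 kappa b.
Proof. by move=> ca sb; rewrite /norm2 inner_tensor// sqrtrM ?inner_ge0. Qed.

(** If sin q were null, integrating the derivative of sin q cos q by parts would make the integral
    of cos^2 vanish too, against cos^2 + sin^2 = 1. *)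
Lemma norm2_sin_gt0 : 0 < norm2 nu (@sin R).
Proof.
have cs := @continuous_sin R; have cc := @continuous_cos R.
have css := continuous_mul cs cs; have ccc := continuous_mul cc cc.
have sL := Lfun2_nu beta cs.
rewrite lt_neqAle norm2_ge0 andbT eq_sym; apply/eqP => s0.
have ss : inner nu (@sin R) (@sin R) = 0 by rewrite -sqr_norm2 s0 expr0n.
have dsc q : is_derive q 1 (fun q => sin q * cos q) (cos q * cos q - sin q * sin q).
  apply: is_derive_val (der_mul (is_derive_sin q) (is_derive_cos q)) _.
  by rewrite mulrN.
have cdsc : continuous (fun q : R => cos q * cos q - sin q * sin q).
  by apply: continuous_add => //; exact: continuous_opp.
have sc2pi : sin (pi *+ 2) * cos (pi *+ 2) = sin 0 * cos 0 :> R.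
  by have [s2 _] := @sin_cos_2pi R 1; rewrite -[pi *+ 2]mul1r s2 sin0 !mul0r.
have : \int[nu]_q (cos q * cos q - sin q * sin q) = 0.
  rewrite (nu_by_parts beta dsc cdsc sc2pi).
  rewrite (_ : \int[nu]_q _ = inner nu (fun q => sin q * cos q) (@sin R)); last first.
    by apply: eq_Rintegral => q _; rewrite mulrC.
  have := inner_CS (Lfun2_nu beta (continuous_mul cs cc)) sL.
  by rewrite s0 mulr0 normr_le0 => /eqP ->; rewrite mulr0.
rewrite RintegralB//; try exact: nu_integrable.
rewrite [X in _ - X]ss subr0 => cc0.
have : \int[nu]_q (sin q * sin q + cos q * cos q) = 0.
  by rewrite RintegralD// ?cc0 ?[X in X + _]ss ?addr0//; exact: nu_integrable.
rewrite (_ : (fun q => _) = fun=> 1); last first.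
  by apply/funext => q; rewrite -!expr2 sin2cos2 subrK.
by rewrite Rintegral_cst//= nu_setT mulr1 => /eqP; rewrite oner_eq0.
Qed.

Let idp : R -> R := fun p => p.

Lemma gen_tensor1 gamma a a' b b' b'' : (forall q, is_derive q 1 a (a' q)) ->
  (forall p, is_derive p 1 b (b' p)) -> (forall p, is_derive p 1 b' (b'' p)) ->
  gen beta gamma (tensor a b) = tensor a' (fun p => p * b p)
    - tensor (fun q => sin q * a q) b'
    + gamma *: tensor a (fun p => - (p * b' p) + beta^-1 * b'' p).
Proof.
move=> da db db'.
have := @gen_tensorE R beta gamma 1 (fun=> 1) (fun=> a) (fun=> a') (fun=> b) (fun=> b')
  (fun=> b'') (fun=> da) (fun=> db) (fun=> db').
by rewrite !big_ord1 !scale1r.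
Qed.

Section cutoff.
Variable f : R -> R.
Hypothesis smooth_f : forall n, smooth_bounded n f.
Hypothesis f0 : 0 < f 0.
Hypothesis supp_f : forall p, 1 < `|p| -> f p = 0.

Variables (f' f'' : R -> R) (M0 M1 M2 : R).
Hypothesis df : forall p, is_derive p 1 f (f' p).
Hypothesis df' : forall p, is_derive p 1 f' (f'' p).
Hypothesis cf'' : continuous f''.
Hypothesis fM0 : forall p, `|f p| <= M0.
Hypothesis f'M1 : forall p, `|f' p| <= M1.
Hypothesis f''M2 : forall p, `|f'' p| <= M2.

Variable t : R.
Hypothesis t_gt0 : 0 < t.
Hypothesis t_le1 : t <= 1.

Let chi p := f (t * p).
Let chi' p := t * f' (t * p).
Let chi'' p := t ^+ 2 * f'' (t * p).

Let phi : R * R -> R := tensor (@sin R) chi.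

Let dscale p : is_derive p 1 (fun p => t * p) t.
Proof. by apply: is_derive_val (der_scale t (der_id p)) _; rewrite mulr1. Qed.

Let dchi p : is_derive p 1 chi (chi' p).
Proof. by apply: is_derive_val (der_comp (df _) (dscale p)) _; rewrite mulrC. Qed.

Let dchi' p : is_derive p 1 chi' (chi'' p).
Proof.
apply: is_derive_val (der_scale t (der_comp (df' _) (dscale p))) _.
by rewrite /chi''; ring.
Qed.

Let cchi'' : continuous chi''.
Proof.
apply: continuous_mul; first exact: continuous_cst.
by move=> p; have := @continuous_comp _ _ _ (fun p => t * p) f'' p (is_derive_continuous dscale (x:=p)) (@cf'' _).
Qed.

Let chiM p : `|chi p| <= M0. Proof. exact: fM0. Qed.

Let chi'M p : `|chi' p| <= t * M1.
Proof. by rewrite normrM (gtr0_norm t_gt0) ler_pM2l. Qed.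

(** One of the two factors t is given up through t <= 1, so that all error terms are linear in t. *)
Let chi''M p : `|chi'' p| <= t * M2.
Proof.
rewrite normrM ger0_norm ?sqr_ge0// ler_pM ?sqr_ge0//.
by rewrite expr2 ger_pMl.
Qed.

Let M0_ge0 : 0 <= M0. Proof. exact: le_trans (fM0 0). Qed.
Let M1_ge0 : 0 <= M1. Proof. exact: le_trans (f'M1 0). Qed.
Let M2_ge0 : 0 <= M2. Proof. exact: le_trans (f''M2 0). Qed.

Let schi : slow chi. Proof. exact: slow_bounded (is_derive_continuous dchi) chiM. Qed.
Let schi' : slow chi'. Proof. exact: slow_bounded (is_derive_continuous dchi') chi'M. Qed.
Let schi'' : slow chi''. Proof. exact: slow_bounded cchi'' chi''M. Qed.
Let sid : slow idp. Proof. exact: slow_id. Qed.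

Let phi_Cc : Cc_infty phi.
Proof.
split.
- move=> n; apply: Cn_tensor; first by have [] := @smooth_bounded_sin R n.
  have := @smooth_bounded_affine _ n t 0 _ (smooth_f n).
  by rewrite (_ : (fun p => _) = chi)//; apply/funext => p; rewrite addr0.
- by move=> q p; rewrite /phi /tensor /= sinD2pi.
- exists t^-1 => q p tp; rewrite /phi /tensor /chi /= supp_f ?mulr0//.
  by rewrite normrM (gtr0_norm t_gt0) -ltr_pdivrMl// mulr1.
Qed.

Let cs := @continuous_sin R.
Let cc := @continuous_cos R.
Let css : continuous (fun q : R => sin q * sin q) := continuous_mul cs cs.

(** The mean of sin q is 0, by integration by parts against the constant 1; the test function is
    thus in the range of [Pi0]. *)
Let Pi0_phi : Pi0 beta phi = phi.
Proof.
apply/funext => x; rewrite /Pi0 mu_Rintegral_cont_slow//.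
rewrite (_ : \int[nu]_q sin q = 0) ?mul0r ?subr0//.
have d1 (q : R) : is_derive q 1 (fun _ : R => 1 : R) ((fun _ : R => 0 : R) q) by exact: der_cst.
have := nu_by_parts beta d1 (@continuous_cst R 0) erefl.
rewrite Rintegral_cst// mul0r => /esym/eqP; rewrite mulf_eq0 gt_eqF//= => /eqP <-.
by apply: eq_Rintegral => q _; rewrite mulr1.
Qed.

Variable gamma : R.
Hypothesis gamma_gt0 : 0 < gamma.

Let psi1 : R * R -> R := tensor (@cos R) (fun p => p * chi p).
Let psi2 : R * R -> R := tensor (fun q => sin q * sin q) chi'.
Let psi3 : R * R -> R := tensor (@sin R) (fun p => - (p * chi' p) + beta^-1 * chi'' p).

Let gen_phi : gen beta gamma phi = psi1 - psi2 + gamma *: psi3.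
Proof. by rewrite (gen_tensor1 gamma (@is_derive_sin R) dchi dchi'). Qed.

Let P := norm2 kappa idp.
Let K := M1 + M1 * P + beta^-1 * M2.

Let s1 : slow (fun p => p * chi p). Proof. exact: slow_mul. Qed.
Let s3 : slow (fun p => - (p * chi' p) + beta^-1 * chi'' p).
Proof.
apply: slow_add; first by apply: slow_opp; exact: slow_mul.
by apply: slow_mul => //; exact: slow_cst.
Qed.

Let psi1L : psi1 \in L2. Proof. exact: Lfun2_tensor. Qed.
Let psi2L : psi2 \in L2. Proof. exact: Lfun2_tensor. Qed.
Let psi3L : psi3 \in L2. Proof. exact: Lfun2_tensor. Qed.
Let phiL : phi \in L2. Proof. exact: Lfun2_tensor. Qed.

Let norm2_mul_id b (M : R) : slow b -> 0 <= M -> (forall p, `|b p| <= M) ->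
  norm2 kappa (fun p => p * b p) <= M * P.
Proof.
move=> sb M0' bM; rewrite -[M in leRHS]ger0_norm// -norm2Z; last exact: Lfun2_kappa.
apply: norm2_mono.
- by apply: Lfun2_kappa => //; exact: slow_mul.
- by apply: Lfun2Z; exact: Lfun2_kappa.
- by move=> p; rewrite [(_ *: _) p](_ : _ = M * p)// !normrM mulrC (ger0_norm M0') ler_wpM2r.
Qed.

Let nrm_sin : norm2 nu (@sin R) <= 1.
Proof. by apply: norm2_le_bound => //; [exact: Lfun2_nu|exact: sin_max]. Qed.

Let nrm_cos : norm2 nu (@cos R) <= 1.
Proof. by apply: norm2_le_bound => //; [exact: Lfun2_nu|exact: cos_max]. Qed.

Let nrm_sin2 : norm2 nu (fun q => sin q * sin q) <= 1.
Proof.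
apply: norm2_le_bound => //; first exact: Lfun2_nu.
by move=> q; rewrite normrM mulr_ile1 ?sin_max.
Qed.

Let nrm_phi : norm2 mu phi <= M0.
Proof.
rewrite norm2_tensor// -[leRHS]mul1r ler_pM ?norm2_ge0//.
by apply: norm2_le_bound => //; exact: Lfun2_kappa.
Qed.

Let nrm_psi1 : norm2 mu psi1 <= M0 * P.
Proof.
rewrite norm2_tensor// -[leRHS]mul1r ler_pM ?norm2_ge0//.
exact: norm2_mul_id.
Qed.

Let nrm_psi2 : norm2 mu psi2 <= t * M1.
Proof.
rewrite norm2_tensor// -[leRHS]mul1r ler_pM ?norm2_ge0//.
by apply: norm2_le_bound; [exact: Lfun2_kappa|rewrite mulr_ge0// ltW|exact: chi'M].
Qed.

Let nrm_psi3 : norm2 mu psi3 <= t * (M1 * P + beta^-1 * M2).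
Proof.
rewrite norm2_tensor// -[leRHS]mul1r ler_pM ?norm2_ge0//.
have h1 : (fun p => p * chi' p) \in Lfun kappa 2%:E by apply: Lfun2_kappa => //; exact: slow_mul.
have h2 : chi'' \in Lfun kappa 2%:E by exact: Lfun2_kappa.
have -> : (fun p => - (p * chi' p) + beta^-1 * chi'' p) =
    - (fun p => p * chi' p) + beta^-1 *: chi'' by [].
apply: (le_trans (norm2_triangle (Lfun2N h1) (Lfun2Z _ h2))).
rewrite norm2N// norm2Z// mulrDr lerD//.
  by rewrite mulrA; apply: norm2_mul_id => //; rewrite mulr_ge0// ltW.
rewrite ger0_norm ?invr_ge0 ?(ltW beta_gt0)// mulrCA ler_pM2l ?invr_gt0//.
by apply: norm2_le_bound => //; rewrite mulr_ge0// ltW.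
Qed.

Let nrm_rest : norm2 mu (- psi2 + gamma *: psi3) <= (1 + gamma) * K * t.
Proof.
have P0 : 0 <= P by exact: norm2_ge0.
have b0 : 0 <= beta^-1 by rewrite invr_ge0 ltW.
apply: (le_trans (norm2_triangle (Lfun2N psi2L) (Lfun2Z _ psi3L))).
rewrite norm2N// norm2Z// gtr0_norm//.
apply: (le_trans (lerD nrm_psi2 (ler_wpM2l (ltW gamma_gt0) nrm_psi3))).
rewrite -subr_ge0 (_ : _ - _ = t * (gamma * M1 + M1 * P + beta^-1 * M2)); last by rewrite /K; ring.
by rewrite mulr_ge0 ?(ltW t_gt0)// !addr_ge0// mulr_ge0// ltW.
Qed.

(** The transport term has norm of order 1, but Gaussian integration by parts gives <p chi, chi> =
    (2 / beta) <chi', chi>, which is of order t. *)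
Let inner_psi1 : `|inner mu psi1 phi| <= 2 / beta * M1 * M0 * t.
Proof.
rewrite inner_tensor// normrM -[leRHS]mul1r ler_pM//.
  apply: (le_trans (inner_CS (Lfun2_nu beta cc) (Lfun2_nu beta cs))).
  by rewrite mulr_ile1 ?norm2_ge0.
have d2 p : is_derive p 1 (fun p => chi p * chi p) (2 * (chi' p * chi p)).
  by apply: is_derive_val (der_mul (dchi p) (dchi p)) _; ring.
have s2 : slow (fun p => 2 * (chi' p * chi p)).
  by apply: slow_mul; [exact: slow_cst|exact: slow_mul].
have := kappa_by_parts beta_gt0 d2 (slow_mul schi schi) s2.
rewrite RintegralZl//; last by apply: kappa_integrable => //; exact: slow_mul.
rewrite (_ : \int[kappa]_p (p * _) = inner kappa (fun p => p * chi p) chi); last first.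
  by apply: eq_Rintegral => p _; rewrite mulrA.
rewrite (_ : \int[kappa]_p _ = inner kappa chi' chi)// => e.
have -> : inner kappa (fun p => p * chi p) chi = 2 / beta * inner kappa chi' chi.
  by rewrite mulrAC e mulrAC mulfV ?mul1r// gt_eqF.
have b2 : 0 < 2 / beta by rewrite divr_gt0.
rewrite normrM (gtr0_norm b2) (_ : _ * t = 2 / beta * (t * M1 * M0)); last by ring.
rewrite ler_pM2l//.
apply: (le_trans (inner_CS (Lfun2_kappa beta_gt0 schi') (Lfun2_kappa beta_gt0 schi))).
rewrite ler_pM ?norm2_ge0// norm2_le_bound ?Lfun2_kappa//.
by rewrite mulr_ge0// ltW.
Qed.

Let gen_phiE : gen beta gamma phi = psi1 + (- psi2 + gamma *: psi3).
Proof. by rewrite gen_phi addrA. Qed.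

Let restL : - psi2 + gamma *: psi3 \in L2.
Proof. by apply: Lfun2D; [exact: Lfun2N|exact: Lfun2Z]. Qed.

Let gen_phiL : gen beta gamma phi \in L2.
Proof. by rewrite gen_phiE; exact: Lfun2D. Qed.

Let nrm_gen : norm2 mu (gen beta gamma phi) <= M0 * P + (1 + gamma) * K * t.
Proof.
by rewrite gen_phiE; apply: (le_trans (norm2_triangle psi1L restL)); exact: lerD.
Qed.

Let inner_gen : inner mu (- gen beta gamma phi) phi <=
  (2 / beta * M1 * M0 + (1 + gamma) * K * M0) * t.
Proof.
rewrite innerNl// gen_phiE innerDl// opprD mulrDl lerD//.
  by rewrite (le_trans _ inner_psi1)// -normrN ler_norm.
rewrite (le_trans (ler_norm _))// normrN (le_trans (inner_CS restL phiL))// mulrAC.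
by rewrite ler_pM ?norm2_ge0.
Qed.

Variables (A : (R * R -> R) -> R * R -> R) (eps lam : R).
Hypothesis hA : is_A beta A.
Hypothesis eps_gt0 : 0 < eps.
Hypothesis hypo : hypocoercive beta A gamma eps lam.

Let A_bound u v g : T_adj beta (u, v) -> u \in L2 -> g \in L2 ->
  inner mu (A u) g <= norm2 mu u / 2 * norm2 mu g.
Proof.
move=> /hA /A_graph_bound h uL gL; have [AL Ab] := h uL.
by apply: (le_trans (le_inner AL gL)); rewrite ler_wpM2r ?norm2_ge0.
Qed.

(** [is_A] constrains [A] only on the domain of the adjoint, so the test function, and then its
    image under the generator, must be placed there before [A] can be bounded. *)
Let adj_phi : exists g, T_adj beta (phi, g).
Proof.
eexists; apply: (T_adj_tensor beta_gt0 (@is_derive_sin R) cc _ schi).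
by have [s2 _] := @sin_cos_2pi R 1; rewrite -[pi *+ 2]mul1r s2 sin0.
Qed.

Let adj_gen_phi : exists g, T_adj beta (gen beta gamma phi, g).
Proof.
have [s2 c2] := @sin_cos_2pi R 1; rewrite mul1r in s2 c2.
have dss (q : R) : is_derive q 1 (fun q => sin q * sin q) (cos q * sin q + sin q * cos q).
  exact: der_mul.
eexists; rewrite gen_phi; apply: T_adjD; first apply: T_adjD.
- apply: (T_adj_tensor beta_gt0 (@is_derive_cos R) _ _ s1).
    exact: continuous_opp.
  by rewrite c2 cos0.
- rewrite -scaleN1r; apply: T_adjZ; apply: (T_adj_tensor beta_gt0 dss _ _ schi').
    by apply: continuous_add; exact: continuous_mul.
  by rewrite s2 sin0.
- apply: T_adjZ; apply: (T_adj_tensor beta_gt0 (@is_derive_sin R) cc _ s3).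
  by rewrite s2 sin0.
Qed.

(** Each term with [A] is at most half of |gen phi| |phi|, by the norm bound on [A]. As t tends to
    0, only eps M0 P M0 remains on the right. *)
Lemma rate_cutoff_bound : lam * (norm2 nu (@sin R) * norm2 kappa chi) ^+ 2 <=
  (2 / beta * M1 * M0 + (1 + gamma) * K * M0) * t
  + eps * ((M0 * P + (1 + gamma) * K * t) * M0).
Proof.
rewrite -norm2_tensor//.
have phiP : (Pi0 beta @` Cc_infty) phi by exists phi.
apply: (le_trans (hypo phiP)); rewrite -addrA lerD// -mulrDr ler_pM2l//.
have [g1 h1] := adj_phi; have [g2 h2] := adj_gen_phi.
apply: (le_trans (lerD (A_bound h2 gen_phiL phiL) (A_bound h1 phiL gen_phiL))).
have -> : norm2 mu (gen beta gamma phi) / 2 * norm2 mu phi +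
    norm2 mu phi / 2 * norm2 mu (gen beta gamma phi) = norm2 mu (gen beta gamma phi) * norm2 mu phi.
  by field.
by rewrite ler_pM ?norm2_ge0.
Qed.

(** The cut-off tends to the constant f 0 in L^2(kappa), since |f (t p) - f 0| <= M1 t |p|; its norm
    stays bounded below independently of t. *)
Lemma cutoff_norm_ge : M1 * P * t <= f 0 / 2 -> f 0 / 2 <= norm2 kappa chi.
Proof.
move=> small.
have lip (x : R) : `|f x - f 0| <= M1 * `|x|.
  have cf := is_derive_continuous df.
  have [x0|x0] := leP 0 x.
    have [c _ ->] := MVT_segment x0 (fun y _ => df y) (continuous_subspaceT cf).
    by rewrite subr0 normrM ler_wpM2r.
  have [c _ e] := MVT_segment (ltW x0) (fun y _ => df y) (continuous_subspaceT cf).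
  by rewrite distrC e sub0r normrM normrN ler_wpM2r.
have cL : (fun _ : R => f 0) \in Lfun kappa 2%:E by apply: Lfun2_kappa => //; exact: slow_cst.
have chiL : chi \in Lfun kappa 2%:E by exact: Lfun2_kappa.
have := norm2_triangle (Lfun2B cL chiL) chiL.
rewrite subrK norm2_cst gtr0_norm// => h.
suff : norm2 kappa ((fun _ : R => f 0) - chi) <= M1 * P * t.
  move=> h'; have -> : f 0 / 2 = f 0 - f 0 / 2 by rewrite {2}(splitr (f 0)) addrK.
  by rewrite lerBlDr (le_trans h)// addrC lerD2l (le_trans h').
rewrite (_ : _ * t = `|M1 * t| * P); last by rewrite ger0_norm ?mulr_ge0// ?(ltW t_gt0)// mulrAC.
rewrite -norm2Z; last exact: Lfun2_kappa.
apply: norm2_mono; [exact: Lfun2B|by apply: Lfun2Z; exact: Lfun2_kappa|].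
move=> p; rewrite [(_ *: _) p](_ : _ = M1 * (t * p)) ?mulrA//.
rewrite [(_ - _) p](_ : _ = f 0 - f (t * p))// distrC (le_trans (lip _))//.
by rewrite -mulrA [leRHS]normrM ger0_norm.
Qed.

End cutoff.

Lemma hypocoercive_rate_le (A : (R * R -> R) -> R * R -> R) : is_A beta A ->
  exists2 C, 0 < C & forall gamma eps lam, 0 < gamma -> 0 < eps ->
    hypocoercive beta A gamma eps lam -> lam <= C * eps.
Proof.
move=> hA; have [f [smooth_f f0 supp_f]] := @smooth_bump R.
have [_ [M0 fM0] [f' df [_ [M1 f'M1] [f'' df' [cf'' [M2 f''M2] _]]]]] := smooth_f 2%N.
have s0 := norm2_sin_gt0.
pose P := norm2 kappa idp; pose s := norm2 nu (@sin R).
have P0 : 0 <= P by exact: norm2_ge0.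
have M0_ge0 : 0 <= M0 by exact: le_trans (fM0 0).
have M1_ge0 : 0 <= M1 by exact: le_trans (f'M1 0).
have M2_ge0 : 0 <= M2 by exact: le_trans (f''M2 0).
pose K := M1 + M1 * P + beta^-1 * M2.
have K0 : 0 <= K by rewrite !addr_ge0// mulr_ge0// invr_ge0 ltW.
pose c := (s * (f 0 / 2)) ^+ 2.
have c0 : 0 < c by rewrite exprn_gt0// mulr_gt0// divr_gt0.
pose N := 1 + (M0 * P + 1) * M0.
have N0 : 0 < N by rewrite ltr_wpDr// mulr_ge0// addr_ge0// mulr_ge0.
exists (N / c); first exact: divr_gt0.
move=> gamma eps lam g0 e0 hypo.
pose D1 := 2 / beta * M1 * M0 + (1 + gamma) * K * M0.
have g1 : 0 <= 1 + gamma by rewrite addr_ge0// ltW.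
have D10 : 0 <= D1 by rewrite addr_ge0// !mulr_ge0// ?invr_ge0// ltW.
(* D dominates every coefficient of t, so t = m / D makes each product at most m; the summand 1
   gives t <= 1. D and m may depend on gamma and eps, whereas N / c does not. *)
pose D := 1 + D1 + (1 + gamma) * K + M1 * P.
have gK : 0 <= (1 + gamma) * K by exact: mulr_ge0.
have MP : 0 <= M1 * P by exact: mulr_ge0.
have D0 : 1 <= D.
  have := addr_ge0 (addr_ge0 D10 gK) MP; rewrite -(lerDl 1).
  by rewrite /D !addrA.
have Dpos : 0 < D by exact: lt_le_trans D0.
pose m := Num.min 1 (Num.min eps (f 0 / 2)).
have m0 : 0 < m by rewrite !lt_min ltr01 e0 divr_gt0.
pose t := m / D.
have t0 : 0 < t by exact: divr_gt0.
have tm (x y : R) : m <= y -> 0 <= x -> x <= D -> x * t <= y.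
  move=> my x0 xD; rewrite /t mulrA ler_pdivrMr// (le_trans (ler_wpM2r (ltW m0) xD))//.
  by rewrite mulrC ler_pM2r.
have m1 : m <= 1 by rewrite ge_min lexx.
have me : m <= eps by rewrite !ge_min lexx orbT.
have mf : m <= f 0 / 2 by rewrite !ge_min lexx !orbT.
have t1 : t <= 1 by rewrite -[t]mul1r tm.
have e1 : D1 * t <= eps by apply: tm => //; rewrite /D; lra.
have e2 : (1 + gamma) * K * t <= 1 by apply: tm => //; rewrite /D; lra.
have e3 : M1 * P * t <= f 0 / 2 by apply: tm => //; rewrite /D; lra.
have bnd := rate_cutoff_bound smooth_f supp_f df df' cf'' fM0 f'M1 f''M2 t0 t1 g0 hA e0 hypo.
have low := cutoff_norm_ge f0 df fM0 f'M1 t0 e3.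
rewrite mulrAC ler_pdivlMr//.
have [lam0|/ltW lam0] := leP lam 0.
  by rewrite (@le_trans _ _ 0) ?mulr_ge0 ?(ltW N0) ?(ltW e0)// mulr_le0_ge0 // ltW.
have : lam * c <= lam * (s * norm2 kappa (fun p => f (t * p))) ^+ 2.
  rewrite ler_wpM2l// lerXn2r ?nnegrE ?mulr_ge0 ?norm2_ge0 ?(ltW f0)//.
  by rewrite ler_pM2l.
move=> /le_trans/(_ bnd)/le_trans; apply.
rewrite [leRHS](_ : _ = eps + eps * ((M0 * P + 1) * M0)); last by rewrite /N; ring.
by rewrite lerD// ler_pM2l// ler_wpM2r// lerD2l.
Qed.

End rate_upper_bound.

Theorem proposition4 (R : realType) (beta : R) (beta_gt0 : 0 < beta)
    (A : (R * R -> R) -> (R * R -> R)) (hA : is_A beta A)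
    (epsbar lambar : R) (lamtilde : R -> R)
    (epsbar01 : 0 < epsbar < 1) (lambar_gt0 : 0 < lambar)
    (eps := fun gamma : R => epsbar * Num.min gamma gamma^-1)
    (lam := fun gamma : R => lamtilde gamma / (1 + eps gamma))
    (hlam : forall gamma : R, 0 < gamma ->
       [/\ 0 < lamtilde gamma,
           hypocoercive beta A gamma (eps gamma) (lamtilde gamma) &
           lambar * Num.min gamma gamma^-1 <= lam gamma]) :
  exists2 C : R, 1 <= C &
  forall gamma : R, 0 < gamma ->
  exists N : nat, forall K L : nat, (N <= K)%N -> (N <= L)%N ->
    Lhat_mx beta gamma K L \in unitmx /\
    exists S : (R * R -> R) -> (R * R -> R),
      inverse_on (V_KL0 beta K L) (gen_KL0 beta gamma K L) S /\
      exists lamhat : R,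
        [/\ 0 < lamhat,
            (op_norm (mu beta) (V_KL0 beta K L) S <= (C / lamhat)%:E)%E &
            lamhat >= lam gamma - eps gamma / (1 + eps gamma) *
              ((1 + Num.sqrt 2) * beta / (2 * K%:R)
               + beta ^+ 3 / 16
                 * (norm2 (mu beta) (cst1 - Pi_q beta K.-1 cst1) ^+ 2
                    / (1 - norm2 (mu beta) (cst1 - Pi_q beta K cst1) ^+ 2)))].
Proof.
have [C1 C1_gt0 [K0 stable]] := galerkin_stability beta_gt0.
have [C2 C2_gt0 rate] := hypocoercive_rate_le beta_gt0 hA.
exists (Num.max 1 (C1 * C2)); first by rewrite le_max lexx.
move=> gamma gamma_gt0; have [lt0 hypo _] := hlam gamma gamma_gt0.
have /andP[eb0 eb1] := epsbar01.
have min_gt0 : 0 < Num.min gamma gamma^-1 by rewrite lt_min gamma_gt0 invr_gt0.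
have max_gt0 : 0 < Num.max gamma gamma^-1 by rewrite lt_max gamma_gt0.
have eps_gt0 : 0 < eps gamma by exact: mulr_gt0.
have eps1_gt0 : 0 < 1 + eps gamma by rewrite addr_gt0.
have lam_gt0 : 0 < lam gamma by exact: divr_gt0.
(* lam <= lamtilde <= C2 eps, and eps <= min (gamma, 1/gamma) because epsbar < 1. *)
have lam_le : lam gamma <= C2 * Num.min gamma gamma^-1.
  rewrite ler_pdivrMr// (le_trans (rate _ _ _ gamma_gt0 eps_gt0 hypo))//.
  rewrite -mulrA ler_pM2l// /eps (le_trans (y := Num.min gamma gamma^-1))//.
    by rewrite ger_pMl// ltW.
  by rewrite ler_peMr ?(ltW min_gt0)// lerDl ltW.
have max_min : Num.max gamma gamma^-1 * Num.min gamma gamma^-1 = 1.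
  by have [_|_] := leP gamma gamma^-1; rewrite ?mulVf ?mulfV ?gt_eqF.
(* The maximum and the minimum of gamma and 1/gamma have product 1, so the upper bound on the rate
   turns the stability constant into a multiple of 1 / lam that is uniform in gamma. *)
have Cgamma : C1 * Num.max gamma gamma^-1 <= Num.max 1 (C1 * C2) / lam gamma.
  rewrite ler_pdivlMr// le_max; apply/orP; right.
  rewrite -mulrA ler_pM2l// (le_trans (ler_wpM2l (ltW max_gt0) lam_le))//.
  by rewrite mulrCA max_min mulr1.
(* The threshold 2 keeps the momentum mode 1, whose equation controls the mode 0. *)
exists (maxn K0 2) => K L; rewrite !geq_max => /andP[K0K K2] /andP[_ L2].
have L_gt0 : (0 < L)%N by exact: ltnW.
have [K_gt0 [one_neq0 st]] := stable gamma K L gamma_gt0 K0K L2.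
have C_ge0 : 0 <= C1 * Num.max gamma gamma^-1 by rewrite mulr_ge0// ltW.
split; first exact: (Lhat_unit beta_gt0 L_gt0 one_neq0 st).
exists (galerkin_inverse beta gamma K L); split.
  exact: (galerkin_inverse_on beta_gt0 L_gt0 one_neq0 st).
exists (lam gamma); split=> //.
  apply: le_trans (op_norm_galerkin_inverse beta_gt0 L_gt0 one_neq0 C_ge0 st) _.
  by rewrite lee_fin.
have b0 := ltW beta_gt0; have d0 := Pi_q_defect_le1 beta_gt0 K.
rewrite gerBl mulr_ge0 ?divr_ge0 ?(ltW eps_gt0) ?(ltW eps1_gt0)// addr_ge0//.
  by rewrite divr_ge0 ?mulr_ge0 ?addr_ge0 ?sqrtr_ge0 ?ler0n.
by rewrite mulr_ge0 ?divr_ge0 ?exprn_ge0 ?norm2_ge0 ?subr_ge0.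
Qed.
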